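(* Consider the discrete dynamical system $\mathbf{x}_{k+1}=\mathbf{f}(\mathbf{x}_k)=\mathbf{A}\mathbf{x}_k+\tilde{\mathbf{f}}(\mathbf{x}_k)$, $\mathbf{x}_k\in\mathbb{R}^n$, with $\mathbf{A}\in\mathbb{R}^{n\times n}$ and $\tilde{\mathbf{f}}(\mathbf{x})=o(|\mathbf{x}|)$. Assume the following. (A1) $\mathbf{x}=\mathbf{0}$ is a stable hyperbolic fixed point, i.e. the eigenvalues $\lambda_1,\dots,\lambda_n$ of $\mathbf{A}$ satisfy $$|\lambda_n|\le\dots\le|\lambda_{d+1}|<|\lambda_d|\le\dots\le|\lambda_1|<1 .$$ (A2) $\tilde{\mathbf{f}}\in C^2$ in a neighborhood of the origin. (A3) For some integer $d\in[1,n]$ (the same $d$ as in (A1)), a $d$-dimensional observable function $\boldsymbol{\phi}\in C^2$ and the $d$-dimensional slow spectral subspace $E$ of the hyperbolic fixed point $\mathbf{x}=\mathbf{0}$ satisfy the non-degeneracy condition $\mathrm{rank}\,[D\boldsymbol{\phi}(\mathbf{0})|_E]=d$. (A4) The data matrices $\boldsymbol{\Phi}$ and $\hat{\boldsymbol{\Phi}}$ collected from iterations of the system are non-degenerate and are dominated by data near $E$, i.e. $$\mathrm{rank}_{\mathrm{row}}\,\boldsymbol{\Phi}=d,\qquad |\mathbf{P}_F\mathbf{X}|,\ |\mathbf{P}_F\hat{\mathbf{X}}|\le|\mathbf{P}_E\mathbf{X}|^{1+\beta}$$ for some $\beta\in(0,1)$. Then the DMD computed from $\boldsymbol{\Phi}$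 and $\hat{\boldsymbol{\Phi}}$ yields a matrix $\boldsymbol{\mathcal{D}}$ that is locally topologically conjugate, with order $\mathcal{O}(|\mathbf{P}_E\mathbf{X}|^{\beta})$ error, to the linearized dynamics on a $d$-dimensional attracting spectral submanifold $\mathcal{W}(E)\in C^1$ tangent to $E$ at $\mathbf{x}=\mathbf{0}$. Specifically, $$\boldsymbol{\mathcal{D}}=D\boldsymbol{\phi}(\mathbf{0})\mathbf{T}_E\,\boldsymbol{\Lambda}_E\left(D\boldsymbol{\phi}(\mathbf{0})\mathbf{T}_E\right)^{-1}+\mathcal{O}\left(|\mathbf{P}_E\mathbf{X}|^{\beta}\right).$$ The spectral submanifold $\mathcal{W}(E)$ and its reduced dynamics are of class $C^1$ at the origin, and at least Hölder continuous in a neighborhood of the origin.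
   Context: Notation. $\mathbf{e}_1,\dots,\mathbf{e}_n$ are the generalized eigenvectors of $\mathbf{A}$ corresponding to $\lambda_1,\dots,\lambda_n$. The slow and fast spectral subspaces are $$E=\mathrm{span}\{\mathrm{Re}\,\mathbf{e}_1,\mathrm{Im}\,\mathbf{e}_1,\dots,\mathrm{Re}\,\mathbf{e}_d,\mathrm{Im}\,\mathbf{e}_d\}\quad(\dim E=d),\qquad F=\mathrm{span}\{\mathrm{Re}\,\mathbf{e}_{d+1},\mathrm{Im}\,\mathbf{e}_{d+1},\dots,\mathrm{Re}\,\mathbf{e}_n,\mathrm{Im}\,\mathbf{e}_n\}.$$ $\mathbf{T}=[\mathbf{T}_E,\mathbf{T}_F]$, where the columns of $\mathbf{T}_E\in\mathbb{R}^{n\times d}$ (resp. $\mathbf{T}_F\in\mathbb{R}^{n\times(n-d)}$) are the real and imaginary parts of the generalized right eigenvectors of $\mathbf{A}|_E$ (resp. $\mathbf{A}|_F$), forming a basis of $E$ (resp. $F$). The rows of $\mathbf{P}_E\in\mathbb{R}^{d\times n}$ (resp. $\mathbf{P}_F\in\mathbb{R}^{(n-d)\times n}$) are the real and imaginary parts of the generalized left eigenvectors of $\mathbf{A}$ associated with $E$ (resp. $F$). $\boldsymbol{\Lambda}_E=(\mathbf{T}^{-1}\mathbf{A}\mathbf{T})|_E\in\mathbb{R}^{d\times d}$, i.e. $\mathbf{A}\mathbf{T}_E=\mathbf{T}_E\boldsymbol{\Lambda}_E$. Data. $\mathbf{X}=[\mathbf{x}^1,\dots,\mathbf{x}^m]\in\mathbb{R}^{n\times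 m}$ is a matrix of $m$ initial conditions, $\hat{\mathbf{X}}=\mathbf{f}(\mathbf{X})$, $\boldsymbol{\Phi}=\boldsymbol{\phi}(\mathbf{X})$ and $\hat{\boldsymbol{\Phi}}=\boldsymbol{\phi}(\mathbf{f}(\mathbf{X}))\in\mathbb{R}^{d\times m}$, with $\mathbf{f}$ and $\boldsymbol{\phi}$ (which takes values in $\mathbb{R}^d$) applied column by column. $|\cdot|$ is the Euclidean norm (for matrices, the Euclidean matrix norm), and $\mathrm{rank}_{\mathrm{row}}$ is the row rank. DMD. The matrix $\boldsymbol{\mathcal{D}}\in\mathbb{R}^{d\times d}$ computed by dynamic mode decomposition (DMD) is the minimizer of $|\hat{\boldsymbol{\Phi}}-\boldsymbol{\mathcal{D}}\boldsymbol{\Phi}|^2$ given by $\boldsymbol{\mathcal{D}}=(\hat{\boldsymbol{\Phi}}\boldsymbol{\Phi}^{\mathrm{T}})(\boldsymbol{\Phi}\boldsymbol{\Phi}^{\mathrm{T}})^{\dagger}$, with $\dagger$ the pseudo-inverse. An attracting spectral submanifold $\mathcal{W}(E)$ is a $d$-dimensional invariant manifold through the fixed point, tangent to $E$ there, to which nearby trajectories converge exponentially. The $\mathcal{O}$ terms refer to the limit $|\mathbf{P}_E\mathbf{X}|\to0$ (data approaching the fixed point), with $\mathbf{f}$ and $\boldsymbol{\phi}$ fixed.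
   Formalization: The observable is assumed to satisfy φ(0)=0, and the error bound is C·cond(Φ)·|P_E X|^β, with cond(Φ)=|Φ||Φ†| and C independent of the data; without either change the stated O(|P_E X|^β) estimate is false. *)

(* Defs.v *)
(* MathComp / MathComp-Analysis, over an arbitrary R : realType;
   the complex numbers are R[i]. *)
From HB Require Import structures.
From mathcomp Require Import all_boot all_order all_algebra complex.
From mathcomp Require Import all_classical all_reals all_analysis.

Set Implicit Arguments.
Unset Strict Implicit.
Unset Printing Implicit Defensive.

Import Order.TTheory GRing.Theory Num.Theory numFieldNormedType.Exports.
Local Open Scope classical_set_scope.
Local Open Scope ring_scope.

Section Matrices.
Context {R : realType}.

(* Frobenius norm; on column vectors it is the Euclidean norm.  The norm `|M|
   of the library is the equivalent max norm. *)
Definition fnorm m n (M : 'M[R]_(m, n)) : R :=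
  Num.sqrt (\sum_i \sum_j M i j ^+ 2).

Definition moore_penrose m n (M : 'M[R]_(m, n)) (G : 'M[R]_(n, m)) : Prop :=
  [/\ M *m G *m M = M, G *m M *m G = G,
      (M *m G)^T = M *m G & (G *m M)^T = G *m M].

(* The Moore-Penrose inverse (the library's [pinvmx] is only a one-sided
   generalized inverse).  It exists and is unique for every real matrix, so the
   default value 0 is never used. *)
Definition pinv m n (M : 'M[R]_(m, n)) : 'M[R]_(n, m) :=
  xget 0 [set G | moore_penrose M G].

(* Scale invariant; equal to 1 for a nonzero matrix with a single row.  A rank
   condition alone does not control the error of a least-squares fit, whose
   implied constant is proportional to the condition number of the data. *)
Definition cond_number m n (M : 'M[R]_(m, n)) : R := fnorm M * fnorm (pinv M).

Definition colwise n d m (g : 'cV[R]_n -> 'cV[R]_d) (X : 'M[R]_(n, m))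
    : 'M[R]_(d, m) :=
  \matrix_(i, j) g (col j X) i 0.

Definition dmd d m (Phi Phihat : 'M[R]_(d, m)) : 'M[R]_d :=
  (Phihat *m Phi^T) *m pinv (Phi *m Phi^T).

End Matrices.

Section Spectral.
Context {R : realType}.

Definition cplx m n (M : 'M[R]_(m, n)) : 'M[R[i]]_(m, n) :=
  map_mx (real_complex R) M.

Definition re_mx m n (M : 'M[R[i]]_(m, n)) : 'M[R]_(m, n) :=
  map_mx (@complex.Re R) M.

Definition im_mx m n (M : 'M[R[i]]_(m, n)) : 'M[R]_(m, n) :=
  map_mx (@complex.Im R) M.

Definition gen_right_eigenvector n (A : 'M[R]_n) (a : R[i]) (v : 'cV[R[i]]_n) :=
  v != 0 /\ exists k : nat, ((cplx A - a%:M) ^+ k) *m v = 0.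

Definition gen_left_eigenvector n (A : 'M[R]_n) (a : R[i]) (w : 'rV[R[i]]_n) :=
  w != 0 /\ exists k : nat, w *m ((cplx A - a%:M) ^+ k) = 0.

(* [lam] lists the eigenvalues of A with algebraic multiplicity, and the
   columns of [e] are a basis of C^n of generalized eigenvectors. *)
Definition gen_eigenbasis n (A : 'M[R]_n) (lam : 'I_n -> R[i])
    (e : 'M[R[i]]_n) : Prop :=
  [/\ char_poly (cplx A) = \prod_(i < n) ('X - (lam i)%:P),
      e \in unitmx
    & forall i, gen_right_eigenvector A (lam i) (col i e)].

(* The span of Re e_i and Im e_i for i < d.  Following the library, a subspace
   of R^n is the row space of a matrix, so column vectors are transposed. *)
Definition slow_subspace n (d : nat) (e : 'M[R[i]]_n) : 'M[R]_n :=
  (\sum_(i < n | (i < d)%N)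
     ((re_mx (col i e))^T + (im_mx (col i e))^T))%MS.

Definition right_spectral_basis n (A : 'M[R]_n) (lam : 'I_n -> R[i])
    (J : pred 'I_n) q (T : 'M[R]_(n, q)) : Prop :=
  row_free T^T /\
  forall k : 'I_q, exists i v,
    [/\ J i, gen_right_eigenvector A (lam i) v
      & col k T = re_mx v \/ col k T = im_mx v].

Definition left_spectral_basis n (A : 'M[R]_n) (lam : 'I_n -> R[i])
    (J : pred 'I_n) q (P : 'M[R]_(q, n)) : Prop :=
  row_free P /\
  forall k : 'I_q, exists i w,
    [/\ J i, gen_left_eigenvector A (lam i) w
      & row k P = re_mx w \/ row k P = im_mx w].

End Spectral.

Section Smoothness.
Context {R : realType}.

(* [U] is meant to be open.  In finite dimension, continuity of all the
   directional derivatives x |-> 'd g x v amounts to continuity of x |-> 'd g x. *)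
Fixpoint Ck (V W : normedModType R) (k : nat) (U : set V) (g : V -> W) : Prop :=
  match k with
  | 0%N => forall x, U x -> {for x, continuous g}
  | k'.+1 => (forall x, U x -> differentiable g x) /\
             (forall v, Ck k' U (fun x => 'd g x v))
  end.

Definition Ck_near (V W : normedModType R) (k : nat) (p : V) (g : V -> W) :=
  exists2 U : set V, open_nbhs p U & Ck k U g.

Definition holder_near (V W : normedModType R) (p : V) (g : V -> W) :=
  exists (a C : R) (U : set V), [/\ 0 < a <= 1, nbhs p U &
    forall x y, U x -> U y -> `|g x - g y| <= C * `|x - y| `^ a].

(* Jacobian matrix for column vectors ([jacobian] is for row vectors). *)
Definition jac n m (g : 'cV[R]_n -> 'cV[R]_m) (p : 'cV[R]_n) : 'M[R]_(m, n) :=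
  \matrix_(i, j) ('d g p (delta_mx j 0)) i 0.

End Smoothness.

Section Dynamics.
Context {R : realType}.

Definition locally_topologically_conjugate d (g h : 'cV[R]_d -> 'cV[R]_d) :=
  exists (U V : set 'cV[R]_d) (k l : 'cV[R]_d -> 'cV[R]_d),
    [/\ open_nbhs (0 : 'cV[R]_d) U /\ open_nbhs (0 : 'cV[R]_d) V,
        k 0 = 0,
        (forall x, U x -> [/\ V (k x), l (k x) = x & {for x, continuous k}]),
        (forall y, V y -> [/\ U (l y), k (l y) = y & {for y, continuous l}])
      & forall x, U x -> U (g x) -> k (g x) = h (k x)].

(* W is a (local) d-dimensional C^1 submanifold through 0, given by the
   parametrization gam : O -> W. *)
Record C1_embedded n d (W : set 'cV[R]_n) (O : set 'cV[R]_d)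
    (gam : 'cV[R]_d -> 'cV[R]_n) : Prop := {
  emb_open : open_nbhs (0 : 'cV[R]_d) O;
  emb_origin : gam 0 = 0;
  emb_image : W = gam @` O;
  emb_C1 : Ck 1 O gam;
  emb_immersion : forall u, O u -> \rank (jac gam u) = d;
  emb_homeo : exists chi : 'cV[R]_n -> 'cV[R]_d,
    {within W, continuous chi} /\ (forall u, O u -> chi (gam u) = u) }.

Definition exponentially_attracting n (f : 'cV[R]_n -> 'cV[R]_n)
    (W : set 'cV[R]_n) : Prop :=
  exists (U : set 'cV[R]_n) (C q : R),
    [/\ nbhs (0 : 'cV[R]_n) U, 0 < q < 1 &
      forall x, U x -> forall k : nat,
        exists2 w, W w & fnorm (iter k f x - w) <= C * q ^+ k].

(* W is an attracting spectral submanifold tangent at 0 to the row space E, and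
   r is its reduced dynamics (f restricted to W) in the coordinates gam.  As W
   is local, invariance is forward invariance.  [Ck 1 O] on the open O gives
   class C^1 at the origin. *)
Record attracting_SSM n d (f : 'cV[R]_n -> 'cV[R]_n) (E : 'M[R]_n)
    (W : set 'cV[R]_n) (O : set 'cV[R]_d) (gam : 'cV[R]_d -> 'cV[R]_n)
    (r : 'cV[R]_d -> 'cV[R]_d) : Prop := {
  ssm_embedded : C1_embedded W O gam;
  ssm_tangent : ((jac gam 0)^T == E)%MS;
  ssm_invariant : forall x, W x -> W (f x);
  ssm_attracting : exponentially_attracting f W;
  ssm_reduced : forall u, O u -> O (r u) /\ f (gam u) = gam (r u);
  ssm_reduced_C1 : Ck 1 O r;
  ssm_holder : holder_near (0 : 'cV[R]_d) gam;
  ssm_reduced_holder : holder_near (0 : 'cV[R]_d) r }.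

End Dynamics.

(* Main.v *)
(** Split R^n = E + F and write points as [T1 u + T2 v].  Let [B] and [L2] be the
    matrices of A on E and F; in suitable norms [|B u| >= a |u|] and
    [|L2 v| <= b |v|] with [b < a < 1].  The slow manifold is a graph [v = h u]
    with [h (B u + P1 (eta w)) = L2 (h u) + P2 (eta w)], [w = T1 u + T2 (h u)], where
    [eta] is a global extension of the germ of [ft] with a small Lipschitz constant.
    As [b < a `^ (1 + al)] for small [al > 0], the graph transform preserves the
    graphs such that for each [x] some linear [L] satisfies
    [|h y - h x - L (y - x)| <= M |y - x| `^ (1 + al)] for all [y].  This condition
    survives pointwise limits, so the limit of the iterated transforms of [0] is at
    once invariant and of class C^1.  Exponential attraction holds because the
    manifold contains the exponentially stable fixed point.

    For DMD, [D - D0 = (Phihat - D0 Phi) pinv Phi].  With [p = |PE X|], the first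
    factor is [O(p `^ (1 + beta))] because the contributions of E cancel, whereas
    [|Phi| >= c p] because [jac phi 0] is invertible on E. *)

Require Import Defs.
From HB Require Import structures.
From mathcomp Require Import all_boot all_order all_algebra complex.
From mathcomp Require Import all_classical all_reals all_analysis.
From mathcomp Require Import ring lra.

Set Implicit Arguments.
Unset Strict Implicit.
Unset Printing Implicit Defensive.

Import Order.TTheory GRing.Theory Num.Theory numFieldNormedType.Exports.
Local Open Scope classical_set_scope.
Local Open Scope ring_scope.

(** * Norms *)

(** The spectral data are complex but the splitting is real. All eigenvalues are separated by
    modulus, so an eigenvalue and its conjugate lie on the same side of the gap. The rows of [PE]
    need not be dual to the columns of [TE]: only [PE = H P1] holds, with [H] invertible and [P1]
    the left inverse of [TE] that kills the fast generalized eigenvectors.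

    [A] may have Jordan blocks, so the bounds [a] and [b] hold only in norms that absorb polynomial
    growth. It may also be singular: for [d < n] the gap makes the slow block invertible, and no
    other block is inverted. For [d = n] there is neither a fast eigenvalue to place [b] nor a
    guarantee that [B] is invertible; the fiber is then trivial and the zero graph is used.

    The graph transform needs estimates at all points and all distances, while the smoothness of
    [ft] is local. The nonlinearity is precomposed with a bounded C^1 map rather than multiplied by
    a bump. Its Taylor remainder is then globally at most quadratic, and at most linear because of
    the Lipschitz bound; together these give the power [1 + al] for any [al] in (0, 1). *)

Section MatrixNorm.
Context {R : realType}.

Lemma mx_norm_le m n (M : 'M[R]_(m, n)) c :
  0 <= c -> (forall i j, `|M i j| <= c) -> `|M| <= c.
Proof.
move=> c0 H; have [->|M0] := eqVneq M 0; first by rewrite normr0.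
have /mx_norm_neq0 [[i j] /= E] : mx_norm M != 0.
  by apply: contra_neq M0 => /mx_norm_eq0.
by rewrite /Num.norm /= E.
Qed.

Lemma mx_norm_ge m n (M : 'M[R]_(m, n)) i j : `|M i j| <= `|M|.
Proof.
rewrite /Num.norm /= mx_normrE.
by apply: (le_trans _ (le_bigmax _ _ (i, j))).
Qed.

Lemma mulmx_norm_le m n p (M : 'M[R]_(m, n)) (B : 'M[R]_(n, p)) :
  `|M *m B| <= n%:R * `|M| * `|B|.
Proof.
apply: mx_norm_le => [|i j]; first by rewrite !mulr_ge0.
rewrite mxE (le_trans (ler_norm_sum _ _ _)) //.
rewrite -mulrA mulr_natl -[n in _ *+ n]card_ord -sumr_const ler_sum // => k _.
by rewrite normrM ler_pM // mx_norm_ge.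
Qed.

Lemma mulmx_bound m n (M : 'M[R]_(m, n)) :
  exists2 K : R, 0 < K & forall x : 'cV[R]_n, `|M *m x| <= K * `|x|.
Proof.
exists (n%:R * `|M| + 1); first by rewrite ltr_wpDl // mulr_ge0.
by move=> x; rewrite (le_trans (mulmx_norm_le _ _)) // ler_wpM2r // lerDl.
Qed.

Lemma cvg_mulmx m n p (M : 'M[R]_(m, n)) (T : Type) (F : set_system T)
    {FF : Filter F} (u : T -> 'M[R]_(n, p)) l :
  u @ F --> l -> (fun t => M *m u t) @ F --> M *m l.
Proof.
move=> ul; have K0 : 0 < n%:R * `|M| + 1 by rewrite ltr_wpDl // mulr_ge0.
apply/cvgrPdist_le => e e0.
move/cvgrPdist_le: ul => /(_ (e / (n%:R * `|M| + 1))).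
rewrite divr_gt0 // => /(_ isT); apply: filterS => t.
rewrite ler_pdivlMr // mulrC => H; rewrite -mulmxBr.
apply: le_trans (mulmx_norm_le _ _) (le_trans _ H).
by rewrite ler_wpM2r // lerDl.
Qed.

Lemma mulmx_continuous m n p (M : 'M[R]_(m, n)) :
  continuous (fun x : 'M[R]_(n, p) => M *m x).
Proof. by move=> x; apply: (@cvg_mulmx _ _ _ M _ (nbhs x) _ id x). Qed.

Lemma geometric_cvg n (u : nat -> 'cV[R]_n) (C q : R) :
  0 <= q < 1 -> (forall k, `|u k.+1 - u k| <= C * q ^+ k) ->
  cvgn u.
Proof.
move=> /andP[q0 q1] H.
have q1' : 0 < 1 - q by rewrite subr_gt0.
have C0 : 0 <= C by have := H 0; rewrite expr0 mulr1; apply: le_trans.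
have D k j : `|u (k + j)%N - u k| <= C / (1 - q) * q ^+ k.
  (* The exact geometric sum is a bound that can be proved by induction on [j]. *)
  suff : `|u (k + j)%N - u k| <= C / (1 - q) * (q ^+ k - q ^+ (k + j)).
    move=> /le_trans; apply; apply: ler_wpM2l.
      by rewrite divr_ge0 // ltW.
    by rewrite lerBlDr lerDl exprn_ge0.
  elim: j => [|j IH]; first by rewrite addn0 !subrr normr0 mulr0.
  rewrite addnS -(subrKA (u (k + j)%N)) (le_trans (ler_normD _ _)) //.
  apply: le_trans (lerD (H _) IH) _.
  rewrite exprS -subr_ge0; set A := q ^+ k; set B := q ^+ (k + j).
  rewrite [X in 0 <= X](_ : _ = 0) //; field; exact: lt0r_neq0.
apply: cauchy_cvg; apply: cauchy_exP => e e0.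
have /cvgrPdist_lt /(_ e e0) : (fun k => C / (1 - q) * q ^+ k) @ \oo --> (0 : R).
  rewrite -(mulr0 (C / (1 - q))); apply: cvgMl_tmp; apply: cvg_expr.
  by rewrite ger0_norm.
move=> [N _ HN]; have {HN} := HN N (leqnn _); rewrite /= sub0r normrN => HN.
exists (u N); exists N => // k /= Nk; rewrite mx_norm_ball /ball_ /= distrC.
rewrite -(subnKC Nk) (le_lt_trans (D _ _)) //.
exact: le_lt_trans (ler_norm _) HN.
Qed.

End MatrixNorm.

Section EquivalentNorms.
Context {R : realType}.

(** The lower comparison constant is normalized to 1, which the adapted norm attains through its
    term [k = 0]; positivity and definiteness then come from the library norm. *)
Record equiv_norm n (N : 'cV[R]_n -> R) (C : R) : Prop := {
  equiv_normD : forall x y, N (x + y) <= N x + N y;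
  equiv_normN : forall x, N (- x) = N x;
  equiv_norm_ge : forall x, `|x| <= N x;
  equiv_norm_le : forall x, N x <= C * `|x| }.

Variables (n : nat) (N : 'cV[R]_n -> R) (C : R).
Hypothesis hN : equiv_norm N C.

Lemma equiv_norm_ge0 x : 0 <= N x.
Proof. exact: le_trans (equiv_norm_ge hN x). Qed.

Lemma equiv_norm0 : N 0 = 0.
Proof.
apply/eqP; rewrite eq_le equiv_norm_ge0 andbT.
by rewrite (le_trans (equiv_norm_le hN 0)) // normr0 mulr0.
Qed.

Lemma equiv_norm0_eq0 x : N x <= 0 -> x = 0.
Proof.
by move=> x0; apply/eqP; rewrite -normr_le0 (le_trans (equiv_norm_ge hN x)).
Qed.

Lemma equiv_normC x y : N (x - y) = N (y - x).
Proof. by rewrite -opprB (equiv_normN hN). Qed.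

Lemma equiv_normB x y : N (x - y) <= N x + N y.
Proof. by rewrite -(equiv_normN hN y) (equiv_normD hN). Qed.

Lemma equiv_norm_lipschitz x y : N x - N y <= N (x - y).
Proof. by rewrite lerBlDr (le_trans _ (equiv_normD hN _ _)) // subrK. Qed.

Lemma equiv_norm_cvg (T : Type) (F : set_system T) {FF : Filter F}
  (u : T -> 'cV[R]_n) l : u @ F --> l -> (fun t => N (u t)) @ F --> N l.
Proof.
move=> ul; have K0 : 0 < `|C| + 1 by rewrite ltr_wpDl.
apply/cvgrPdist_le => e e0.
move/cvgrPdist_le: ul => /(_ (e / (`|C| + 1))).
rewrite divr_gt0 // => /(_ isT); apply: filterS => t.
rewrite ler_pdivlMr // mulrC => H.
have {}H : N (l - u t) <= e.
  apply: le_trans (equiv_norm_le hN _) (le_trans _ H).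
  by rewrite ler_wpM2r // (le_trans (ler_norm _)) // lerDl.
rewrite ler_norml lerNl opprB !(le_trans _ H) //.
  exact: equiv_norm_lipschitz.
by rewrite equiv_normC; exact: equiv_norm_lipschitz.
Qed.

End EquivalentNorms.

(** * Spectral estimates and the invariant splitting *)

Section SpectralBound.
Context {R : realType}.
Local Notation CR := R[i].

(* With [w = (M - mu) v], the norms [s K] of [M ^+ K v] satisfy
   [s K.+1 <= |mu| s K + |M ^+ K w|], and [w] is handled by induction on [k]. *)
Lemma gen_eigenvector_growth q (M : 'M[CR]_q) (mu b : CR) k (v : 'cV[CR]_q) :
  0 < b -> `|mu| < b -> (M - mu%:M) ^+ k *m v = 0 ->
  exists2 C : CR, 0 <= C &
    forall K, \sum_i `|(M ^+ K *m v) i 0| <= C * b ^+ K.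
Proof.
move=> b0 mub; have d0 : 0 < b - `|mu| by rewrite subr_gt0.
elim: k v => [|k IH] v.
  rewrite expr0 mul1mx => ->; exists 0 => // K.
  by rewrite mulmx0 mul0r big1 // => i _; rewrite mxE normr0.
rewrite exprSr -mulmxA => /IH [C1 C10 H1].
have s0 : 0 <= \sum_i `|v i 0| by rewrite sumr_ge0.
pose C := \sum_i `|v i 0| + C1 / (b - `|mu|).
have C0 : 0 <= C by rewrite addr_ge0 // divr_ge0 // ltW.
exists C => //.
have HC : C1 + `|mu| * C <= C * b.
  rewrite -lerBrDr mulrC -mulrBl /C mulrDr [_ * (C1 / _)]mulrC divfK ?lt0r_neq0 //.
  by rewrite lerDr mulr_ge0 // ltW.
elim=> [|K IHK].
  by rewrite !expr0 mul1mx mulr1 lerDl divr_ge0 // ltW.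
have -> : M ^+ K.+1 *m v = M ^+ K *m ((M - mu%:M) *m v) + mu *: (M ^+ K *m v).
  rewrite exprSr -mulmxA mulmxBl mulmxBr mul_scalar_mx.
  by rewrite -scalemxAr subrK.
apply: (@le_trans _ _ (C1 * b ^+ K + `|mu| * (C * b ^+ K))).
  apply: le_trans (lerD (H1 K) (ler_wpM2l (normr_ge0 mu) IHK)).
  rewrite mulr_sumr -big_split ler_sum // => i _.
  have -> (x y : 'cV[CR]_q) : (x + mu *: y) i 0 = x i 0 + mu * y i 0.
    by rewrite !mxE.
  by rewrite (le_trans (ler_normD _ _)) // normrM.
by rewrite exprS !mulrA -mulrDl ler_wpM2r // exprn_ge0 // ltW.
Qed.

Lemma cplxE m n (M : 'M[R]_(m, n)) i j : cplx M i j = (M i j)%:C%C.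
Proof. by rewrite mxE. Qed.

Lemma cplxM m n p (M : 'M[R]_(m, n)) (B : 'M[R]_(n, p)) :
  cplx (M *m B) = cplx M *m cplx B.
Proof. exact: map_mxM. Qed.

Lemma cplx_exp n (M : 'M[R]_n) K : cplx (M ^+ K) = cplx M ^+ K.
Proof.
elim: K => [|K IH]; first by rewrite !expr0 [LHS]map_mx1.
by rewrite !exprS -IH; exact: cplxM.
Qed.

Lemma normC_real (x : R) : `|x%:C%C| = `|x|%:C%C.
Proof. by rewrite normc_def /= expr0n addr0 sqrtr_sqr. Qed.

(** As [W V = 1], a vector is [x = W (V x)], a combination of the columns of [W] with coefficients
    bounded by [|x|], and each column grows at most like [b ^+ K]. [W] may be rectangular: it will
    be the image of a full eigenbasis under a projection onto one block, where some columns
    vanish. *)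
Lemma spectral_growth q (M : 'M[R]_q) (b : R) N (W : 'M[CR]_(q, N))
    (V : 'M[CR]_(N, q)) :
  0 < b -> W *m V = 1%:M ->
  (forall j, exists mu k, `|mu| < b%:C%C /\
     (cplx M - mu%:M) ^+ k *m col j W = 0) ->
  exists2 C : R, 0 < C &
    forall K (x : 'cV[R]_q), `|M ^+ K *m x| <= C * b ^+ K * `|x|.
Proof.
move=> b0 WV H; have bC0 : 0 < b%:C%C :> CR by rewrite ltcR.
have /choice[Cj HCj] : forall j : 'I_N, exists c : CR, 0 <= c /\ forall K,
    \sum_i `|(cplx M ^+ K *m col j W) i 0| <= c * b%:C%C ^+ K.
  move=> j.
  have [mu [k [mub E]]] := H j.
  by have [C C0 HC] := gen_eigenvector_growth bC0 mub E; exists C.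
pose S := \sum_j Cj j * \sum_l `|V j l|.
have S0 : 0 <= S.
  by rewrite sumr_ge0 // => j _; rewrite mulr_ge0 ?sumr_ge0 //; case: (HCj j).
have [s Es] : exists s, S = s%:C%C.
  exists (complex.Re S); move: S0; case: (S) => x y /=.
  by rewrite lecE /= => /andP[/eqP -> _].
have s0 : 0 <= s by rewrite -(@lecR R) -Es.
exists (s + 1); first by rewrite ltr_wpDl.
move=> K x; apply: (@le_trans _ _ (s * b ^+ K * `|x|)); last first.
  by rewrite ler_wpM2r // ler_wpM2r ?exprn_ge0 1?ltW // ltrDl.
apply: mx_norm_le => [|i j]; first by rewrite !mulr_ge0 // exprn_ge0 // ltW.
rewrite -(@lecR R) -normC_real !rmorphM /= -Es ord1 -cplxE cplxM cplx_exp.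
rewrite rmorphXn /=.
rewrite -(mul1mx (cplx x)) -WV -mulmxA mulmxA mxE.
rewrite (le_trans (ler_norm_sum _ _ _)) // /S !mulr_suml ler_sum // => k _.
rewrite normrM.
have -> : (cplx M ^+ K *m W) i k = (cplx M ^+ K *m col k W) i 0.
  by rewrite [LHS]mxE [RHS]mxE; apply: eq_bigr => l _; rewrite [col k W l 0]mxE.
have [Ck0 /(_ K) HK] := HCj k.
rewrite [Cj k * _ * _]mulrAC -[leRHS]mulrA ler_pM //.
  apply: le_trans HK; rewrite (bigD1 i) //= lerDl sumr_ge0 //.
rewrite mulr_suml mxE (le_trans (ler_norm_sum _ _ _)) // ler_sum // => l _.
rewrite normrM ler_wpM2l // cplxE normC_real lecR; exact: mx_norm_ge.
Qed.

(* The norm is [sup_k b ^- k |M ^+ k x|]. *)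
Lemma adapted_norm q (M : 'M[R]_q) (b : R) N (W : 'M[CR]_(q, N))
    (V : 'M[CR]_(N, q)) :
  0 < b -> W *m V = 1%:M ->
  (forall j, exists mu k, `|mu| < b%:C%C /\
     (cplx M - mu%:M) ^+ k *m col j W = 0) ->
  exists Nm C, [/\ 0 < C, equiv_norm Nm C & forall x, Nm (M *m x) <= b * Nm x].
Proof.
move=> b0 WV H; have [C C0 HC] := spectral_growth b0 WV H.
pose t (x : 'cV[R]_q) k := b ^- k * `|M ^+ k *m x|.
have tC x k : t x k <= C * `|x|.
  rewrite /t mulrC ler_pdivrMr ?exprn_gt0 // mulrAC; exact: HC.
have ub x : has_ubound (range (t x)).
  by exists (C * `|x|) => _ [k _ <-].
have hs x : has_sup (range (t x)) by split; [exists (t x 0); exists 0|exact: ub].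
pose Nm x := sup (range (t x)).
have tN x k : t x k <= Nm x by apply: ub_le_sup => //; exists k.
have Nle x c : (forall k, t x k <= c) -> Nm x <= c.
  by move=> h; apply: ge_sup; [exists (t x 0); exists 0|move=> _ [k _ <-]].
exists Nm, C; split => //.
- split.
  + move=> x y; apply: Nle => k.
    apply: le_trans (lerD (tN x k) (tN y k)).
    by rewrite /t -mulrDr mulmxDr ler_wpM2l ?ler_normD // invr_ge0 exprn_ge0 // ltW.
  + move=> x; rewrite /Nm; have -> // : t (- x) = t x.
    by apply/funext => k; rewrite /t mulmxN normrN.
  + by move=> x; apply: le_trans (tN x 0); rewrite /t expr0 invr1 mul1r expr0 mul1mx.
  + by move=> x; exact: Nle.
- move=> x; apply: Nle => k.
  rewrite -ler_pdivrMl //; apply: le_trans (tN x k.+1).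
  by rewrite /t mulrA -invfM -exprS mulmxA -[M ^+ k *m M]exprSr.
Qed.

End SpectralBound.

Section SpectralSplitting.
Context {R : realType}.
Local Notation CR := R[i].

(** Double induction on the two nilpotency indices: [(b - a) w v = w (A - a) v - w (A - b) v], where
    the first term lowers the index of [w] and the second that of [v]. *)
Lemma gen_eigenvector_annihilate n (A : 'M[CR]_n) (a b : CR) k l
    (w : 'rV[CR]_n) (v : 'cV[CR]_n) :
  a != b -> w *m (A - a%:M) ^+ k = 0 -> (A - b%:M) ^+ l *m v = 0 ->
  w *m v = 0.
Proof.
move=> ab; elim: k l w v => [|k IHk] l w v.
  by rewrite expr0 mulmx1 => -> _; rewrite mul0mx.
move=> wk; elim: l v => [|l IHl] v.
  by rewrite expr0 mul1mx => ->; rewrite mulmx0.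
move=> vl.
have wa : w *m (A - a%:M) *m v = 0.
  by apply: IHk vl; rewrite -mulmxA; move: wk; rewrite exprS.
have wb : w *m ((A - b%:M) *m v) = 0.
  by apply: IHl; rewrite mulmxA; move: vl; rewrite exprSr.
have E : (b - a) *: (w *m v) = 0.
  transitivity (w *m (A - a%:M) *m v - w *m ((A - b%:M) *m v)).
    rewrite -mulmxA -mulmxBr -mulmxBl scalemxAr; congr (w *m _).
    by rewrite -mul_scalar_mx opprB [_ + (_ - A)]addrC subrKA raddfB.
  by rewrite wa wb subrr.
apply/eqP; move/eqP: E; rewrite scaler_eq0 => /orP[|//].
by rewrite subr_eq0 eq_sym (negPf ab).
Qed.

Definition conj_mx m n (M : 'M[CR]_(m, n)) := map_mx (@conjc R) M.

Lemma conj_mxM m n p (M : 'M[CR]_(m, n)) (B : 'M[CR]_(n, p)) :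
  conj_mx (M *m B) = conj_mx M *m conj_mx B.
Proof. exact: map_mxM. Qed.

Lemma conj_gen_eigenvector n (A : 'M[R]_n) (b : CR) l (v : 'cV[CR]_n) :
  (cplx A - b%:M) ^+ l *m v = 0 ->
  (cplx A - (conjc b)%:M) ^+ l *m conj_mx v = 0.
Proof.
move=> /(congr1 (@conj_mx n 1)); rewrite conj_mxM [conj_mx 0]map_mx0 => <-.
congr (_ *m _).
have E : conj_mx (cplx A - b%:M) = cplx A - (conjc b)%:M.
  rewrite /conj_mx map_mxB map_scalar_mx; congr (_ - _).
  by apply/matrixP => i j; rewrite !mxE /= oppr0.
elim: l => [|l IH]; first by rewrite !expr0 [RHS]map_mx1.
by rewrite !exprS [RHS]conj_mxM E IH.
Qed.

Lemma normc_conj (b : CR) : `|conjc b| = `|b|.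
Proof. by case: b => x y; rewrite !normc_def /= sqrrN. Qed.

Lemma re_mxM m n p (M : 'M[CR]_(m, n)) (B : 'M[CR]_(n, p)) :
  re_mx (M *m B) = re_mx M *m re_mx B - im_mx M *m im_mx B.
Proof.
apply/matrixP => i j; rewrite !mxE raddf_sum -sumrB; apply: eq_bigr => k _.
by rewrite !mxE; case: (M i k) (B k j) => [a b] [c e].
Qed.

Lemma im_mxM m n p (M : 'M[CR]_(m, n)) (B : 'M[CR]_(n, p)) :
  im_mx (M *m B) = re_mx M *m im_mx B + im_mx M *m re_mx B.
Proof.
apply/matrixP => i j; rewrite !mxE raddf_sum -big_split; apply: eq_bigr => k _.
by rewrite !mxE; case: (M i k) (B k j) => [a b] [c e].
Qed.

Lemma re_mx_conj m n (M : 'M[CR]_(m, n)) : re_mx (conj_mx M) = re_mx M.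
Proof. by apply/matrixP => i j; rewrite !mxE; case: (M i j). Qed.

Lemma im_mx_conj m n (M : 'M[CR]_(m, n)) : im_mx (conj_mx M) = - im_mx M.
Proof. by apply/matrixP => i j; rewrite !mxE; case: (M i j). Qed.

Lemma re_im_mx_eq m n (M B : 'M[CR]_(m, n)) :
  re_mx M = re_mx B -> im_mx M = im_mx B -> M = B.
Proof.
move=> /matrixP re /matrixP im; apply/matrixP => i j.
move: (re i j) (im i j); rewrite !mxE.
by case: (M i j) (B i j) => [a b] [c e] /= -> ->.
Qed.

Lemma re_mx_cplx m n (M : 'M[R]_(m, n)) : re_mx (cplx M) = M.
Proof. by apply/matrixP => i j; rewrite !mxE. Qed.

Lemma im_mx_cplx m n (M : 'M[R]_(m, n)) : im_mx (cplx M) = 0.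
Proof. by apply/matrixP => i j; rewrite !mxE. Qed.

Lemma cplx_mulmx0 m n p (M : 'M[R]_(m, n)) (B : 'M[CR]_(n, p)) :
  M *m re_mx B = 0 -> M *m im_mx B = 0 -> cplx M *m B = 0.
Proof.
move=> re im; apply: re_im_mx_eq.
  by rewrite re_mxM re_mx_cplx im_mx_cplx re mul0mx subr0 [RHS]map_mx0.
by rewrite im_mxM re_mx_cplx im_mx_cplx im mul0mx addr0 [RHS]map_mx0.
Qed.

Lemma addsub_eq0 m n (P Q : 'M[R]_(m, n)) :
  P - Q = 0 -> P + Q = 0 -> P = 0 /\ Q = 0.
Proof.
move=> /subr0_eq ->; rewrite -mulr2n -scaler_nat => /eqP.
by rewrite scaler_eq0 pnatr_eq0 /= => /eqP ->.
Qed.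

(** The real parts of the two equations are the difference and the sum of [re w re v] and
    [im w im v], so both products vanish; the imaginary parts treat the mixed products in the same
    way. *)
Lemma annihilate_re_im m n p (w : 'M[CR]_(m, n)) (v : 'M[CR]_(n, p)) :
  w *m v = 0 -> w *m conj_mx v = 0 ->
  (re_mx w *m re_mx v = 0 /\ re_mx w *m im_mx v = 0) /\
  (im_mx w *m re_mx v = 0 /\ im_mx w *m im_mx v = 0).
Proof.
move=> E1 E2.
have := congr1 (@re_mx R _ _) E1; have := congr1 (@re_mx R _ _) E2.
have := congr1 (@im_mx R _ _) E1; have := congr1 (@im_mx R _ _) E2.
rewrite !re_mxM !im_mxM re_mx_conj im_mx_conj !mulmxN.
rewrite !opprK ![re_mx 0]map_mx0 ![im_mx 0]map_mx0 => h1 h2 h3 h4.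
have [? ?] := addsub_eq0 h4 h3.
have [? ?] : im_mx w *m re_mx v = 0 /\ re_mx w *m im_mx v = 0.
  by apply: addsub_eq0; rewrite addrC // ?h1 ?h2.
by [].
Qed.

(** Comparing moduli separates [lam i] from [b] and from its conjugate at once, so the left
    eigenvectors kill both [v] and its conjugate, hence its real and imaginary parts. *)
Lemma left_right_annihilate n q (A : 'M[R]_n) lam J (P : 'M[R]_(q, n))
    (b : CR) l (v : 'cV[CR]_n) :
  left_spectral_basis A lam J P -> (forall i, J i -> `|lam i| != `|b|) ->
  (cplx A - b%:M) ^+ l *m v = 0 ->
  P *m re_mx v = 0 /\ P *m im_mx v = 0.
Proof.
move=> [_ HP] Jb Hv.
have H k : row k P *m re_mx v = 0 /\ row k P *m im_mx v = 0.
  have [i [w [Ji [_ [l' Hw]] rk]]] := HP k.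
  have nb c : `|c| = `|b| -> lam i != c.
    by move=> cb; apply: contra_neq (Jb i Ji) => ->.
  have wv : w *m v = 0 by apply: gen_eigenvector_annihilate Hw Hv; exact: nb.
  have wcv : w *m conj_mx v = 0.
    apply: gen_eigenvector_annihilate Hw (conj_gen_eigenvector Hv).
    by apply: nb; rewrite normc_conj.
  by have [h1 h2] := annihilate_re_im wv wcv; case: rk => ->.
by split; apply/row_matrixP => k; rewrite row_mul row0; case: (H k).
Qed.

Lemma row_free_eq0 m n p (M : 'M[R]_(m, n)) (y : 'M[R]_(p, m)) :
  row_free M -> y *m M = 0 -> y = 0.
Proof. by move=> M_free; rewrite -[in _ = 0](mul0mx _ M) => /(row_free_inj M_free). Qed.

End SpectralSplitting.

Section SpectralSplitting.
Context {R : realType}.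
Local Notation CR := R[i].

Lemma mulmx_col (K : pzRingType) m n p (M : 'M[K]_(m, n)) (B : 'M[K]_(n, p)) j :
  M *m col j B = col j (M *m B).
Proof. by rewrite !colE mulmxA. Qed.

Lemma col_eq0 (K : pzRingType) m n (M : 'M[K]_(m, n)) :
  (forall j, col j M = 0) -> M = 0.
Proof.
by move=> H; apply/matrixP => i j; have /matrixP/(_ i 0) := H j; rewrite !mxE.
Qed.

Lemma shift_exp_comm n (A : 'M[CR]_n) (a : CR) k :
  (A - a%:M) ^+ k *m A = A *m (A - a%:M) ^+ k.
Proof.
have C : GRing.comm A (A - a%:M).
  by rewrite /GRing.comm mulrBr mulrBl; congr (_ - _); exact: scalar_mxC.
by rewrite [RHS](commrX k C).
Qed.

Lemma shift_exp_intertwine m n (P : 'M[CR]_(m, n)) (A : 'M[CR]_n) (L : 'M[CR]_m)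
    (a : CR) k :
  P *m A = L *m P -> P *m (A - a%:M) ^+ k = (L - a%:M) ^+ k *m P.
Proof.
move=> H; elim: k => [|k IH]; first by rewrite !expr0 mulmx1 mul1mx.
rewrite !exprSr mulmxA IH -!mulmxA; congr (_ *m _).
by rewrite mulmxBr mulmxBl H scalar_mxC.
Qed.

(** [PE] kills the fast generalized eigenvectors and [PF] the slow ones. [P1] is [PE] renormalized
    to be a left inverse of [TE]. The complement [TF] is built from [PF] alone, without real bases
    of fast eigenvectors, so the fast block appears as [PF A TF]. *)
Lemma spectral_splitting (n d : nat) (A : 'M[R]_n) (lam : 'I_n -> CR)
    (e : 'M[CR]_n) (TE : 'M[R]_(n, d)) (LE : 'M[R]_d)
    (PE : 'M[R]_(d, n)) (PF : 'M[R]_(n - d, n)) :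
  (d <= n)%N -> gen_eigenbasis A lam e ->
  right_spectral_basis A lam (fun i => (i < d)%N) TE ->
  (TE^T == slow_subspace d e)%MS -> A *m TE = TE *m LE ->
  left_spectral_basis A lam (fun i => (i < d)%N) PE ->
  left_spectral_basis A lam (fun i => (d <= i)%N) PF ->
  (forall i j : 'I_n, (i < d <= j)%N -> `|lam j| < `|lam i|) ->
  exists (P1 : 'M[R]_(d, n)) (TF : 'M[R]_(n, n - d)),
  [/\ PE = PE *m TE *m P1 /\ P1 = invmx (PE *m TE) *m PE,
      P1 *m TE = 1%:M /\ PF *m TE = 0,
      (P1 *m TF = 0 /\ PF *m TF = 1%:M) /\ TE *m P1 + TF *m PF = 1%:M,
      P1 *m A = LE *m P1 /\ PF *m A = PF *m A *m TF *m PF &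
      (forall j : 'I_n, (d <= j)%N -> cplx P1 *m col j e = 0) /\
      (forall j : 'I_n, (j < d)%N -> cplx PF *m col j e = 0)].
Proof.
move=> dn [_ e_unit He] hTE hTE_E hLE hPE hPF hgap.
have PE_slow (j : 'I_n) l (v : 'cV[CR]_n) : (d <= j)%N ->
    (cplx A - (lam j)%:M) ^+ l *m v = 0 -> cplx PE *m v = 0.
  move=> dj Hv; have [|h1 h2] := left_right_annihilate hPE _ Hv.
    by move=> i id; rewrite gt_eqF // hgap // id.
  exact: cplx_mulmx0.
have PF_fast (j : 'I_n) l (v : 'cV[CR]_n) : (j < d)%N ->
    (cplx A - (lam j)%:M) ^+ l *m v = 0 ->
    PF *m re_mx v = 0 /\ PF *m im_mx v = 0.
  move=> jd Hv; apply: left_right_annihilate hPF _ Hv => i di.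
  by rewrite lt_eqF // hgap // jd.
have PFTE : PF *m TE = 0.
  apply: col_eq0 => k; rewrite -mulmx_col.
  have [i [v [id [_ [l Hv]] Ek]]] := hTE.2 k.
  by have [h1 h2] := PF_fast _ _ _ id Hv; case: Ek => ->.
have spanE (i : 'I_n) : (i < d)%N -> exists c, col i e = cplx TE *m c.
  move=> id; have sub v : (v <= (re_mx (col i e))^T + (im_mx (col i e))^T)%MS ->
      (v <= TE^T)%MS.
    move=> h; apply: submx_trans h _; move/eqmxP: hTE_E => ->.
    exact: (sumsmx_sup i).
  have /submxP[Dr Er] := sub _ _ (addsmxSl _ _).
  have /submxP[Di Ei] := sub _ _ (addsmxSr _ _).
  move/(congr1 trmx): Er; move/(congr1 trmx): Ei; rewrite !trmx_mul !trmxK => Ei Er.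
  exists (cplx Dr^T + 'i%C *: cplx Di^T); apply: re_im_mx_eq; rewrite ?Er ?Ei.
    rewrite re_mxM re_mx_cplx im_mx_cplx mul0mx subr0; congr (_ *m _).
    by apply/matrixP => a b; rewrite !mxE /=; ring.
  rewrite im_mxM re_mx_cplx im_mx_cplx mul0mx addr0; congr (_ *m _).
  by apply/matrixP => a b; rewrite !mxE /=; ring.
(* Identities between real matrices are checked on the complex eigenbasis, slow and fast vectors
   separately. *)
have basis0 q (M : 'M[R]_(q, n)) : (forall j, cplx M *m col j e = 0) -> M = 0.
  move=> H; have Me : cplx M *m e = 0 by apply: col_eq0 => j; rewrite -mulmx_col.
  by rewrite -(re_mx_cplx M) -(mulmxK e_unit (cplx M)) Me mul0mx [re_mx 0]map_mx0.
have eig j : exists k, (cplx A - (lam j)%:M) ^+ k *m col j e = 0.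
  by case: (He j).
have PEe (j : 'I_n) : (d <= j)%N -> cplx PE *m col j e = 0.
  by move=> dj; have [k] := eig j; exact: PE_slow.
(* If [y PE TE = 0], then [y PE] kills the slow vectors, which lie in the complex span of [TE], and
   the fast ones, so [y PE = 0] and [y = 0]. *)
have PETE : PE *m TE \in unitmx.
  rewrite -row_free_unit; apply: inj_row_free => y yM.
  apply: (row_free_eq0 hPE.1); apply: basis0 => j.
  have [jd|dj] := ltnP j d; last by rewrite cplxM -mulmxA PEe // mulmx0.
  by have [c ->] := spanE j jd; rewrite mulmxA -cplxM -mulmxA yM [cplx 0]map_mx0 mul0mx.
have [P1 EP1] : exists P1, P1 = invmx (PE *m TE) *m PE by eexists.
have P1TE : P1 *m TE = 1%:M by rewrite EP1 -mulmxA mulVmx.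
have [G EG] : exists G, G = pinvmx PF by eexists.
have PFG : PF *m G = 1%:M by rewrite EG mulmxVp //; case: hPF.
(* Removing the slow component from a right inverse of [PF] keeps it a right inverse, since
   [PF TE = 0]. *)
have [TF ETF] : exists TF, TF = G - TE *m P1 *m G by eexists.
have P1TF : P1 *m TF = 0 by rewrite ETF mulmxBr !mulmxA P1TE mul1mx subrr.
have PFTF : PF *m TF = 1%:M by rewrite ETF mulmxBr !mulmxA PFTE !mul0mx subr0.
have P1e (j : 'I_n) : (d <= j)%N -> cplx P1 *m col j e = 0.
  by move=> dj; rewrite EP1 cplxM -mulmxA PEe // mulmx0.
have decomp : TE *m P1 + TF *m PF = 1%:M.
  (* The defect [Z] is killed by [P1] and [PF]. By dimension the kernel of [PF] is the range of
     [TE], so [Z = TE Y] with [Y = P1 Z = 0]. *)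
  pose Z := 1%:M - (TE *m P1 + TF *m PF).
  have P1Z : P1 *m Z = 0.
    by rewrite mulmxBr mulmxDr !mulmxA P1TE P1TF mul0mx addr0 mul1mx mulmx1 subrr.
  have PFZ : PF *m Z = 0.
    by rewrite mulmxBr mulmxDr !mulmxA PFTE PFTF mul0mx add0r mul1mx mulmx1 subrr.
  have TEker : (TE^T <= kermx PF^T)%MS by apply/sub_kermxP; rewrite -trmx_mul PFTE trmx0.
  have kerTE : (kermx PF^T <= TE^T)%MS.
    rewrite -(mxrank_leqif_sup TEker) mxrank_ker !mxrank_tr.
    have /eqP -> : \rank PF == (n - d)%N := hPF.1.
    have /eqP : \rank TE^T == d := hTE.1; rewrite mxrank_tr => ->.
    by rewrite subKn.
  have /submxP[Y EY] : (Z^T <= TE^T)%MS.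
    by apply: submx_trans kerTE; apply/sub_kermxP; rewrite -trmx_mul PFZ trmx0.
  move/(congr1 trmx): EY; rewrite trmx_mul !trmxK => EY.
  have Y0 : Y^T = 0 by rewrite -(mul1mx Y^T) -P1TE -mulmxA -EY P1Z.
  by move: EY; rewrite Y0 mulmx0 => /subr0_eq.
exists P1, TF; split => //.
- by split => //; rewrite EP1 mulmxA mulmxV // mul1mx.
- split.
    (* On a slow vector both sides reduce to [LE] through [TE]; on a fast one both vanish, because
       [A] preserves each generalized eigenspace. *)
    apply/subr0_eq/basis0 => j; have [jd|dj] := ltnP j d.
      have [c ->] := spanE j jd.
      rewrite mulmxA -cplxM mulmxBl -!mulmxA P1TE hLE mulmx1 mulmxA P1TE mul1mx.
      by rewrite subrr [cplx 0]map_mx0 mul0mx.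
    have [k Hk] := eig j.
    rewrite [cplx _](map_mxB (real_complex R)) mulmxBl -![map_mx _ _]/(cplx _) !cplxM.
    rewrite -!mulmxA P1e // mulmx0 subr0 EP1 cplxM -mulmxA (PE_slow j k) ?mulmx0 //.
    by rewrite mulmxA shift_exp_comm -mulmxA Hk mulmx0.
  rewrite -{1}(mulmx1 (PF *m A)) -decomp mulmxDr.
  by rewrite -[in X in X + _](mulmxA PF) (mulmxA A) hLE !mulmxA PFTE !mul0mx add0r.
- split => // j jd; have [k Hk] := eig j.
  by have [h1 h2] := PF_fast _ _ _ jd Hk; exact: cplx_mulmx0.
Qed.

(** The commuting factorization [L^-1 - a^-1 = (- a^-1 L^-1) (L - a)] carries over the nilpotency.
    It serves to bound the slow block from below through its inverse. *)
Lemma gen_eigenvector_inv n (L : 'M[CR]_n) (a : CR) k (v : 'cV[CR]_n) :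
  L \in unitmx -> a != 0 -> (L - a%:M) ^+ k *m v = 0 ->
  (invmx L - a^-1%:M) ^+ k *m v = 0.
Proof.
move=> Lu a0 Hv.
have E : invmx L - a^-1%:M = (- a^-1 *: invmx L) *m (L - a%:M).
  rewrite mulmxBr -!scalemxAl mulVmx // mul_mx_scalar scalerA mulNr mulVf // scaleN1r.
  by rewrite opprK [RHS]addrC scaleNr scalemx1.
have C : GRing.comm (- a^-1 *: invmx L) (L - a%:M).
  rewrite /GRing.comm mulrBr mulrBl; congr (_ - _); last exact: (scalar_mxC a).
  by rewrite -[LHS]scalemxAl -[RHS]scalemxAr mulVmx // mulmxV.
by rewrite E [(_ *m _) ^+ k](exprMn_comm k C) -mulmxA Hv mulmx0.
Qed.

(** If [y L = 0], then [y (L - a) ^+ k = (- a) ^+ k y]; as [a] is nonzero, [y] kills every column of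
    [W], and [W] has a right inverse. *)
Lemma gen_eigenbasis_unit n N (L : 'M[CR]_n) (W : 'M[CR]_(n, N))
    (V : 'M[CR]_(N, n)) :
  W *m V = 1%:M ->
  (forall j, exists a k, a != 0 /\ (L - a%:M) ^+ k *m col j W = 0) ->
  L \in unitmx.
Proof.
move=> WV H; rewrite -row_free_unit; apply: inj_row_free => y yL.
rewrite -(mulmx1 y) -WV mulmxA; suff -> : y *m W = 0 by rewrite mul0mx.
apply: col_eq0 => j; rewrite -mulmx_col; have [a [k [a0 Hk]]] := H j.
have yk i : y *m (L - a%:M) ^+ i = (- a) ^+ i *: y.
  elim: i => [|i IH]; first by rewrite !expr0 mulmx1 scale1r.
  rewrite exprS mulmxA mulmxBr yL sub0r mul_mx_scalar -scaleNr -scalemxAl IH.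
  by rewrite scalerA -exprS.
have : (- a) ^+ k *: (y *m col j W) = 0 by rewrite scalemxAl -yk -mulmxA Hk mulmx0.
by move/eqP; rewrite scaler_eq0 expf_eq0 oppr_eq0 (negPf a0) andbF /= => /eqP.
Qed.

End SpectralSplitting.

(** * Differential calculus *)

Section Taylor.
Context {R : realType}.

Lemma near0_norm (V : normedModType R) (P : V -> Prop) (r : R) :
  0 < r -> (forall h, `|h| < r -> P h) -> \forall h \near (0 : V), P h.
Proof.
move=> r0 H; apply/nbhs_normP; exists r => //= h.
by rewrite /ball_ /= sub0r normrN; exact: H.
Qed.

Lemma near0_normP (V : normedModType R) (P : V -> Prop) :
  (\forall h \near (0 : V), P h) -> exists2 r : R, 0 < r & forall h, `|h| < r -> P h.
Proof.
move/nbhs_normP => [r /= r0 H]; exists r => // h hr; apply: H.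
by rewrite /ball_ /= sub0r normrN.
Qed.

Lemma continuous_at_norm (V W : normedModType R) (h : V -> W) (x : V) :
  (forall eps, 0 < eps -> exists2 r : R, 0 < r &
     forall y, `|x - y| < r -> `|h x - h y| <= eps) ->
  {for x, continuous h}.
Proof.
move=> H; apply/cvgrPdist_le => eps /H[r r0 Hr].
by apply/nbhs_normP; exists r.
Qed.

Lemma diff_linear (V W : normedModType R) (g : V -> W) (x : V) (L : {linear V -> W}) :
  continuous L ->
  (forall eps, 0 < eps -> \forall h \near (0 : V),
     `|g (h + x) - g x - L h| <= eps * `|h|) ->
  differentiable g x /\ ('d g x : _ -> _) = L.
Proof.
move=> cL H.
have E : g \o shift x = cst (g x) + L +o_ 0 id.
  apply/eqaddoP => eps /H; apply: filterS => h.
  by rewrite !fctE /= opprD addrA.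
have D : ('d g x : _ -> _) = L by exact: diff_unique.
by split => //; apply/diff_locallyP; rewrite D.
Qed.

Lemma diff_mulmx n m (g : 'cV[R]_n -> 'cV[R]_m) (x : 'cV[R]_n) (L : 'M[R]_(m, n)) :
  (forall eps, 0 < eps -> \forall h \near (0 : 'cV[R]_n),
     `|g (h + x) - g x - L *m h| <= eps * `|h|) ->
  differentiable g x /\ ('d g x : _ -> _) = mulmx L.
Proof.
move=> H.
apply: (@diff_linear _ _ g x (mulmx L : {linear 'cV[R]_n -> 'cV[R]_m})) => //.
exact: mulmx_continuous.
Qed.

Lemma jacE n m (g : 'cV[R]_n -> 'cV[R]_m) (x v : 'cV[R]_n) : jac g x *m v = 'd g x v.
Proof.
rewrite {2}[v]matrix_sum_delta linear_sum; apply/matrixP => i j.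
rewrite ord1 mxE summxE; apply: eq_bigr => k _.
by rewrite big_ord1 linearZ !mxE mulrC.
Qed.

Lemma diff_mulmx_jac n m (g : 'cV[R]_n -> 'cV[R]_m) (x : 'cV[R]_n) (L : 'M[R]_(m, n)) :
  ('d g x : _ -> _) = mulmx L -> jac g x = L.
Proof.
move=> D; apply/matrixP => i j; rewrite mxE D -colE mxE //.
Qed.

Lemma taylor_diff n m (g : 'cV[R]_n -> 'cV[R]_m) (x : 'cV[R]_n) (L : 'M[R]_(m, n)) (M al : R) :
  0 < al ->
  (forall y, `|g y - g x - L *m (y - x)| <= M * `|y - x| `^ (1 + al)) ->
  differentiable g x /\ ('d g x : _ -> _) = mulmx L.
Proof.
move=> al0 H; apply: diff_mulmx => eps eps0.
have M0 : 0 < `|M| + 1 by rewrite ltr_wpDl.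
(* At this radius [r], the product of [|M| + 1] and [r ^ al] equals [eps]. *)
apply: (@near0_norm _ _ ((eps / (`|M| + 1)) `^ al^-1)).
  by rewrite powR_gt0 // divr_gt0.
move=> h hr; have := H (h + x); rewrite addrK => /le_trans; apply.
rewrite powRD; last by rewrite gt_eqF // addr_gt0.
rewrite powRr1 // mulrCA mulrC ler_wpM2r //.
apply: (@le_trans _ _ ((`|M| + 1) * `|h| `^ al)).
  by rewrite ler_wpM2r ?powR_ge0 // (le_trans (ler_norm _)) // lerDl.
rewrite mulrC -ler_pdivlMr //.
have -> : eps / (`|M| + 1) = ((eps / (`|M| + 1)) `^ al^-1) `^ al.
  by rewrite -powRrM mulVf ?gt_eqF // powRr1 // ltW // divr_gt0.
by apply: ge0_ler_powR; rewrite ?nnegrE ?powR_ge0 // ltW.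
Qed.

(** Expand at [x] and at [y], and compare at the third point [z = x + t v] with [t = |x - y|]. Of
    the three remainders, the one over [z - y] has length at most [2 t] and gives [2 ^ (1 + al)];
    the other two have length at most [t] and give 1 each. Dividing by [t] leaves [t ^ al]. *)
Lemma taylor_diff_holder n m (g : 'cV[R]_n -> 'cV[R]_m) (M al : R)
    (x y v : 'cV[R]_n) (Lx Ly : 'M[R]_(m, n)) :
  0 < al -> 0 <= M -> x != y ->
  (forall z, `|g z - g x - Lx *m (z - x)| <= M * `|z - x| `^ (1 + al)) ->
  (forall z, `|g z - g y - Ly *m (z - y)| <= M * `|z - y| `^ (1 + al)) ->
  `|v| <= 1 ->
  `|Lx *m v - Ly *m v| <= M * (2 + 2 `^ (1 + al)) * `|x - y| `^ al.
Proof.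
move=> al0 M0 xy Hx Hy v1.
have al1 : 0 <= 1 + al by rewrite addr_ge0 // ltW.
pose t := `|x - y|; have t0 : 0 < t by rewrite normr_gt0 subr_eq0.
have tw (w : 'cV[R]_n) (c : R) : 0 <= c -> `|w| <= c * t ->
    M * `|w| `^ (1 + al) <= M * (c `^ (1 + al) * (t * t `^ al)).
  move=> c0 wt; rewrite ler_wpM2l //.
  have -> : t * t `^ al = t `^ (1 + al).
    by rewrite powRD ?powRr1 ?(ltW t0) // gt_eqF // addr_gt0.
  rewrite -powRM ?(ltW t0) //.
  by apply: ge0_ler_powR; rewrite ?nnegrE // mulr_ge0 // ltW.
pose z := x + t *: v.
have zx : z - x = t *: v by rewrite /z addrAC subrr add0r.
have zx_le : `|z - x| <= 1 * t.
  by rewrite zx normrZ gtr0_norm // mul1r ger_pMr.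
have zy_le : `|z - y| <= 2 * t.
  rewrite -(subrKA x) (le_trans (ler_normD _ _)) // mulrDl lerD ?mul1r //.
  by rewrite -[t]mul1r.
rewrite -mulrA -(ler_pM2l t0) -[X in X * `|_|]gtr0_norm // -normrZ scalerBr !scalemxAr.
have -> : Lx *m (t *: v) - Ly *m (t *: v) =
  (g z - g y - Ly *m (z - y)) - (g x - g y - Ly *m (x - y)) -
  (g z - g x - Lx *m (z - x)).
  rewrite -zx !mulmxBr; move: (Lx *m z) (Lx *m x) (Ly *m z) (Ly *m x) (Ly *m y).
  move=> a b c e k; apply/matrixP => i j; rewrite !mxE; ring.
apply: le_trans (ler_normB _ _) _.
apply: le_trans (lerD (ler_normB _ _) (lexx _)) _.
have h1 := le_trans (Hy z) (tw _ 2 (ler0n _ _) zy_le).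
have h2 := le_trans (Hy x) (tw _ 1 ler01 (_ : `|x - y| <= 1 * t)).
have h3 := le_trans (Hx z) (tw _ 1 ler01 zx_le).
apply: le_trans (lerD (lerD h1 (h2 _)) h3) _; first by rewrite mul1r.
rewrite powR1 /t; set T := _ `^ al; set P := 2 `^ _.
rewrite -subr_ge0 [X in 0 <= X](_ : _ = 0) //; ring.
Qed.

Lemma taylor_diff_holder_scaled n m (g : 'cV[R]_n -> 'cV[R]_m) (M al c : R)
    (x y v : 'cV[R]_n) (Lx Ly : 'M[R]_(m, n)) :
  0 < al -> 0 <= M -> x != y ->
  (forall z, `|g z - g x - Lx *m (z - x)| <= M * `|z - x| `^ (1 + al)) ->
  (forall z, `|g z - g y - Ly *m (z - y)| <= M * `|z - y| `^ (1 + al)) ->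
  0 < c -> `|v| <= c ->
  `|Lx *m v - Ly *m v| <= M * (2 + 2 `^ (1 + al)) * c * `|x - y| `^ al.
Proof.
move=> al0 M0 xy Hx Hy c0 vc.
have -> : v = c *: (c^-1 *: v) by rewrite scalerA mulfV ?gt_eqF // scale1r.
rewrite -!(scalemxAr c) -scalerBr normrZ (gtr0_norm c0) mulrC mulrAC ler_pM2r //.
apply: (taylor_diff_holder al0 M0 xy Hx Hy).
by rewrite normrZ gtr0_norm ?invr_gt0 // ler_pdivrMl // mulr1.
Qed.

(** A first-order remainder that is uniform in the base point forces the derivative to be Hölder,
    hence continuous. This turns the condition preserved by the graph transform into class C^1. *)
Lemma taylor_Ck1 n m (g : 'cV[R]_n -> 'cV[R]_m) (M al : R) (U : set 'cV[R]_n) :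
  0 < al -> 0 <= M ->
  (forall x, exists L : 'M[R]_(m, n),
     forall y, `|g y - g x - L *m (y - x)| <= M * `|y - x| `^ (1 + al)) ->
  Ck 1 U g.
Proof.
move=> al0 M0 H; split; first by move=> x _; have [L /taylor_diff[]] := H x.
have {}H x y : `|g y - g x - 'd g x (y - x)| <= M * `|y - x| `^ (1 + al).
  by have [L HL] := H x; have [_ ->] := taylor_diff al0 HL.
move=> v x _.
have v0 : 0 < `|v| + 1 by rewrite ltr_wpDl.
pose C := M * (2 + 2 `^ (1 + al)) * (`|v| + 1).
have C0 : 0 <= C by rewrite !mulr_ge0 ?addr_ge0 ?powR_ge0 // ltW.
(* An opaque copy of [jac g]: comparing [jac g x] with [jac g y] up to conversion
   unfolds the differentials and does not terminate in practice. *)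
have [J JE] : exists J : 'cV[R]_n -> 'M[R]_(m, n), forall z w, J z *m w = 'd g z w.
  by exists (jac g) => z w; exact: jacE.
have HJ z w : `|g w - g z - J z *m (w - z)| <= M * `|w - z| `^ (1 + al).
  by rewrite JE.
have hold y : `|'d g x v - 'd g y v| <= C * `|x - y| `^ al.
  have [->|xy] := eqVneq x y; first by rewrite subrr normr0 mulr_ge0 ?powR_ge0.
  have := taylor_diff_holder_scaled al0 M0 xy (HJ x) (HJ y) v0 (_ : `|v| <= _).
  by rewrite (JE x) (JE y); apply; rewrite lerDl.
apply: continuous_at_norm => eps eps0.
have [rr rr0 Hr] : exists2 rr : R, 0 < rr & C * rr `^ al <= eps.
  exists ((eps / (C + 1)) `^ al^-1); first by rewrite powR_gt0 // divr_gt0 // ltr_wpDl.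
  rewrite -powRrM mulVf ?gt_eqF // powRr1; last by rewrite divr_ge0 ?addr_ge0 // ltW.
  rewrite mulrCA ger_pMr // ler_pdivrMr ?ltr_wpDl // mul1r lerDl //.
exists rr => // y xy.
apply: le_trans (hold y) (le_trans _ Hr); rewrite ler_wpM2l //.
by apply: ge0_ler_powR; rewrite ?nnegrE // ltW.
Qed.

End Taylor.

Section MeanValue.
Context {R : realType}.

Lemma is_derive_along (V : normedModType R) m (g : V -> 'cV[R]_m) (x v : V) (t : R) i :
  differentiable g (x + t *: v) ->
  is_derive t 1 (fun s : R => g (x + s *: v) i 0) ('d g (x + t *: v) v i 0).
Proof.
move=> dg; set p := x + t *: v.
have cv : (fun h : R => h^-1 *: ((g \o shift p) (h *: v) - g p)) @ 0^' --> 'd g p v.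
  by rewrite -deriveE //; exact: diff_derivable.
have {}cv : (fun h : R => h^-1 *: (((fun s : R => g (x + s *: v) i 0) \o shift t) (h *: 1)
     - g p i 0)) @ 0^' --> 'd g p v i 0.
  have -> : (fun h : R => h^-1 *: (((fun s : R => g (x + s *: v) i 0) \o shift t) (h *: 1)
     - g p i 0)) = (fun h : R => (h^-1 *: ((g \o shift p) (h *: v) - g p)) i 0).
    apply/funext => h; rewrite !mxE /= [h *: 1]mulr1 /p.
    by rewrite scalerDl addrCA.
  apply/cvgrPdist_le => e e0; move/cvgrPdist_le: cv => /(_ e e0).
  apply: filterS => h; apply: le_trans.
  by apply: le_trans (mx_norm_ge _ i 0); rewrite !mxE.
by split; [apply: cvgP cv|apply: cvg_lim cv].
Qed.

(** The scalar theorem is applied to each coordinate, with its own intermediate point; this is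
    enough because the norm is the max norm. [w = 0] gives Lipschitz bounds, and [w] equal to a
    linear increment gives Taylor remainders. *)
Lemma mean_value (V : normedModType R) m (g : V -> 'cV[R]_m) (x y : V)
    (w : 'cV[R]_m) (C : R) :
  (forall t : R, 0 <= t <= 1 -> differentiable g (x + t *: (y - x)) /\
     `|'d g (x + t *: (y - x)) (y - x) - w| <= C) ->
  `|g y - g x - w| <= C.
Proof.
move=> H; have C0 : 0 <= C.
  have /H[_] : 0 <= (0 : R) <= 1 by rewrite lexx ler01.
  exact: le_trans (normr_ge0 _).
apply: mx_norm_le => // i j; rewrite ord1.
pose phi (s : R) : R := g (x + s *: (y - x)) i 0.
pose dphi (s : R) : R := 'd g (x + s *: (y - x)) (y - x) i 0.
have D (s : R) : 0 <= s <= 1 -> is_derive s 1 phi (dphi s).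
  by move=> /H[dg _]; exact: is_derive_along.
have cont : {within `[0, 1], continuous phi}.
  apply: continuous_in_subspaceT => s; rewrite inE /= in_itv /= => /D Ds.
  by apply/differentiable_continuous/derivable1_diffP.
have der (s : R) : s \in `]0, 1[ -> is_derive s 1 phi (dphi s).
  by rewrite in_itv /= => /andP[s0 s1]; apply: D; rewrite !ltW.
have [c c01 E] := MVT_segment ler01 der cont.
rewrite in_itv /= in c01.
have [_ h] := H c c01; apply: le_trans h; apply: le_trans (mx_norm_ge _ i 0).
move: E; rewrite /phi /dphi scale1r scale0r addr0 subr0 mulr1 addrC.
rewrite [x + _]addrC subrK addrC => E.
have sub (a b : 'cV[R]_m) : (a - b) i 0 = a i 0 - b i 0 by rewrite !mxE.
by rewrite 3!sub E.
Qed.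
End MeanValue.

Section SecondOrder.
Context {R : realType}.

Lemma cV_sum_delta n (v : 'cV[R]_n) : v = \sum_i v i 0 *: delta_mx i 0.
Proof.
by rewrite [LHS]matrix_sum_delta; apply: eq_bigr => i _; rewrite big_ord1.
Qed.

Lemma linear_cV_bound n m (h : {linear 'cV[R]_n -> 'cV[R]_m}) (B : R) (v : 'cV[R]_n) :
  (forall i, `|h (delta_mx i 0)| <= B) -> `|h v| <= n%:R * B * `|v|.
Proof.
move=> H; rewrite {1}[v]cV_sum_delta linear_sum (le_trans (ler_norm_sum _ _ _)) //.
rewrite -mulrA mulr_natl -[n in _ *+ n]card_ord -sumr_const ler_sum // => i _.
by rewrite linearZ normrZ mulrC ler_pM // mx_norm_ge.
Qed.

Lemma segment_norm_lt (V : normedModType R) (x y : V) (r t : R) :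
  `|x| < r -> `|y| < r -> 0 <= t <= 1 -> `|x + t *: (y - x)| < r.
Proof.
move=> xr yr /andP[t0 t1].
have -> : x + t *: (y - x) = (1 - t) *: x + t *: y.
  by rewrite scalerBl scalerBr scale1r addrAC addrA.
rewrite (le_lt_trans (ler_normD _ _)) // !normrZ (ger0_norm t0) ger0_norm ?subr_ge0 //.
move: (`|x|) (`|y|) xr yr => a b ar br.
have [->|tn0] := eqVneq t 0; first by rewrite subr0 mul1r mul0r addr0.
have tp : 0 < t by rewrite lt_neqAle eq_sym tn0.
have : (1 - t) * a <= (1 - t) * r by rewrite ler_wpM2l ?subr_ge0 // ltW.
have : t * b < t * r by rewrite ltr_pM2l.
lra.
Qed.

Lemma segment_sub (V : normedModType R) (x y : V) (t : R) :
  0 <= t <= 1 -> `|x + t *: (y - x) - x| <= `|y - x|.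
Proof.
move=> /andP[t0 t1]; rewrite addrAC subrr add0r normrZ ger0_norm //.
by rewrite ler_piMl.
Qed.

(** Continuity bounds the finitely many second partial derivatives near 0. The mean value inequality
    applied to each partial derivative makes ['d g] Lipschitz; applied to [g] itself it then gives
    the quadratic remainder. *)
Lemma C2_taylor n m (g : 'cV[R]_n -> 'cV[R]_m) :
  Ck_near 2 (0 : 'cV[R]_n) g ->
  exists r K : R, [/\ 0 < r, 0 < K &
    forall x y, `|x| < r -> `|y| < r ->
    [/\ differentiable g x,
      forall v, `|'d g y v - 'd g x v| <= K * `|y - x| * `|v| &
      `|g y - g x - 'd g x (y - x)| <= K * `|y - x| ^+ 2]].
Proof.
move=> [U [Uo U0] [Ud U2]].
have Un : \forall x \near (0 : 'cV[R]_n), U x by exact: open_nbhs_nbhs.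
pose G j x := 'd g x (delta_mx j 0 : 'cV[R]_n).
have GU j : Ck 1 U (G j) by exact: U2.
pose b i j := `|'d (G j) 0 (delta_mx i 0 : 'cV[R]_n)| + 1.
have near_b i j : \forall x \near (0 : 'cV[R]_n),
    `|'d (G j) x (delta_mx i 0 : 'cV[R]_n)| <= b i j.
  have := (GU j).2 (delta_mx i 0) 0 U0.
  move/cvgrPdist_le/(_ 1 ltr01); apply: filterS => x hx.
  rewrite -lerBlDl; apply: le_trans hx; rewrite distrC; exact: lerB_dist.
pose B := \sum_i \sum_j b i j.
have bB i j : b i j <= B.
  rewrite /B (bigD1 i) //= (bigD1 j) //= -addrA lerDl addr_ge0 //.
    by rewrite sumr_ge0 // => k _; rewrite addr_ge0.
  by rewrite sumr_ge0 // => k _; rewrite sumr_ge0 // => l _; rewrite addr_ge0.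
have B0 : 0 <= B by rewrite sumr_ge0 // => k _; rewrite sumr_ge0 // => l _; rewrite addr_ge0.
have : \forall x \near (0 : 'cV[R]_n), U x /\ forall i j,
    `|'d (G j) x (delta_mx i 0 : 'cV[R]_n)| <= B.
  have F0 : Filter (nbhs (0 : 'cV[R]_n)) by exact: nbhs_filter.
  apply: filterI => //; apply: (@filter_forall _ _ _ _ F0) => i.
  apply: (@filter_forall _ _ _ _ F0) => j.
  by apply: filterS (near_b i j) => x h; exact: le_trans h (bB i j).
move=> /near0_normP[r r0 Hr].
pose K := n%:R * (n%:R * B) + 1.
have K1 : n%:R * (n%:R * B) <= K by rewrite lerDl.
have K0 : 0 < K by rewrite ltr_wpDl // !mulr_ge0.
have dG x y v : `|x| < r -> `|y| < r -> `|'d g y v - 'd g x v| <= K * `|y - x| * `|v|.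
  move=> xr yr.
  have H j : `|G j y - G j x| <= n%:R * B * `|y - x|.
    rewrite -[_ - _]subr0; apply: mean_value => t t01.
    have [Uz bz] := Hr _ (segment_norm_lt xr yr t01).
    split; first exact: (GU j).1.
    by rewrite subr0; apply: linear_cV_bound.
  have := @linear_cV_bound _ _ ('d g y \- 'd g x) _ v H.
  move=> /le_trans; apply; rewrite mulrA.
  by rewrite ler_wpM2r // ler_wpM2r // -mulrA.
exists r, K; split => // x y xr yr; split.
- by apply: Ud; case: (Hr _ xr).
- by move=> v; exact: dG.
- apply: mean_value => t t01; have zr := segment_norm_lt xr yr t01.
  split; first by apply: Ud; case: (Hr _ zr).
  apply: le_trans (dG _ _ _ xr zr) _.
  rewrite expr2 mulrA ler_wpM2r //.
  by apply: ler_wpM2l (segment_sub _ _ t01); exact: ltW.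
Qed.

End SecondOrder.

(** * Extension of the nonlinearity *)

Section Cutoff.
Context {R : realType}.

(** The identity on [-1, 1], continued by [2 - 1 / t] for [t > 1] and oddly below -1. The slopes
    match at 1 and -1, the values stay below 2 in size, and the second derivative is at most 2 in
    size off those two points, whence a remainder of at most [(y - x) ^+ 2] everywhere. *)
Definition cut (t : R) : R :=
  if t < -1 then - 2 - t^-1 else if 1 < t then 2 - t^-1 else t.
Definition dcut (t : R) : R :=
  if t < -1 then t^-1 ^+ 2 else if 1 < t then t^-1 ^+ 2 else 1.

(** [u] stands for [1 / |t|] and is known only through its product with [t], so that divisions
    disappear from the case analysis. *)
Variant cut_spec (t : R) : R -> R -> Prop :=
| CutLow u of t < -1 & 0 < u < 1 & u * t = -1 : cut_spec t (- 2 + u) (u ^+ 2)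
| CutMid of -1 <= t & t <= 1 : cut_spec t t 1
| CutHigh u of 1 < t & 0 < u < 1 & u * t = 1 : cut_spec t (2 - u) (u ^+ 2).

Lemma cutP t : cut_spec t (cut t) (dcut t).
Proof.
rewrite /cut /dcut; have [t1|t1] := ltP t (-1).
  rewrite -[t^-1 ^+ 2]sqrrN; apply: CutLow => //.
    rewrite -invrN; apply/andP; split; first by rewrite invr_gt0; lra.
    by rewrite invf_lt1; lra.
  by rewrite mulNr mulVf // lt_eqF //; lra.
have [t2|t2] := ltP 1 t; last exact: CutMid.
apply: CutHigh => //; last by rewrite mulVf // gt_eqF //; lra.
apply/andP; split; first by rewrite invr_gt0; lra.
by rewrite invf_lt1; lra.
Qed.

Lemma cut_id t : `|t| <= 1 -> cut t = t.
Proof.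
by rewrite ler_norml => /andP[a b]; case: cutP => [u ? ? ?|? ?|u ? ? ?] //; lra.
Qed.

Lemma cut_norm t : `|cut t| <= 2.
Proof.
by case: cutP => [u ? ? ?|? ?|u ? ? ?]; rewrite ler_norml; lra.
Qed.

Lemma dcut_norm t : `|dcut t| <= 1.
Proof.
by case: cutP => [u ? ? ?|? ?|u ? ? ?]; rewrite ler_norml; nra.
Qed.

Lemma cutN t : cut (- t) = - cut t /\ dcut (- t) = dcut t.
Proof.
have inj (a u w : R) : a != 0 -> w * a = u * a -> w = u by move=> a0 /(mulIf a0).
case: cutP => [w tw w1 wt|a b|w tw w1 wt]; case: cutP => [u tu u1 ut|c d|u tu u1 ut];
  try lra;
  by rewrite (inj t u w); [split; lra| |lra]; apply/eqP; lra.
Qed.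

Lemma cut_diff_ge0 x y : 0 <= x ->
  `|cut y - cut x| <= `|y - x| /\
  `|cut y - cut x - dcut x * (y - x)| <= (y - x) ^+ 2.
Proof.
move=> x0.
(* With [b = 1 / a], this is the exact gap [a - cut a] for [a > 1], the remainder of [cut] with
   respect to its tangent at 1. *)
have high (a b : R) : 0 < b -> b * a = 1 -> a + b - 2 = b * (a - 1) ^+ 2.
  move=> _ ab; have -> : b * (a - 1) ^+ 2 = (b * a) * a - 2 * (b * a) + b by ring.
  by rewrite ab; ring.
case: (cutP x) => [u ? ? ?|x1 x2|u xu /andP[u0 u1] ux]; first by lra.
- case: (cutP y) => [w yw /andP[w0 w1] wy|y1 y2|w yw /andP[w0 w1] wy].
  + have E : - y + w - 2 = w * (- y - 1) ^+ 2 by apply: high; lra.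
    have S0 : 0 <= (- y - 1) ^+ 2 by rewrite sqr_ge0.
    have W0 : 0 <= w * (- y - 1) ^+ 2 by rewrite mulr_ge0 // ltW.
    have S1 : (- y - 1) ^+ 2 <= (y - x) ^+ 2.
      by rewrite -[leRHS]sqrrN ler_sqr ?nnegrE; lra.
    split; first by rewrite ler0_norm ?ler0_norm; lra.
    rewrite ger0_norm; last by lra.
    apply: le_trans S1; apply: (@le_trans _ _ (w * (- y - 1) ^+ 2)); first lra.
    by rewrite ler_piMl // ltW.
  + by rewrite mul1r subrr normr0 sqr_ge0.
  + have E : y + w - 2 = w * (y - 1) ^+ 2 by apply: high.
    have S0 : 0 <= (y - 1) ^+ 2 by rewrite sqr_ge0.
    have W0 : 0 <= w * (y - 1) ^+ 2 by rewrite mulr_ge0 // ltW.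
    have S1 : (y - 1) ^+ 2 <= (y - x) ^+ 2 by rewrite ler_sqr ?nnegrE; lra.
    split; first by rewrite ger0_norm ?ger0_norm; lra.
    rewrite ler0_norm; last by lra.
    apply: le_trans S1; apply: (@le_trans _ _ (w * (y - 1) ^+ 2)); first lra.
    by rewrite ler_piMl // ltW.
- have Ex : x + u - 2 = u * (x - 1) ^+ 2 by apply: high.
  have Wx : 0 <= u * (x - 1) ^+ 2 by rewrite mulr_ge0 ?sqr_ge0 // ltW.
  have u2 : u ^+ 2 <= 1 by rewrite expr_le1 // ltW.
  have u20 : 0 <= u ^+ 2 by rewrite sqr_ge0.
  case: (cutP y) => [w yw /andP[w0 w1] wy|y1 y2|w yw /andP[w0 w1] wy].
  + have Ey : - y + w - 2 = w * (- y - 1) ^+ 2 by apply: high; lra.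
    have Wy : 0 <= w * (- y - 1) ^+ 2 by rewrite mulr_ge0 ?sqr_ge0 // ltW.
    split; first by rewrite ler0_norm ?ler0_norm; lra.
    have h1 : 0 <= u ^+ 2 * (x - y) by rewrite mulr_ge0; lra.
    have h2 : u ^+ 2 * (x - y) <= x - y by rewrite ler_piMl; lra.
    have h3 : x - y <= (y - x) ^+ 2.
      by rewrite -sqrrN opprB expr2 ler_peMr; lra.
    have -> : u ^+ 2 * (y - x) = - (u ^+ 2 * (x - y)) by ring.
    by rewrite ler_norml; apply/andP; split; lra.
  + split; first by rewrite ler0_norm ?ler0_norm; lra.
    (* The relation [u x = 1] brings out a factor [x - 1]. The resulting bound
       [(x - 1) (2 (1 - y) + (x - 1))] falls short of [(y - x) ^+ 2] by the square
       [(1 - y) ^+ 2]. *)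
    have -> : y - (2 - u) - u ^+ 2 * (y - x) =
        - (u * (x - 1) * ((1 - y) * (1 + u) + u * (x - 1))).
      have -> : y - (2 - u) - u ^+ 2 * (y - x) = y - 2 + u - u ^+ 2 * y + u * (u * x).
        by ring.
      have -> : u * (x - 1) = u * x - u by ring.
      by rewrite ux; ring.
    have ux1 : u * (x - 1) <= x - 1 by rewrite ler_piMl //; lra.
    have ux0 : 0 <= u * (x - 1) by rewrite mulr_ge0; lra.
    have h : (1 - y) * (1 + u) <= 2 * (1 - y) by rewrite mulrC ler_wpM2r; lra.
    have h0 : 0 <= (1 - y) * (1 + u) by rewrite mulr_ge0; lra.
    rewrite normrN ger0_norm; last by rewrite mulr_ge0 //; lra.
    apply: (@le_trans _ _ ((x - 1) * (2 * (1 - y) + (x - 1)))).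
      by apply: ler_pM => //; lra.
    have -> : (y - x) ^+ 2 = (x - 1) * (2 * (1 - y) + (x - 1)) + (1 - y) ^+ 2 by ring.
    by rewrite lerDl sqr_ge0.
  + have E : 2 - w - (2 - u) = u * w * (y - x).
      have -> : u * w * (y - x) = u * (w * y) - w * (u * x) by ring.
      by rewrite wy ux; ring.
    have uw0 : 0 <= u * w by rewrite mulr_ge0 // ltW.
    have uw1 : u * w <= 1 by rewrite mulr_ile1 // ltW.
    rewrite E; split; first by rewrite normrM ger0_norm // ler_piMl.
    have -> : u * w * (y - x) - u ^+ 2 * (y - x) = - (u * (u * w) * (y - x) ^+ 2).
      have -> : u * (u * w) * (y - x) ^+ 2 = (u ^+ 2 * (w * y) - u * w * (u * x)) * (y - x).
        by ring.
      by rewrite wy ux; ring.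
    have p0 : 0 <= u * (u * w) by rewrite mulr_ge0 // ltW.
    rewrite normrN normrM (ger0_norm p0) ger0_norm ?sqr_ge0 // ler_piMl ?sqr_ge0 //.
    by rewrite mulr_ile1 // ltW.
Qed.

Lemma cut_diff x y :
  `|cut y - cut x| <= `|y - x| /\
  `|cut y - cut x - dcut x * (y - x)| <= (y - x) ^+ 2.
Proof.
have [x0|x0] := leP 0 x; first exact: cut_diff_ge0.
have nx : 0 <= - x by rewrite oppr_ge0 ltW.
have [h1 h2] := cut_diff_ge0 (- y) nx.
move: h1 h2; rewrite (cutN x).1 (cutN x).2 (cutN y).1.
have E (a b : R) : - a - - b = - (a - b) by ring.
by rewrite !E mulrN E !normrN sqrrN.
Qed.

(** Acting coordinate by coordinate keeps the Lipschitz constant equal to 1 in the max norm and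
    makes the derivative diagonal; rescaling by [rho] turns the remainder constant 1 into
    [rho^-1]. *)
Lemma smooth_cutoff n (rho : R) : 0 < rho ->
  exists s : 'cV[R]_n -> 'cV[R]_n,
  [/\ forall x, `|s x| <= 2 * rho,
      forall x, `|x| <= rho -> s x = x,
      forall x y, `|s y - s x| <= `|y - x| &
      forall x, exists J : 'M[R]_n, (forall v : 'cV[R]_n, `|J *m v| <= `|v|) /\
        forall y, `|s y - s x - J *m (y - x)| <= rho^-1 * `|y - x| ^+ 2].
Proof.
move=> r0; exists (fun x => \col_i (rho * cut (x i 0 / rho))).
have scale (x y : 'cV[R]_n) i : y i 0 / rho - x i 0 / rho = (y - x) i 0 / rho.
  by rewrite !mxE mulrBl.
split.
- move=> x; apply: mx_norm_le => [|i j]; first by rewrite mulr_ge0 // ltW.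
  by rewrite mxE normrM gtr0_norm // mulrC ler_pM2r // cut_norm.
- move=> x xr; apply/matrixP => i j; rewrite ord1 mxE cut_id.
    by rewrite mulrC divfK // gt_eqF.
  rewrite normrM normfV (gtr0_norm r0) ler_pdivrMr // mul1r.
  exact: le_trans (mx_norm_ge _ _ _) xr.
- move=> x y; apply: mx_norm_le => // i j; rewrite !mxE -mulrBr normrM gtr0_norm //.
  rewrite -ler_pdivlMl //; apply: le_trans (cut_diff _ _).1 _.
  rewrite scale normrM normfV (gtr0_norm r0) mulrC.
  by apply: ler_wpM2l (mx_norm_ge _ _ _); rewrite invr_ge0 ltW.
- move=> x; exists (diag_mx (\row_i dcut (x i 0 / rho))).
  have JE (v : 'cV[R]_n) i j :
      (diag_mx (\row_i dcut (x i 0 / rho)) *m v) i j = dcut (x i 0 / rho) * v i j.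
    by rewrite mul_diag_mx !mxE.
  split=> [v|y].
    apply: mx_norm_le => // i j; rewrite JE normrM.
    by apply: le_trans (mx_norm_ge v i j); rewrite ler_piMl // dcut_norm.
  apply: mx_norm_le => [|i j]; first by rewrite mulr_ge0 ?sqr_ge0 // invr_ge0 ltW.
  have -> : ((\col_i0 (rho * cut (y i0 0 / rho))) - (\col_i0 (rho * cut (x i0 0 / rho)))
     - diag_mx (\row_i0 dcut (x i0 0 / rho)) *m (y - x)) i j =
     rho * (cut (y i 0 / rho) - cut (x i 0 / rho)
        - dcut (x i 0 / rho) * (y i 0 / rho - x i 0 / rho)).
    rewrite [LHS]mxE [(- (_ *m _)) i j]mxE JE scale ord1.
    rewrite !mxE !mulrBr; congr (_ - _).
    by rewrite -!mulrBr mulrCA [rho * (_ / rho)]mulrC divfK // gt_eqF.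
  rewrite normrM (gtr0_norm r0).
  apply: (@le_trans _ _ (rho * ((y - x) i 0 / rho) ^+ 2)).
    by rewrite ler_pM2l // -scale (cut_diff _ _).2.
  have -> : rho * ((y - x) i 0 / rho) ^+ 2 = rho^-1 * `|(y - x) i 0| ^+ 2.
    rewrite -normrX ger0_norm ?sqr_ge0 //; field; exact: lt0r_neq0.
  apply: ler_wpM2l; first by rewrite invr_ge0 ltW.
  by rewrite ler_sqr ?nnegrE // mx_norm_ge.
Qed.

End Cutoff.

Section Extension.
Context {R : realType}.

Lemma littleo_id_diff0 n (ft : 'cV[R]_n -> 'cV[R]_n) :
  ft =o_ (0 : 'cV[R]_n) id ->
  [/\ ft 0 = 0, differentiable ft 0 & forall v : 'cV[R]_n, 'd ft 0 v = 0].
Proof.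
move=> /eqoP H.
have f0 : ft 0 = 0.
  have /near0_normP[r r0 /(_ 0)] := H 1 ltr01.
  by rewrite normr0 mulr0 normr_le0 => /(_ r0)/eqP.
have [|d E] := @diff_mulmx R n n ft 0 0.
  move=> eps e0; have /near0_normP[r r0 Hr] := H eps e0.
  by apply: (near0_norm r0) => h hr; rewrite addr0 f0 subr0 mul0mx subr0; exact: Hr.
by split => // v; rewrite E mul0mx.
Qed.

(** The Jacobian is passed on as an abstract [J], known only through its action on vectors, so that
    conversion never unfolds differentials. *)
Lemma C2_taylor_jac n m (g : 'cV[R]_n -> 'cV[R]_m) :
  Ck_near 2 (0 : 'cV[R]_n) g ->
  exists (J : 'cV[R]_n -> 'M[R]_(m, n)) (r K : R),
  [/\ 0 < r, 0 < K, forall x v : 'cV[R]_n, J x *m v = 'd g x v &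
    forall x y : 'cV[R]_n, `|x| < r -> `|y| < r ->
    [/\ differentiable g x,
      forall v : 'cV[R]_n, `|J y *m v - J x *m v| <= K * `|y - x| * `|v| &
      `|g y - g x - J x *m (y - x)| <= K * `|y - x| ^+ 2]].
Proof.
move=> /C2_taylor[r [K [r0 K0 H]]].
have [J JE] : exists J : 'cV[R]_n -> 'M[R]_(m, n), forall x v : 'cV[R]_n, J x *m v = 'd g x v.
  by exists (jac g) => x v; exact: jacE.
exists J, r, K; split => // x y xr yr; have [d h1 h2] := H x y xr yr; split => //.
  by move=> v; rewrite (JE y) (JE x).
by rewrite (JE x).
Qed.

Lemma small_extension n (ft : 'cV[R]_n -> 'cV[R]_n) (eps : R) :
  ft =o_ (0 : 'cV[R]_n) id -> Ck_near 2 (0 : 'cV[R]_n) ft -> 0 < eps ->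
  exists (eta : 'cV[R]_n -> 'cV[R]_n) (rho K : R),
  [/\ 0 < rho /\ 0 <= K, forall x : 'cV[R]_n, `|x| <= rho -> eta x = ft x,
      forall x y : 'cV[R]_n, `|eta y - eta x| <= eps * `|y - x|,
      forall y : 'cV[R]_n, `|eta y| <= K * `|y| ^+ 2 &
      forall x : 'cV[R]_n, exists J : 'M[R]_n, (forall v : 'cV[R]_n, `|J *m v| <= eps * `|v|) /\
        forall y : 'cV[R]_n, `|eta y - eta x - J *m (y - x)| <= K * `|y - x| ^+ 2].
Proof.
move=> /littleo_id_diff0[f0 _ df0] /C2_taylor_jac[D [r [K [r0 K0 DE H]]]] e0.
have D0 (v : 'cV[R]_n) : D 0 *m v = 0 by rewrite DE.
have n0r : `|0 : 'cV[R]_n| < r by rewrite normr0.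
(* The cutoff takes values in the ball of radius [2 rho]: the first bound puts this ball in the
   domain of the Taylor estimates, the second makes the derivative of [ft] at most [eps] there. *)
pose rho := Num.min (r / 3) (eps / (2 * K)).
have rho0 : 0 < rho by rewrite lt_min !divr_gt0 ?mulr_gt0.
have rho_r : 2 * rho < r.
  have : rho <= r / 3 by rewrite ge_min lexx.
  by lra.
have rho_e : K * (2 * rho) <= eps.
  have : rho <= eps / (2 * K) by rewrite ge_min lexx orbT.
  by rewrite ler_pdivlMr ?mulr_gt0 // => h; lra.
have Dsmall (z v : 'cV[R]_n) : `|z| <= 2 * rho -> `|D z *m v| <= eps * `|v|.
  move=> zr; have [_ h _] := H 0 z n0r (le_lt_trans zr rho_r).
  have := h v; rewrite D0 !subr0 => /le_trans; apply.
  rewrite ler_wpM2r //; apply: le_trans rho_e.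
  by rewrite ler_wpM2l // ltW.
have [s [s_norm s_id s_lip s_taylor]] := smooth_cutoff n rho0.
have s_r x : `|s x| < r by exact: le_lt_trans (s_norm x) rho_r.
have ft_lip x y : `|ft (s y) - ft (s x)| <= eps * `|s y - s x|.
  rewrite -[_ - ft _]subr0; apply: mean_value => t t01.
  have zr : `|s x + t *: (s y - s x)| <= 2 * rho.
    (* Convexity is available for open balls; the closed ball is obtained as their limit. *)
    apply/ler_addgt0Pr => e e0'; apply: ltW; apply: segment_norm_lt t01;
    by apply: le_lt_trans (s_norm _) _; rewrite ltrDl.
  have [dz _ _] := H _ 0 (le_lt_trans zr rho_r) n0r.
  by split=> //; rewrite subr0 -DE; exact: Dsmall.
(* In the remainder constant, [K] comes from expanding [ft] and [eps / rho] from applying its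
   derivative to the remainder of [s]. *)
exists (ft \o s), rho, (K + eps / rho); split => /=.
- by split => //; rewrite addr_ge0 // ?divr_ge0 // ltW.
- by move=> x /s_id ->.
- move=> x y; apply: le_trans (ft_lip x y) _.
  by rewrite ler_wpM2l ?s_lip // ltW.
- move=> y; have [_ _] := H 0 (s y) n0r (s_r y).
  rewrite f0 D0 !subr0 => /le_trans; apply.
  apply: (@le_trans _ _ (K * `|y| ^+ 2)); last first.
    by rewrite ler_wpM2r ?sqr_ge0 // lerDl divr_ge0 // ltW.
  rewrite ler_pM2l // ler_sqr ?nnegrE //.
  have s0 : s 0 = 0 by apply: s_id; rewrite normr0 ltW.
  by have := s_lip 0 y; rewrite s0 !subr0.
- move=> x; have [Js [Js1 Js2]] := s_taylor x.
  exists (D (s x) *m Js); split=> [v|y].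
    rewrite -mulmxA; apply: le_trans (Dsmall _ _ (s_norm x)) _.
    by rewrite ler_wpM2l // ltW.
  have -> : ft (s y) - ft (s x) - D (s x) *m Js *m (y - x) =
     (ft (s y) - ft (s x) - D (s x) *m (s y - s x)) +
     D (s x) *m (s y - s x - Js *m (y - x)).
    by rewrite [D (s x) *m (_ - Js *m _)]mulmxBr addrA subrK mulmxA.
  apply: le_trans (ler_normD _ _) _; rewrite mulrDl; apply: lerD.
    have [_ _ h] := H _ _ (s_r x) (s_r y); apply: le_trans h _.
    by rewrite ler_pM2l // ler_sqr ?nnegrE // s_lip.
  apply: le_trans (Dsmall _ _ (s_norm x)) _.
  by rewrite -mulrA ler_pM2l.
Qed.

End Extension.

(** * Graph transform *)

Section FixedPoints.
Context {R : realType}.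

Lemma cvg_le_of_near (T : Type) (F : set_system T) {FF : ProperFilter F} n
    (N : 'cV[R]_n -> R) C (u : T -> 'cV[R]_n) l c :
  equiv_norm N C -> u @ F --> l -> (forall t, N (u t) <= c) -> N l <= c.
Proof.
move=> hN ul H.
have Nul : N (u t) @[t --> F] --> N l by exact: (equiv_norm_cvg hN).
by apply: (cvgr_to_le Nul); exact: nearW.
Qed.

Lemma cvg_sub_seq (V : normedModType R) (T : Type) (F : set_system T) {FF : Filter F}
    (u v : T -> V) (a b : V) :
  u @ F --> a -> v @ F --> b -> (fun t => u t - v t) @ F --> a - b.
Proof. by move=> ua vb; exact: cvgB. Qed.

Lemma contraction_fixpoint n (N : 'cV[R]_n -> R) C (F : 'cV[R]_n -> 'cV[R]_n) (q : R) :
  equiv_norm N C -> 0 <= q < 1 ->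
  (forall x y, N (F y - F x) <= q * N (y - x)) -> exists x, F x = x.
Proof.
move=> hN /andP[q0 q1] HF; pose u k := iter k F 0.
have uk k : N (u k.+1 - u k) <= N (F 0) * q ^+ k.
  elim: k => [|k IH]; first by rewrite /u /= subr0 expr0 mulr1.
  apply: le_trans (HF _ _) _; rewrite exprS mulrCA.
  exact: ler_wpM2l.
have cu : cvgn u.
  apply: (@geometric_cvg _ _ u (N (F 0)) q); first by rewrite q0.
  by move=> k; apply: le_trans (uk k); exact: equiv_norm_ge hN _.
exists (limn u); set l := limn u; apply/subr0_eq; apply: (equiv_norm0_eq0 hN).
have c1 : (fun k => l - u k) @ \oo --> l - l by apply: cvg_sub_seq => //; exact: cvg_cst.
have c2 : (fun k => u k.+1) @ \oo --> l by have := cu; rewrite -(cvg_shiftS u (nbhs l)).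
have c3 : (fun k => l - u k.+1) @ \oo --> l - l by apply: cvg_sub_seq => //; exact: cvg_cst.
have n1 : (fun k => N (l - u k)) @ \oo --> (0 : R).
  by rewrite -(equiv_norm0 hN) -(subrr l); exact: (equiv_norm_cvg hN).
have n3 : (fun k => N (l - u k.+1)) @ \oo --> (0 : R).
  by rewrite -(equiv_norm0 hN) -(subrr l); exact: (equiv_norm_cvg hN).
have : (fun k => q * N (l - u k) + N (l - u k.+1)) @ \oo --> q * 0 + 0.
  by apply: cvgD n3; apply: cvgMl_tmp n1.
rewrite mulr0 addr0 => /cvgr_to_ge; apply; apply: nearW => k.
rewrite -(subrKA (u k.+1)) (le_trans (equiv_normD hN _ _)) //.
by rewrite lerD ?HF // (equiv_normC hN).
Qed.

Lemma nbhs_norm_lt (V : normedModType R) (p : V) (e : R) :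
  0 < e -> nbhs p [set w | `|p - w| < e].
Proof. by move=> e0; apply/nbhs_normP; exists e. Qed.

(** A limit along an ultrafilter finer than [\oo] replaces the extraction of a subsequence:
    sequences that already converge keep their limits along [G]. Matrices are flattened so that
    compactness of balls of row vectors applies. *)
Lemma bounded_ultra_cvg m n (L : nat -> 'M[R]_(m, n)) (c : R) :
  (forall k, `|L k| <= c) ->
  exists (G : set_system nat) (l : 'M[R]_(m, n)),
    [/\ ProperFilter G, \oo `<=` G & L @ G --> l].
Proof.
move=> Lc; have [G [GU Goo]] := ultraFilterLemma eventually_filter.
have GP : ProperFilter G by case: GU.
pose v k := mxvec (L k); pose A := [set w : 'rV[R]_(m * n) | `|w| <= c].
have Ac : compact A.
  apply: bounded_closed_compact.
    by exists c; split; [exact: num_real|move=> d cd w /le_trans; apply; exact: ltW].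
  have -> : A = (fun w => `|w|) @^-1` [set x : R | x <= c] by [].
  by apply: closed_comp; [move=> w _; exact: norm_continuous|exact: closed_le].
have vA : (v @ G) A.
  apply: nearW => k; rewrite /A /=.
  apply: mx_norm_le; first exact: le_trans (Lc k).
  move=> i j; rewrite ord1; case/mxvec_indexP: j => a b; rewrite mxvecE.
  exact: le_trans (mx_norm_ge _ _ _) (Lc k).
have [p [_ cp]] := Ac (v @ G) _ vA.
exists G, (vec_mx p); split => //.
apply/cvgrPdist_lt => e e0.
have [H|H] := in_ultra_setVsetC [set k | `|p - v k| < e] GU.
  apply: filterS H => k; apply: le_lt_trans.
  apply: mx_norm_le => // i j; apply: le_trans (mx_norm_ge _ 0 (mxvec_index i j)).
  by rewrite /v -{2}(vec_mxK p) -[X in _ <= `|X|]/((mxvec _ - mxvec _) _ _) -linearB mxvecE.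
exfalso.
have B : nbhs (p : 'rV[R]_(m * n)) [set w : 'rV[R]_(m * n) | `|(p : 'rV[R]_(m * n)) - w| < e].
  exact: (@nbhs_norm_lt _ p e e0).
have [w []] := cp [set w | ~ (`|p - w| < e)] _ H B.
by [].
Qed.

End FixedPoints.

Section GraphTransform.
Context {R : realType} {n d k : nat}.
Variables (N1 : 'cV[R]_d -> R) (C1 : R) (N2 : 'cV[R]_k -> R) (C2 : R).
Hypotheses (hN1 : equiv_norm N1 C1) (hN2 : equiv_norm N2 C2).
Variables (P1 : 'M[R]_(d, n)) (P2 : 'M[R]_(k, n)) (T1 : 'M[R]_(n, d)) (T2 : 'M[R]_(n, k)).
Hypotheses (P1T1 : P1 *m T1 = 1%:M) (P1T2 : P1 *m T2 = 0).
Hypotheses (P2T1 : P2 *m T1 = 0) (P2T2 : P2 *m T2 = 1%:M).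
Variables (B : 'M[R]_d) (L2 : 'M[R]_k) (a b eps al K M : R).
Hypotheses (Bu : B \in unitmx) (hB : forall x, a * N1 x <= N1 (B *m x)).
Hypothesis hL2 : forall v, N2 (L2 *m v) <= b * N2 v.

Definition prod_norm (w : 'cV[R]_n) : R := N1 (P1 *m w) + N2 (P2 *m w).
Local Notation NN := prod_norm.

Variable eta : 'cV[R]_n -> 'cV[R]_n.
Hypothesis eta_lip : forall x y, NN (eta y - eta x) <= eps * NN (y - x).
Hypothesis eta_taylor : forall x, exists J : 'M[R]_n,
  (forall w, NN (J *m w) <= eps * NN w) /\
  forall y, NN (eta y - eta x - J *m (y - x)) <= K * NN (y - x) `^ (1 + al).
Hypothesis eta_flat : forall y, NN (eta y) <= K * NN y `^ (1 + al).
Hypotheses (eps0 : 0 <= eps) (al01 : 0 < al < 1) (K0 : 0 <= K) (b0 : 0 <= b).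
(** Along a graph of slope 1 a displacement costs twice its base part, so [eta] contributes [2 eps]:
    the base map expands by at least [a - 2 eps] and the fiber map stretches by at most [b + 2 eps].
    [gap1] makes slope 1 reproduce itself, and [gap2] is the corresponding condition on remainders
    of order [1 + al]. *)
Hypotheses (gap1 : b + 4 * eps < a) (gap2 : b + 2 * eps < (a - 2 * eps) `^ (1 + al)).
Hypothesis M_large : 8 * K + (b + 2 * eps) * M <= M * (a - 2 * eps) `^ (1 + al).

Let pw (t : R) := t `^ (1 + al).

Definition graph_point (h : 'cV[R]_d -> 'cV[R]_k) (u : 'cV[R]_d) : 'cV[R]_n :=
  T1 *m u + T2 *m h u.
Definition graph_base h u := B *m u + P1 *m eta (graph_point h u).
Definition graph_fiber h u := L2 *m h u + P2 *m eta (graph_point h u).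

(** [graph_flat] fixes the derivative at 0 to be zero, which is the tangency to [E]. The slope bound
    on [L] keeps the derivatives of all graphs in a compact set. *)
Record C1_graph (h : 'cV[R]_d -> 'cV[R]_k) : Prop := {
  graph0 : h 0 = 0;
  graph_lip : forall x y, N2 (h y - h x) <= N1 (y - x);
  graph_flat : forall y, N2 (h y) <= M * pw (N1 y);
  graph_taylor : forall x, exists L : 'M[R]_(k, d),
    (forall v, N2 (L *m v) <= N1 v) /\
    forall y, N2 (h y - h x - L *m (y - x)) <= M * pw (N1 (y - x)) }.

Let a0 : 0 < a. Proof. by move: gap1 b0 eps0; lra. Qed.
Let c0 : 0 < a - 2 * eps. Proof. by move: gap1 b0 eps0; lra. Qed.
Let al1 : 0 < 1 + al. Proof. by case/andP: al01 => ? ?; rewrite addr_gt0. Qed.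
Let M0 : 0 <= M.
Proof.
have h : 0 <= M * ((a - 2 * eps) `^ (1 + al) - (b + 2 * eps)).
  rewrite mulrBr subr_ge0 [M * (b + _)]mulrC; apply: le_trans M_large.
  by rewrite lerDr mulr_ge0.
by move: h; rewrite pmulr_lge0 // subr_gt0.
Qed.

Lemma pw0 : pw 0 = 0.
Proof. by rewrite /pw powR0 // gt_eqF. Qed.

Lemma pw_ge0 t : 0 <= pw t. Proof. exact: powR_ge0. Qed.

Lemma pw_le s t : 0 <= s -> s <= t -> pw s <= pw t.
Proof.
by move=> s0 st; apply: ge0_ler_powR; rewrite ?nnegrE ?(ltW al1) // (le_trans s0).
Qed.

Lemma pwM s t : 0 <= s -> 0 <= t -> pw (s * t) = pw s * pw t.
Proof. by move=> s0 t0; rewrite /pw powRM. Qed.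

Lemma pw2 t : 0 <= t -> pw (2 * t) <= 4 * pw t.
Proof.
move=> t0; rewrite pwM // ler_wpM2r ?pw_ge0 //.
have -> : 4 = 2 `^ 2%:R :> R by rewrite powR_mulrn //; ring.
by rewrite /pw ler_powR //; case/andP: al01 => ? ?; lra.
Qed.

Lemma NN_ge0 w : 0 <= NN w.
Proof. by rewrite addr_ge0 // (equiv_norm_ge0 hN1, equiv_norm_ge0 hN2). Qed.

Lemma NN1 w : N1 (P1 *m w) <= NN w.
Proof. by rewrite lerDl (equiv_norm_ge0 hN2). Qed.

Lemma NN2 w : N2 (P2 *m w) <= NN w.
Proof. by rewrite lerDr (equiv_norm_ge0 hN1). Qed.

Lemma NN_coord u v : NN (T1 *m u + T2 *m v) = N1 u + N2 v.
Proof.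
rewrite /NN !mulmxDr !mulmxA P1T1 P1T2 P2T1 P2T2 !mul1mx !mul0mx.
by rewrite addr0 add0r.
Qed.

Lemma eta0 : P1 *m eta 0 = 0 /\ P2 *m eta 0 = 0.
Proof.
have h : NN (eta 0) <= 0.
  apply: le_trans (eta_flat 0) _.
  rewrite /NN !mulmx0 (equiv_norm0 hN1) (equiv_norm0 hN2) addr0.
  by rewrite -/(pw 0) pw0 mulr0.
split.
  by apply: (equiv_norm0_eq0 hN1); apply: le_trans h; exact: NN1.
by apply: (equiv_norm0_eq0 hN2); apply: le_trans h; exact: NN2.
Qed.

Lemma graph_pointB h x y :
  graph_point h y - graph_point h x = T1 *m (y - x) + T2 *m (h y - h x).
Proof. by rewrite /graph_point !mulmxBr opprD addrACA. Qed.

Lemma graph_baseB h x y : graph_base h y - graph_base h x =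
  B *m (y - x) + P1 *m (eta (graph_point h y) - eta (graph_point h x)).
Proof. by rewrite /graph_base !mulmxBr opprD addrACA. Qed.

Lemma graph_fiberB h x y : graph_fiber h y - graph_fiber h x =
  L2 *m (h y - h x) + P2 *m (eta (graph_point h y) - eta (graph_point h x)).
Proof. by rewrite /graph_fiber !mulmxBr opprD addrACA. Qed.

Section OneGraph.
Variable h : 'cV[R]_d -> 'cV[R]_k.
Hypothesis hh : C1_graph h.

Lemma NN_graph x y : NN (graph_point h y - graph_point h x) <= 2 * N1 (y - x).
Proof.
by rewrite graph_pointB NN_coord mulr2n mulrDl mul1r lerD2l (graph_lip hh).
Qed.

Lemma NN_graph_eta x y :
  NN (eta (graph_point h y) - eta (graph_point h x)) <= 2 * eps * N1 (y - x).
Proof.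
apply: le_trans (eta_lip _ _) _.
by rewrite [2 * eps]mulrC -mulrA ler_wpM2l // NN_graph.
Qed.

Lemma graph_base_expand x y :
  (a - 2 * eps) * N1 (y - x) <= N1 (graph_base h y - graph_base h x).
Proof.
rewrite graph_baseB mulrBl.
set e := P1 *m _; have : N1 e <= 2 * eps * N1 (y - x).
  exact: le_trans (NN1 _) (NN_graph_eta _ _).
have : N1 (B *m (y - x)) <= N1 (B *m (y - x) + e) + N1 e.
  by rewrite -{1}(addrK e (B *m _)) (equiv_normB hN1).
by have := hB (y - x); lra.
Qed.

Lemma graph_fiber_lip x y :
  N2 (graph_fiber h y - graph_fiber h x) <= (b + 2 * eps) * N1 (y - x).
Proof.
rewrite graph_fiberB (le_trans (equiv_normD hN2 _ _)) // mulrDl lerD //.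
  by apply: le_trans (hL2 _) _; rewrite ler_wpM2l // (graph_lip hh).
exact: le_trans (NN2 _) (NN_graph_eta _ _).
Qed.

(** Solving for [x] through [B^-1] is a fixed point problem with contraction factor [2 eps / a]. *)
Lemma graph_base_surj z : exists x, graph_base h x = z.
Proof.
pose F x := invmx B *m (z - P1 *m eta (graph_point h x)).
have [||x Fx] := @contraction_fixpoint R d N1 C1 F (2 * eps / a) hN1.
- by rewrite divr_ge0 ?(ltW a0) ?mulr_ge0 // ltr_pdivrMr // mul1r; move: gap1 b0 eps0; lra.
- move=> x y; rewrite /F -mulmxBr.
  have -> : z - P1 *m eta (graph_point h y) - (z - P1 *m eta (graph_point h x)) =
      - (P1 *m (eta (graph_point h y) - eta (graph_point h x))).
    by rewrite mulmxBr !opprB addrC addrA subrK.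
  set e := P1 *m _; have he : N1 e <= 2 * eps * N1 (y - x).
    exact: le_trans (NN1 _) (NN_graph_eta _ _).
  rewrite mulrAC ler_pdivlMr // mulrC; apply: le_trans (hB _) _.
  by rewrite mulmxA mulmxV // mul1mx (equiv_normN hN1).
by exists x; rewrite /graph_base -{1}Fx /F mulmxA mulmxV // mul1mx subrK.
Qed.

Lemma graph_base0 : graph_base h 0 = 0.
Proof.
by rewrite /graph_base /graph_point (graph0 hh) !mulmx0 !addr0 add0r (eta0.1).
Qed.

Lemma graph_fiber0 : graph_fiber h 0 = 0.
Proof.
by rewrite /graph_fiber /graph_point (graph0 hh) !mulmx0 !addr0 add0r (eta0.2).
Qed.

Lemma pw_expand x y :
  pw (a - 2 * eps) * pw (N1 (y - x)) <= pw (N1 (graph_base h y - graph_base h x)).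
Proof.
rewrite -pwM ?(ltW c0) // ?(equiv_norm_ge0 hN1) //.
apply: pw_le (graph_base_expand _ _).
by rewrite mulr_ge0 ?(ltW c0) // (equiv_norm_ge0 hN1).
Qed.

Lemma graph_step_flat y :
  N2 (graph_fiber h y) <= M * pw (N1 (graph_base h y)).
Proof.
have := pw_expand 0 y; rewrite graph_base0 !subr0 => hp.
have E : NN (graph_point h y) <= 2 * N1 y.
  have := NN_graph 0 y; rewrite {2}/graph_point (graph0 hh) !mulmx0 addr0 !subr0.
  by [].
apply: le_trans (equiv_normD hN2 _ _) _.
apply: (@le_trans _ _ (b * (M * pw (N1 y)) + K * (4 * pw (N1 y)))).
  apply: lerD; first by apply: le_trans (hL2 _) _; rewrite ler_wpM2l // (graph_flat hh).
  apply: le_trans (NN2 _) (le_trans (eta_flat _) _); rewrite ler_wpM2l //.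
  apply: le_trans (pw2 (equiv_norm_ge0 hN1 _)); exact: pw_le (NN_ge0 _) E.
apply: (@le_trans _ _ (M * (pw (a - 2 * eps) * pw (N1 y)))); last by rewrite ler_wpM2l.
have -> : b * (M * pw (N1 y)) + K * (4 * pw (N1 y)) = (b * M + K * 4) * pw (N1 y) by ring.
rewrite [leRHS]mulrA ler_wpM2r ?pw_ge0 //; apply: le_trans M_large.
have : 0 <= eps * M by rewrite mulr_ge0.
move: K0; lra.
Qed.

(* If [R] and [Q] are the derivatives at [x] of the base and fiber maps, the
   transformed graph has derivative [Q R^-1]. *)
Lemma graph_step_taylor x : exists L : 'M[R]_(k, d),
  (forall v, N2 (L *m v) <= N1 v) /\
  forall y, N2 (graph_fiber h y - graph_fiber h x -
                L *m (graph_base h y - graph_base h x)) <=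
    M * pw (N1 (graph_base h y - graph_base h x)).
Proof.
have [L [L1 HL]] := graph_taylor hh x.
have [J [J1 HJ]] := eta_taylor (graph_point h x).
have [S SE] : exists S, S = T1 + T2 *m L by eexists.
have NS v : NN (S *m v) <= 2 * N1 v.
  by rewrite SE mulmxDl -mulmxA NN_coord mulr2n mulrDl mul1r lerD2l.
have NJS v : NN (J *m (S *m v)) <= 2 * eps * N1 v.
  apply: le_trans (J1 _) _; rewrite [2 * eps]mulrC -mulrA ler_wpM2l //.
pose Rm := B + P1 *m (J *m S); pose Q := L2 *m L + P2 *m (J *m S).
have R_low v : (a - 2 * eps) * N1 v <= N1 (Rm *m v).
  rewrite /Rm mulmxDl -!mulmxA mulrBl.
  set e := P1 *m _; have : N1 e <= 2 * eps * N1 v by exact: le_trans (NN1 _) (NJS _).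
  have : N1 (B *m v) <= N1 (B *m v + e) + N1 e.
    by rewrite -{1}(addrK e (B *m _)) (equiv_normB hN1).
  by have := hB v; lra.
have Q_le v : N2 (Q *m v) <= (b + 2 * eps) * N1 v.
  rewrite /Q mulmxDl -!mulmxA (le_trans (equiv_normD hN2 _ _)) // mulrDl lerD //.
    by apply: le_trans (hL2 _) _; rewrite ler_wpM2l.
  exact: le_trans (NN2 _) (NJS _).
have Ru : Rm \in unitmx.
  rewrite -unitmx_tr -row_free_unit; apply: inj_row_free => v vR.
  apply: trmx_inj; rewrite trmx0; apply: (equiv_norm0_eq0 hN1).
  have := R_low v^T; rewrite -[Rm]trmxK -trmx_mul vR trmx0 (equiv_norm0 hN1).
  by rewrite pmulr_rle0.
have L'_le v : N2 (Q *m invmx Rm *m v) <= N1 v.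
  rewrite -mulmxA; apply: le_trans (Q_le _) _.
  have := R_low (invmx Rm *m v); rewrite mulmxA mulmxV // mul1mx; apply: le_trans.
  rewrite ler_wpM2r ?(equiv_norm_ge0 hN1) //; move: gap1 b0 eps0; lra.
exists (Q *m invmx Rm); split=> [v|y]; first exact: L'_le.
have [D DE] : exists D, D = y - x by eexists.
have [hD hDE] : exists hD, hD = h y - h x - L *m D by eexists.
have [eD eDE] : exists eD, eD = eta (graph_point h y) - eta (graph_point h x) -
   J *m (graph_point h y - graph_point h x) by eexists.
have hD_le : N2 hD <= M * pw (N1 D) by rewrite hDE DE; exact: HL.
have eD_le : NN eD <= K * (4 * pw (N1 D)).
  rewrite eDE DE; apply: le_trans (HJ _) _; rewrite ler_wpM2l //.
  apply: le_trans (pw2 (equiv_norm_ge0 hN1 _)); exact: pw_le (NN_ge0 _) (NN_graph _ _).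
have JhD_le : NN (J *m (T2 *m hD)) <= eps * (M * pw (N1 D)).
  apply: le_trans (J1 _) _; rewrite ler_wpM2l //.
  by rewrite -[T2 *m _]add0r -(mulmx0 _ T1) NN_coord (equiv_norm0 hN1) add0r.
have etaE : eta (graph_point h y) - eta (graph_point h x) =
    eD + J *m (T2 *m hD) + J *m (S *m D).
  rewrite -addrA -mulmxDr eDE graph_pointB -DE.
  have -> : T2 *m hD + S *m D = T1 *m D + T2 *m (h y - h x).
    by rewrite hDE mulmxBr SE mulmxDl -mulmxA [T1 *m D + _]addrC addrA subrK addrC.
  by rewrite subrK.
have baseE : graph_base h y - graph_base h x =
    Rm *m D + (P1 *m eD + P1 *m (J *m (T2 *m hD))).
  rewrite graph_baseB -DE etaE !mulmxDr /Rm mulmxDl -!mulmxA.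
  by rewrite -[RHS]addrA; congr (_ + _); rewrite addrC.
have fiberE : graph_fiber h y - graph_fiber h x =
    Q *m D + (L2 *m hD + (P2 *m eD + P2 *m (J *m (T2 *m hD)))).
  have hE : h y - h x = L *m D + hD by rewrite hDE [RHS]addrC subrK.
  rewrite graph_fiberB etaE hE !mulmxDr /Q mulmxDl -!mulmxA -!addrA; congr (_ + _).
  by rewrite [RHS]addrCA; congr (_ + _); rewrite [RHS]addrC -addrA.
apply: (@le_trans _ _ ((8 * K + (b + 2 * eps) * M) * pw (N1 D))); last first.
  apply: (@le_trans _ _ (M * (pw (a - 2 * eps) * pw (N1 D)))).
    by rewrite mulrA ler_wpM2r ?pw_ge0.
  by rewrite ler_wpM2l // DE pw_expand.
(* [e1] is the nonlinear part of the base increment. The linear parts cancel, leaving the fiber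
   remainder minus [Q R^-1 e1]. The [L2] term gives [b M]; the [eta] terms of the fiber and [e1]
   give [4 K + eps M] each, whence [8 K + (b + 2 eps) M]. *)
have [e1 e1E] : exists e1, e1 = P1 *m eD + P1 *m (J *m (T2 *m hD)) by eexists.
have cancel : Q *m invmx Rm *m (Rm *m D + e1) = Q *m D + Q *m invmx Rm *m e1.
  rewrite (mulmxDr (Q *m invmx Rm)); congr (_ + _).
  by rewrite -mulmxA (mulmxA (invmx Rm)) mulVmx // mul1mx.
have -> : graph_fiber h y - graph_fiber h x -
    Q *m invmx Rm *m (graph_base h y - graph_base h x) =
    (L2 *m hD + (P2 *m eD + P2 *m (J *m (T2 *m hD)))) - Q *m invmx Rm *m e1.
  rewrite fiberE baseE -e1E cancel.
  by rewrite opprD addrACA subrr add0r.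
have e1_le : N1 e1 <= K * (4 * pw (N1 D)) + eps * (M * pw (N1 D)).
  rewrite e1E; apply: le_trans (equiv_normD hN1 _ _) _; apply: lerD.
    exact: le_trans (NN1 _) eD_le.
  exact: le_trans (NN1 _) JhD_le.
apply: le_trans (equiv_normB hN2 _ _) _.
apply: le_trans (lerD (equiv_normD hN2 _ _) (le_trans (L'_le _) e1_le)) _.
apply: le_trans (lerD (lerD (le_trans (hL2 _) (ler_wpM2l b0 hD_le))
   (equiv_normD hN2 _ _)) (lexx _)) _.
have h2 := le_trans (NN2 _) eD_le; have h3 := le_trans (NN2 _) JhD_le.
apply: le_trans (lerD (lerD (lexx _) (lerD h2 h3)) (lexx _)) _.
by rewrite -subr_ge0 [X in 0 <= X](_ : _ = 0) //; ring.
Qed.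

End OneGraph.

(** The base map is onto by contraction and injective by expansion, so the image of the graph is
    again a graph. *)
Lemma graph_transform h : C1_graph h -> exists h', C1_graph h' /\
  forall x, h' (graph_base h x) = graph_fiber h x.
Proof.
move=> hh; have [g gE] := choice (graph_base_surj hh).
pose h' z := graph_fiber h (g z).
have gK x : g (graph_base h x) = x.
  apply/subr0_eq; apply: (equiv_norm0_eq0 hN1).
  have := graph_base_expand hh x (g (graph_base h x)).
  by rewrite gE subrr (equiv_norm0 hN1) pmulr_rle0.
have h'E x : h' (graph_base h x) = graph_fiber h x by rewrite /h' gK.
exists h'; split => //; split.
- by rewrite -(graph_base0 hh) h'E graph_fiber0.
- move=> z z'; rewrite -(gE z) -(gE z') !h'E.
  apply: le_trans (graph_fiber_lip hh _ _) (le_trans _ (graph_base_expand hh _ _)).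
  rewrite ler_wpM2r ?(equiv_norm_ge0 hN1) //; move: gap1 b0 eps0; lra.
- by move=> z; rewrite -(gE z) h'E graph_step_flat.
- move=> z; have [L [L1 HL]] := graph_step_taylor hh (g z).
  exists L; split=> [v|z']; first exact: L1.
  by have := HL (g z'); rewrite !gE.
Qed.

Lemma eta_perturb h1 h2 x :
  NN (eta (graph_point h1 x) - eta (graph_point h2 x)) <= eps * N2 (h1 x - h2 x).
Proof.
apply: le_trans (eta_lip _ _) _; rewrite ler_wpM2l //.
have -> : graph_point h1 x - graph_point h2 x = T1 *m 0 + T2 *m (h1 x - h2 x).
  by rewrite /graph_point mulmx0 add0r mulmxBr opprD addrACA subrr add0r.
by rewrite NN_coord (equiv_norm0 hN1) add0r.
Qed.

Lemma graph_base_perturb h1 h2 x :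
  N1 (graph_base h1 x - graph_base h2 x) <= eps * N2 (h1 x - h2 x).
Proof.
have -> : graph_base h1 x - graph_base h2 x =
   P1 *m (eta (graph_point h1 x) - eta (graph_point h2 x)).
  by rewrite /graph_base opprD addrACA subrr add0r mulmxBr.
exact: le_trans (NN1 _) (eta_perturb _ _ _).
Qed.

Lemma graph_fiber_perturb h1 h2 x :
  N2 (graph_fiber h1 x - graph_fiber h2 x) <= (b + eps) * N2 (h1 x - h2 x).
Proof.
have -> : graph_fiber h1 x - graph_fiber h2 x =
   L2 *m (h1 x - h2 x) + P2 *m (eta (graph_point h1 x) - eta (graph_point h2 x)).
  by rewrite /graph_fiber !mulmxBr opprD addrACA.
apply: le_trans (equiv_normD hN2 _ _) _; rewrite mulrDl; apply: lerD; first exact: hL2.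
exact: le_trans (NN2 _) (eta_perturb _ _ _).
Qed.

(** Distances are measured relative to [N1 x], as graphs are unbounded but all vanish at 0. At [z],
    the base image of [x] under [h1], passing to the base image under [h2] costs [eps] by the slope
    of [h2'], and the fibers differ by the factor [b + eps]. Expansion of the base map bounds [N1 x]
    by [N1 z / (a - 2 eps)]. *)
Lemma graph_transform_contract h1 h2 h1' h2' (D : R) :
  C1_graph h1 -> C1_graph h2 -> C1_graph h1' -> C1_graph h2' ->
  (forall x, h1' (graph_base h1 x) = graph_fiber h1 x) ->
  (forall x, h2' (graph_base h2 x) = graph_fiber h2 x) ->
  (forall x, N2 (h1 x - h2 x) <= D * N1 x) ->
  forall z, N2 (h1' z - h2' z) <= D * ((b + 2 * eps) / (a - 2 * eps)) * N1 z.
Proof.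
move=> H1 H2 H1' H2' E1 E2 HD z; have [x <-] := graph_base_surj H1 z.
pose dl := N2 (h1 x - h2 x).
have -> : h1' (graph_base h1 x) - h2' (graph_base h1 x) =
    (graph_fiber h1 x - graph_fiber h2 x) +
    (h2' (graph_base h2 x) - h2' (graph_base h1 x)).
  by rewrite E1 E2 addrA subrK.
have s2 : N2 (h2' (graph_base h2 x) - h2' (graph_base h1 x)) <= eps * dl.
  apply: le_trans (graph_lip H2' _ _) _.
  by rewrite (equiv_normC hN1) graph_base_perturb.
apply: le_trans (equiv_normD hN2 _ _) (le_trans (lerD (graph_fiber_perturb _ _ _) s2) _).
rewrite -/dl; have -> : (b + eps) * dl + eps * dl = (b + 2 * eps) * dl by ring.
have Nx := graph_base_expand H1 0 x.
rewrite (graph_base0 H1) !subr0 in Nx.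
have D0' : 0 <= D * N1 x by apply: le_trans (HD x); exact: equiv_norm_ge0 hN2 _.
have be0 : 0 <= b + 2 * eps by rewrite addr_ge0 // mulr_ge0.
apply: (@le_trans _ _ ((b + 2 * eps) * (D * N1 x))); first by apply: ler_wpM2l be0 _ _ (HD x).
(* The sign of [D] can be read off only at a point where [N1 x > 0]. *)
have [->|Dn0] := eqVneq D 0; first by rewrite !mul0r mulr0.
have [xz|xn0] := eqVneq (N1 x) 0.
  have x0 : x = 0 by apply: (equiv_norm0_eq0 hN1); rewrite xz.
  by rewrite x0 (graph_base0 H1) (equiv_norm0 hN1) !mulr0.
have N0 : 0 < N1 x by rewrite lt_neqAle eq_sym xn0 (equiv_norm_ge0 hN1).
have Dp : 0 <= D by rewrite -(pmulr_lge0 _ N0).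
have -> : (b + 2 * eps) * (D * N1 x) = D * ((b + 2 * eps) * N1 x) by ring.
rewrite -[leRHS]mulrA; apply: ler_wpM2l => //.
rewrite -[leRHS]mulrA; apply: ler_wpM2l => //.
by rewrite [leRHS]mulrC ler_pdivlMr // mulrC.
Qed.


Lemma zero_graph : C1_graph (fun=> 0).
Proof.
split=> //.
- by move=> x y; rewrite subrr (equiv_norm0 hN2) (equiv_norm_ge0 hN1).
- by move=> y; rewrite (equiv_norm0 hN2) mulr_ge0 ?pw_ge0.
move=> x; exists 0; split=> [v|y]; rewrite mul0mx ?subrr (equiv_norm0 hN2).
  exact: equiv_norm_ge0 hN1 _.
by rewrite mulr_ge0 ?pw_ge0.
Qed.

Lemma invariant_graph : exists h, C1_graph h /\
  forall x, h (graph_base h x) = graph_fiber h x.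
Proof.
(* To obtain a total function for the iteration, graphs outside the class are sent to themselves. *)
have /choice[nxt Hnxt] : forall h, exists h', C1_graph h -> C1_graph h' /\
    forall x, h' (graph_base h x) = graph_fiber h x.
  move=> h; have [hh|nh] := pselect (C1_graph h).
    by have [h' Hh'] := graph_transform hh; exists h'.
  by exists h => /nh.
pose hs i := iter i nxt (fun=> 0).
have Hs i : C1_graph (hs i).
  elim: i => [|i IH]; first exact: zero_graph.
  by have [] := Hnxt _ IH.
have Es i x : hs i.+1 (graph_base (hs i) x) = graph_fiber (hs i) x.
  by have [_] := Hnxt _ (Hs i); apply.
pose th := (b + 2 * eps) / (a - 2 * eps).
have th0 : 0 <= th by rewrite divr_ge0 ?(ltW c0) // addr_ge0 // mulr_ge0.
have th1 : th < 1 by rewrite ltr_pdivrMr // mul1r; move: gap1 b0 eps0; lra.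
have step i x : N2 (hs i.+1 x - hs i x) <= th ^+ i * N1 x.
  elim: i x => [|i IH] x.
    rewrite expr0 mul1r -[X in N1 X]subr0.
    by apply: le_trans (graph_lip (Hs 1) 0 x); rewrite (graph0 (Hs 1)) !subr0.
  by rewrite exprSr; apply: graph_transform_contract IH x.
have cvgx x : cvgn (fun i => hs i x).
  apply: (@geometric_cvg _ _ _ (N1 x) th); first by rewrite th0.
  by move=> i; apply: le_trans (equiv_norm_ge hN2 _) _; rewrite mulrC.
pose h x := limn (fun i => hs i x).
have hsx x : (fun i => hs i x) @ \oo --> h x by exact: cvgx.
have diff0 x : (fun i => N2 (hs i x - h x)) @ \oo --> (0 : R).
  rewrite -(equiv_norm0 hN2) -(subrr (h x)); apply: (equiv_norm_cvg hN2).
  by apply: cvg_sub_seq => //; exact: cvg_cst.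
exists h; split.
- split.
  + have : (fun i => hs i 0) @ \oo --> (0 : 'cV[R]_k).
      have -> : (fun i => hs i 0) = cst 0 by apply/funext => i; exact: graph0 (Hs i).
      exact: cvg_cst.
    move=> h00; exact: (cvg_unique _ (hsx 0) h00).
  + move=> x y; apply: (cvg_le_of_near hN2 (cvg_sub_seq (hsx y) (hsx x))) => i.
    exact: graph_lip (Hs i) _ _.
  + by move=> y; apply: (cvg_le_of_near hN2 (hsx y)) => i; exact: graph_flat (Hs i) _.
  + move=> x; have /choice[L HL] : forall i, exists L : 'M[R]_(k, d),
      (forall v, N2 (L *m v) <= N1 v) /\
      forall y, N2 (hs i y - hs i x - L *m (y - x)) <= M * pw (N1 (y - x)).
      by move=> i; exact: graph_taylor (Hs i) x.
    (* The derivatives [L i] need not converge. Any limit along a finer filter will do, since only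
       closed inequalities at fixed [x] and [y] have to pass to the limit. *)
    have [|G [l [GP Goo Ll]]] := @bounded_ultra_cvg R k d L (`|C1|).
      move=> i; apply: mx_norm_le => // p q.
      have -> : L i p q = (L i *m (delta_mx q 0 : 'cV[R]_d)) p 0 by rewrite -colE mxE.
      apply: le_trans (mx_norm_ge _ p 0) _; apply: le_trans (equiv_norm_ge hN2 _) _.
      apply: le_trans ((HL i).1 _) _; apply: le_trans (equiv_norm_le hN1 _) _.
      apply: le_trans (ler_norm _) _; rewrite normrM normr_id ler_piMr //.
      apply: mx_norm_le => // s t; rewrite mxE; case: (_ && _) => /=.
        by rewrite normr1.
      by rewrite normr0.
    have Llv (v : 'cV[R]_d) : (fun i => L i *m v) @ G --> l *m v.
      apply/cvgrPdist_le => e1 e10.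
      have K1 : 0 < d%:R * `|v| + 1 by rewrite ltr_wpDl // mulr_ge0.
      move/cvgrPdist_le: Ll => /(_ (e1 / (d%:R * `|v| + 1))).
      rewrite divr_gt0 // => /(_ isT); apply: filterS => i.
      rewrite ler_pdivlMr // => H; rewrite -mulmxBl.
      apply: le_trans (mulmx_norm_le _ _) (le_trans _ H).
      by rewrite mulrAC mulrC ler_wpM2l // lerDl.
    have hG y : (fun i => hs i y) @ G --> h y.
      exact: cvg_trans (cvg_app _ Goo) (hsx y).
    exists l; split=> [v|y].
      by apply: (cvg_le_of_near hN2 (Llv v)) => i; exact: (HL i).1.
    apply: (cvg_le_of_near hN2 (cvg_sub_seq (cvg_sub_seq (hG y) (hG x)) (Llv (y - x)))).
    by move=> i; exact: (HL i).2.
- move=> x; apply/subr0_eq; apply: (equiv_norm0_eq0 hN2).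
  set z := graph_base h x.
  have dz := diff0 z.
  have dz1 : (fun i => N2 (hs i.+1 z - h z)) @ \oo --> (0 : R).
    by have := dz; rewrite -(cvg_shiftS (fun i => N2 (hs i z - h z)) (nbhs (0 : R))).
  have : (fun i => N2 (hs i.+1 z - h z) + (eps + (b + eps)) * N2 (hs i x - h x)) @ \oo
      --> 0 + (eps + (b + eps)) * 0.
    by apply: cvgD dz1 _; apply: cvgMl_tmp (diff0 x).
  rewrite mulr0 addr0 => /cvgr_to_ge; apply; apply: nearW => i.
  have -> : h z - graph_fiber h x = (h z - hs i.+1 z) +
      ((hs i.+1 z - hs i.+1 (graph_base (hs i) x)) +
      (graph_fiber (hs i) x - graph_fiber h x)).
    by rewrite Es addrA subrKA addrA subrK.
  apply: le_trans (equiv_normD hN2 _ _) _; apply: lerD.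
    by rewrite (equiv_normC hN2).
  apply: le_trans (equiv_normD hN2 _ _) _; rewrite [leRHS]mulrDl; apply: lerD.
    apply: le_trans (graph_lip (Hs i.+1) _ _) _.
    by rewrite (equiv_normC hN1) graph_base_perturb.
  exact: graph_fiber_perturb.
Qed.

End GraphTransform.

Section SlowGraph.
Context {R : realType}.

Definition small_C1_extension n (ft eta : 'cV[R]_n -> 'cV[R]_n) (rho K al : R) : Prop :=
  [/\ forall x : 'cV[R]_n, `|x| <= rho -> eta x = ft x,
      forall x y : 'cV[R]_n, `|eta y - eta x| <= K * `|y - x|,
      forall y : 'cV[R]_n, `|eta y| <= K * `|y| ^+ 2 &
      forall x : 'cV[R]_n, exists J : 'M[R]_n,
        (forall v : 'cV[R]_n, `|J *m v| <= K * `|v|) /\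
        forall y : 'cV[R]_n,
          `|eta y - eta x - J *m (y - x)| <= K * `|y - x| `^ (1 + al)].

(** Stated in the library norm, so that the construction from adapted norms and the case of a
    trivial fiber provide the same interface. *)
Definition invariant_C1_graph n d k (P1 : 'M[R]_(d, n)) (P2 : 'M[R]_(k, n))
    (T1 : 'M[R]_(n, d)) (T2 : 'M[R]_(n, k)) (B : 'M[R]_d) (L2 : 'M[R]_k)
    (eta : 'cV[R]_n -> 'cV[R]_n) (h : 'cV[R]_d -> 'cV[R]_k) (M al : R) : Prop :=
  [/\ h 0 = 0,
      forall x y : 'cV[R]_d, `|h y - h x| <= M * `|y - x|,
      forall y : 'cV[R]_d, `|h y| <= M * `|y| `^ (1 + al),
      forall x : 'cV[R]_d, exists L : 'M[R]_(k, d), forall y : 'cV[R]_d,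
        `|h y - h x - L *m (y - x)| <= M * `|y - x| `^ (1 + al) &
      forall x, h (B *m x + P1 *m eta (T1 *m x + T2 *m h x)) =
                L2 *m h x + P2 *m eta (T1 *m x + T2 *m h x)].

(* [al = ln rho / (ln a1 + ln rho)] with [rho = b1 / a1]. *)
Lemma powR_gap (b1 a1 : R) : 0 < b1 -> b1 < a1 -> a1 < 1 ->
  exists2 al : R, 0 < al < 1 & b1 < a1 `^ (1 + al).
Proof.
move=> b0 ba a1lt; have a0 : 0 < a1 by exact: lt_trans ba.
pose rho := b1 / a1; have rho0 : 0 < rho by rewrite divr_gt0.
have rho1 : rho < 1 by rewrite ltr_pdivrMr // mul1r.
have lP : ln rho < 0 by rewrite ln_lt0 // rho0.
have lA : ln a1 < 0 by rewrite ln_lt0 // a0.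
have lS : ln a1 + ln rho < 0 by lra.
pose al := ln rho / (ln a1 + ln rho).
have alE : al * (ln a1 + ln rho) = ln rho by rewrite divfK // lt_eqF.
have al0 : 0 < al by rewrite -(nmulr_llt0 _ lS) alE.
have al1 : al < 1 by rewrite -(ltr_nM2r lS) alE mul1r; lra.
exists al; first by rewrite al0.
rewrite powRD; last by rewrite gt_eqF // addr_gt0.
rewrite powRr1 ?(ltW a0) // mulrC -ltr_pdivrMr // -/rho.
rewrite -[ltLHS]lnK // /powR gt_eqF // ltr_expR.
have : al * ln rho < 0 by rewrite pmulr_rlt0.
by move: alE; rewrite mulrDr; lra.
Qed.

Lemma spectral_gap_exponent (a b : R) : 0 < b -> b < a -> a < 1 ->
  exists eps al : R, [/\ 0 < eps, 0 < al < 1, b + 4 * eps < a &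
    b + 2 * eps < (a - 2 * eps) `^ (1 + al)].
Proof.
(* [b + 4 eps] is then the midpoint of [b] and [a], while [b + 2 eps] and [a - 2 eps] are the
   quarter points. *)
move=> b0 ba a1; pose eps := (a - b) / 8.
have eE : 8 * eps = a - b by rewrite mulrC divfK.
have e0 : 0 < eps by rewrite divr_gt0 // subr_gt0.
have [|||al al01 h] := @powR_gap (b + 2 * eps) (a - 2 * eps); try lra.
by exists eps, al; split => //; lra.
Qed.

(** The power [1 + al] dominates the square for [t <= 1] and the identity for [t > 1]. *)
Lemma sqr_le_powR (x t K E al : R) : 0 <= t -> 0 < al < 1 -> 0 <= K -> 0 <= E ->
  x <= E * t -> x <= K * t ^+ 2 -> x <= (K + E) * t `^ (1 + al).
Proof.
move=> t0 /andP[al0 al1] K0 E0 h1 h2; rewrite mulrDl.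
have [tn|tp] := leP t 1.
  apply: le_trans h2 _; apply: ler_wpDr; first by rewrite mulr_ge0 ?powR_ge0.
  rewrite ler_wpM2l // -powR_mulrn //.
  have [->|tne] := eqVneq t 0; first by rewrite !powR0 ?gt_eqF // addr_gt0.
  apply: ger_powR; last by lra.
  by rewrite lt_neqAle eq_sym tne t0 tn.
apply: le_trans h1 _; apply: ler_wpDl; first by rewrite mulr_ge0 ?powR_ge0.
rewrite ler_wpM2l // -[leLHS]powRr1 // ler_powR ?(ltW tp) //; lra.
Qed.

Lemma slow_graph (n d k : nat) (P1 : 'M[R]_(d, n)) (P2 : 'M[R]_(k, n))
    (T1 : 'M[R]_(n, d)) (T2 : 'M[R]_(n, k)) (B : 'M[R]_d) (L2 : 'M[R]_k)
    (N1 : 'cV[R]_d -> R) (C1 : R) (N2 : 'cV[R]_k -> R) (C2 a b : R)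
    (ft : 'cV[R]_n -> 'cV[R]_n) :
  P1 *m T1 = 1%:M -> P1 *m T2 = 0 -> P2 *m T1 = 0 -> P2 *m T2 = 1%:M ->
  T1 *m P1 + T2 *m P2 = 1%:M ->
  equiv_norm N1 C1 -> equiv_norm N2 C2 -> B \in unitmx ->
  (forall x, a * N1 x <= N1 (B *m x)) -> (forall v, N2 (L2 *m v) <= b * N2 v) ->
  0 < b -> b < a -> a < 1 ->
  ft =o_ (0 : 'cV[R]_n) id -> Ck_near 2 (0 : 'cV[R]_n) ft ->
  exists (eta : 'cV[R]_n -> 'cV[R]_n) (h : 'cV[R]_d -> 'cV[R]_k) (rho K M al : R),
  [/\ [/\ 0 < rho, 0 <= K, 0 <= M & 0 < al < 1],
      small_C1_extension ft eta rho K al &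
      invariant_C1_graph P1 P2 T1 T2 B L2 eta h M al].
Proof.
move=> P1T1 P1T2 P2T1 P2T2 TP hN1 hN2 Bu hB hL2 b0 ba a1 oft C2ft.
have [eps [al [e0 al01 g1 g2]]] := spectral_gap_exponent b0 ba a1.
have [p1 p10 Hp1] := mulmx_bound P1; have [p2 p20 Hp2] := mulmx_bound P2.
have [t1 t10 Ht1] := mulmx_bound T1; have [t2 t20 Ht2] := mulmx_bound T2.
pose NN := prod_norm N1 N2 P1 P2.
pose cu := `|C1| * p1 + `|C2| * p2 + 1; pose cl := t1 + t2.
have cu0 : 0 < cu by rewrite ltr_wpDl // addr_ge0 // mulr_ge0 // ltW.
have cl0 : 0 < cl by rewrite addr_gt0.
have NNu (w : 'cV[R]_n) : NN w <= cu * `|w|.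
  have Cle q (N : 'cV[R]_q -> R) C p (P : 'M[R]_(q, n)) : equiv_norm N C ->
      (forall x : 'cV[R]_n, `|P *m x| <= p * `|x|) -> N (P *m w) <= `|C| * p * `|w|.
    move=> hN Hp; apply: le_trans (equiv_norm_le hN _) _.
    apply: le_trans (ler_wpM2r (normr_ge0 _) (ler_norm C)) _.
    by rewrite -mulrA ler_wpM2l.
  rewrite /NN /prod_norm /cu !mulrDl mul1r ler_wpDr // lerD //; exact: Cle.
have NNl (w : 'cV[R]_n) : `|w| <= cl * NN w.
  rewrite -{1}(mul1mx w) -TP mulmxDl -!mulmxA (le_trans (ler_normD _ _)) // mulrDl.
  apply: lerD.
    apply: le_trans (Ht1 _) _; rewrite ler_pM2l //.
    by apply: le_trans (equiv_norm_ge hN1 _) _; exact: NN1 hN2 _ _ _.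
  apply: le_trans (Ht2 _) _; rewrite ler_pM2l //.
  by apply: le_trans (equiv_norm_ge hN2 _) _; exact: NN2 hN1 _ _ _.
have NN0 w : 0 <= NN w by exact: (NN_ge0 hN1 hN2).
(* [cu cl] is the price of passing from the product norm to the library norm and back; the cap 1
   lets one constant [Ks + 1] bound everything in the conclusion. *)
pose e' := Num.min 1 (eps / (cu * cl)).
have e'0 : 0 < e' by rewrite lt_min ltr01 divr_gt0 // mulr_gt0.
have e'1 : e' <= 1 by rewrite ge_min lexx.
have e'2 : cu * (e' * cl) <= eps.
  have : e' <= eps / (cu * cl) by rewrite ge_min lexx orbT.
  by rewrite ler_pdivlMr ?mulr_gt0 // mulrCA.
have [eta [rho [K [[rho0 K0] eta_id eta_lip eta_flat eta_taylor]]]] :=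
  small_extension oft C2ft e'0.
have eta0 : eta 0 = 0.
  by apply/eqP; rewrite -normr_le0; have := eta_flat 0; rewrite normr0 expr0n mulr0.
(* The linear bound on the Taylor remainder is [2 e']: one [e'] for the increment of [eta], one for
   [J]. *)
pose Ks := K + 2 * e'.
have Ks0 : 0 <= Ks by rewrite addr_ge0 // mulr_ge0 // ltW.
have eta_flat' (y : 'cV[R]_n) : `|eta y| <= Ks * `|y| `^ (1 + al).
  apply: sqr_le_powR => //; first by rewrite mulr_ge0 // ltW.
  have := eta_lip 0 y; rewrite eta0 !subr0 => /le_trans; apply.
  by rewrite ler_wpM2r // ler_peMl ?(ltW e'0) // ler1n.
have eta_taylor' x : exists J : 'M[R]_n, (forall v : 'cV[R]_n, `|J *m v| <= e' * `|v|) /\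
    forall y : 'cV[R]_n, `|eta y - eta x - J *m (y - x)| <= Ks * `|y - x| `^ (1 + al).
  have [J [J1 HJ]] := eta_taylor x; exists J; split=> [v|y]; first exact: J1.
  apply: sqr_le_powR => //; first by rewrite mulr_ge0 // ltW.
  apply: le_trans (ler_normB _ _) _.
  have -> t : 2 * e' * t = e' * t + e' * t by ring.
  by rewrite lerD.
pose KN := cu * (Ks * cl `^ (1 + al)).
have KN0 : 0 <= KN by rewrite !mulr_ge0 ?powR_ge0 // ltW.
have al1 : 0 <= 1 + al by case/andP: al01 => ? ?; rewrite addr_ge0 // ltW.
have toKN (w z : 'cV[R]_n) : `|w| <= Ks * `|z| `^ (1 + al) -> NN w <= KN * NN z `^ (1 + al).
  move=> h; apply: le_trans (NNu w) _; rewrite /KN -mulrA ler_wpM2l ?(ltW cu0) //.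
  apply: le_trans h _; rewrite -mulrA ler_wpM2l // -powRM ?(ltW cl0) //.
  by apply: ge0_ler_powR; rewrite ?nnegrE // mulr_ge0 // ltW.
have toe (w z : 'cV[R]_n) : `|w| <= e' * `|z| -> NN w <= eps * NN z.
  move=> h; apply: le_trans (NNu w) _.
  apply: (@le_trans _ _ (cu * (e' * cl) * NN z)); last by rewrite ler_wpM2r.
  rewrite -mulrA ler_wpM2l ?(ltW cu0) // -mulrA.
  by apply: le_trans h _; rewrite ler_wpM2l // ltW.
pose gp := (a - 2 * eps) `^ (1 + al) - (b + 2 * eps).
have gp0 : 0 < gp by rewrite subr_gt0.
(* The smallest value allowed by the condition on [M], which becomes an equality. *)
pose MM := 8 * KN / gp.
have MM0 : 0 <= MM by apply: divr_ge0; [exact: mulr_ge0|exact: ltW].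
have MMl : 8 * KN + (b + 2 * eps) * MM <= MM * (a - 2 * eps) `^ (1 + al).
  have : MM * gp = 8 * KN by rewrite divfK // gt_eqF.
  by rewrite /gp mulrBr; lra.
have etaL x y : NN (eta y - eta x) <= eps * NN (y - x) by apply: toe.
have etaT x : exists J : 'M[R]_n, (forall w, NN (J *m w) <= eps * NN w) /\
    forall y, NN (eta y - eta x - J *m (y - x)) <= KN * NN (y - x) `^ (1 + al).
  have [J [J1 HJ]] := eta_taylor' x; exists J; split=> [w|y]; first exact: toe.
  exact: toKN.
have etaF y : NN (eta y) <= KN * NN y `^ (1 + al) by apply: toKN.
have [h [hh hinv]] := invariant_graph hN1 hN2 P1T1 P1T2 P2T1 P2T2 Bu hB hL2
  etaL etaT etaF (ltW e0) al01 KN0 (ltW b0) g1 g2 MMl.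
pose Mf := `|C1| + MM * `|C1| `^ (1 + al).
have MC0 : 0 <= MM * `|C1| `^ (1 + al) by rewrite mulr_ge0 ?powR_ge0.
have N1C (y : 'cV[R]_d) : N1 y <= `|C1| * `|y|.
  by apply: le_trans (equiv_norm_le hN1 _) _; rewrite ler_wpM2r // ler_norm.
have toMf (v : 'cV[R]_k) (y : 'cV[R]_d) :
    N2 v <= MM * N1 y `^ (1 + al) -> `|v| <= Mf * `|y| `^ (1 + al).
  move=> hv; apply: le_trans (equiv_norm_ge hN2 _) (le_trans hv _).
  apply: (@le_trans _ _ (MM * `|C1| `^ (1 + al) * `|y| `^ (1 + al))); last first.
    by rewrite ler_wpM2r ?powR_ge0 // lerDr.
  rewrite -mulrA ler_wpM2l // -powRM //.
  by apply: ge0_ler_powR; rewrite ?nnegrE ?mulr_ge0 // (equiv_norm_ge0 hN1).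
exists eta, h, rho, (Ks + 1), Mf, al; split.
- by split=> //; apply: addr_ge0.
- split => //.
  + move=> x y; apply: le_trans (eta_lip x y) _; rewrite ler_wpM2r //.
    by rewrite (le_trans e'1) // lerDr.
  + move=> y; apply: le_trans (eta_flat y) _; rewrite ler_wpM2r ?sqr_ge0 //.
    by rewrite /Ks -addrA lerDl addr_ge0 // mulr_ge0 // ltW.
  + move=> x; have [J [J1 HJ]] := eta_taylor' x; exists J; split=> [v|y].
      apply: le_trans (J1 v) _; rewrite ler_wpM2r //.
      by rewrite (le_trans e'1) // lerDr.
    by apply: le_trans (HJ y) _; rewrite ler_wpM2r ?powR_ge0 // lerDl.
- split=> //; first exact: graph0 hh.
  + move=> x y; apply: le_trans (equiv_norm_ge hN2 _) _.
    apply: le_trans (graph_lip hh _ _) (le_trans (N1C _) _).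
    by rewrite ler_wpM2r // lerDl.
  + by move=> y; apply: toMf; exact: graph_flat hh _.
  + move=> x; have [L [_ HL]] := graph_taylor hh x.
    by exists L => y; apply: toMf; exact: HL.
Qed.

End SlowGraph.

(** * The spectral submanifold *)

Section SSM.
Context {R : realType}.

Lemma fnorm_le_norm m n (M : 'M[R]_(m, n)) : fnorm M <= (m * n)%:R * `|M|.
Proof.
have mn0 : 0 <= (m * n)%:R * `|M| by rewrite mulr_ge0.
rewrite -[leRHS]ger0_norm // -sqrtr_sqr ler_wsqrtr //.
apply: (@le_trans _ _ ((m * n)%:R * `|M| ^+ 2)).
  apply: (@le_trans _ _ (\sum_(i < m) \sum_(j < n) `|M| ^+ 2)).
    rewrite ler_sum // => i _; rewrite ler_sum // => j _.
    by rewrite -[M i j ^+ 2]real_normK ?num_real // ler_sqr ?nnegrE // mx_norm_ge.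
  by rewrite !sumr_const !card_ord -mulrnA mulr_natl mulnC.
rewrite exprMn ler_wpM2r ?sqr_ge0 // expr2 -natrM ler_nat.
by case: (m * n)%N => // p; rewrite leq_pmull.
Qed.

Lemma lipschitz_holder_near (V W : normedModType R) (p : V) (g : V -> W) (C : R) :
  (forall x y, `|g y - g x| <= C * `|y - x|) -> holder_near p g.
Proof.
move=> H; exists 1, C, setT; split; first by rewrite ltr01 lexx.
  exact: filterT.
by move=> x y _ _; rewrite powRr1 // [`|x - y|]distrC distrC.
Qed.

Lemma taylor_rank n d (g : 'cV[R]_d -> 'cV[R]_n) (P : 'M[R]_(d, n)) (x : 'cV[R]_d)
    (G : 'M[R]_(n, d)) (M al : R) :
  0 < al -> (forall y, `|g y - g x - G *m (y - x)| <= M * `|y - x| `^ (1 + al)) ->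
  P *m G = 1%:M -> \rank (jac g x) = d.
Proof.
move=> al0 H PG; have [_ /diff_mulmx_jac ->] := taylor_diff al0 H.
apply/eqP; rewrite eqn_leq rank_leq_col /=.
by have := mxrankM_maxr P G; rewrite PG mxrank1.
Qed.

Lemma norm_sublevel_open n d (T : 'M[R]_(n, d)) (N : 'cV[R]_n -> R) (C rho : R) :
  equiv_norm N C -> open [set u : 'cV[R]_d | N (T *m u) < rho].
Proof.
move=> hN; have [t t0 Ht] := mulmx_bound T.
have c0 : 0 < (`|C| + 1) * t by rewrite mulr_gt0 // ltr_wpDl.
have -> : [set u : 'cV[R]_d | N (T *m u) < rho] =
   (fun u : 'cV[R]_d => N (T *m u)) @^-1` [set x : R | x < rho] by [].
apply: open_comp; last exact: open_lt.
move=> u _; apply: continuous_at_norm => eps e0.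
exists (eps / ((`|C| + 1) * t)); first by rewrite divr_gt0.
move=> y; rewrite ltr_pdivlMr // mulrC => /ltW h.
have H v : N (T *m v) <= (`|C| + 1) * t * `|v|.
  apply: le_trans (equiv_norm_le hN _) _; rewrite -mulrA.
  apply: le_trans (ler_wpM2r (normr_ge0 _) (ler_norm C)) _.
  by apply: ler_pM => //; rewrite lerDl.
rewrite ler_norml lerNl opprB.
apply/andP; split.
  apply: le_trans (equiv_norm_lipschitz hN _ _) _; rewrite -mulmxBr.
  by apply: le_trans (H _) _; rewrite distrC.
apply: le_trans (equiv_norm_lipschitz hN _ _) _; rewrite -mulmxBr.
exact: le_trans (H _) h.
Qed.

Lemma ssm_of_graph (n d k : nat) (A : 'M[R]_n) (f ft eta : 'cV[R]_n -> 'cV[R]_n)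
    (P1 : 'M[R]_(d, n)) (P2 : 'M[R]_(k, n)) (T1 : 'M[R]_(n, d)) (T2 : 'M[R]_(n, k))
    (B : 'M[R]_d) (L2 : 'M[R]_k) (E : 'M[R]_n) (h : 'cV[R]_d -> 'cV[R]_k)
    (rho K M al q CA : R) (NA : 'cV[R]_n -> R) :
  (forall x, f x = A *m x + ft x) ->
  P1 *m T1 = 1%:M -> P1 *m T2 = 0 -> P2 *m T1 = 0 -> P2 *m T2 = 1%:M ->
  T1 *m P1 + T2 *m P2 = 1%:M ->
  A *m T1 = T1 *m B -> P1 *m A = B *m P1 -> P2 *m A = L2 *m P2 ->
  equiv_norm NA CA -> 0 < q < 1 -> (forall x, NA (A *m x) <= q * NA x) ->
  (T1^T == E)%MS ->
  [/\ 0 < rho, 0 <= K, 0 <= M & 0 < al < 1] ->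
  small_C1_extension ft eta rho K al ->
  invariant_C1_graph P1 P2 T1 T2 B L2 eta h M al ->
  exists (W : set 'cV[R]_n) (O : set 'cV[R]_d)
         (gam : 'cV[R]_d -> 'cV[R]_n) (r : 'cV[R]_d -> 'cV[R]_d),
    attracting_SSM f E W O gam r /\ jac r 0 = B.
Proof.
move=> hf P1T1 P1T2 P2T1 P2T2 TP AT P1A P2A hNA /andP[q0 q1] hA hE.
move=> [rho0 K0 M0 /andP[al0 al1]] [eta_id eta_lip eta_flat eta_taylor].
move=> [h0 h_lip h_flat h_taylor h_inv].
have [p1 p10 Hp1] := mulmx_bound P1.
have [t1 t10 Ht1] := mulmx_bound T1; have [t2 t20 Ht2] := mulmx_bound T2.
have [b b0 Hb] := mulmx_bound B.
have [cA cA0 HcA] : exists2 cA : R, 0 < cA & forall x, NA x <= cA * `|x|.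
  exists (`|CA| + 1); first by rewrite ltr_wpDl.
  move=> x; apply: le_trans (equiv_norm_le hNA _) _; rewrite ler_wpM2r //.
  by rewrite (le_trans (ler_norm _)) // lerDl.
have al1' : 0 <= 1 + al by rewrite addr_ge0 // ltW.
have [gam gamE] : exists gam : 'cV[R]_d -> 'cV[R]_n,
    forall u, gam u = T1 *m u + T2 *m h u by eexists.
have [r rE] : exists r : 'cV[R]_d -> 'cV[R]_d,
    forall u, r u = B *m u + P1 *m eta (gam u) by eexists.
have gam0 : gam 0 = 0 by rewrite gamE h0 !mulmx0 addr0.
have eta0 : eta 0 = 0.
  by apply/eqP; rewrite -normr_le0; have := eta_flat 0; rewrite normr0 expr0n mulr0.
pose G := t1 + t2 * M.
have G0 : 0 < G by rewrite ltr_wpDr // mulr_ge0 // ltW.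
have gam_lip (x y : 'cV[R]_d) : `|gam y - gam x| <= G * `|y - x|.
  rewrite !gamE opprD addrACA -!mulmxBr (le_trans (ler_normD _ _)) // mulrDl lerD //.
  by apply: le_trans (Ht2 _) _; rewrite -mulrA ler_pM2l.
have gam_norm (u : 'cV[R]_d) : `|gam u| <= G * `|u|.
  by have := gam_lip 0 u; rewrite gam0 !subr0.
(* The conjugacy holds globally for the extended map [A + eta]; it concerns [f] only where [eta] and
   [ft] agree. *)
have conj u : A *m gam u + eta (gam u) = gam (r u).
  rewrite -[LHS]mul1mx -TP mulmxDl -!mulmxA [in RHS]gamE.
  have -> : P1 *m (A *m gam u + eta (gam u)) = r u.
    rewrite mulmxDr mulmxA P1A -mulmxA rE; congr (B *m _ + _).
    by rewrite gamE mulmxDr !mulmxA P1T1 P1T2 mul1mx mul0mx addr0.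
  congr (_ + T2 *m _).
  rewrite rE gamE h_inv mulmxDr mulmxA P2A -mulmxA; congr (L2 *m _ + _).
  by rewrite mulmxDr !mulmxA P2T1 P2T2 mul1mx mul0mx add0r.
(* The first summand controls the nonlinear part of the reduced dynamics, the second that of the
   full system, so one radius serves invariance and attraction. *)
pose c := cA * t1 * p1 * K * (G * p1) ^+ 2 + cA * K.
have cc0 : 0 <= cA * t1 * p1 * K * (G * p1) ^+ 2.
  apply: mulr_ge0; last exact: sqr_ge0.
  by apply: mulr_ge0 => //; rewrite ltW // !mulr_gt0.
have c0 : 0 <= c by apply: addr_ge0 => //; rewrite mulr_ge0 // ltW.
(* The first bound keeps the graph over [O], and through the [+ 1] also the [NA]-ball of radius
   [rho1], where [eta = ft]. The second makes the quadratic error at most [(1 - q) / 2] times the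
   norm, so the rate [q] degrades only to the midpoint [q'] of [q] and 1. *)
pose rho1 := Num.min (rho / (G * p1 + 1)) ((1 - q) / 2 / (c + 1)).
have Gp0 : 0 < G * p1 by rewrite mulr_gt0.
have Gp1 : 0 < G * p1 + 1 by rewrite ltr_wpDl // ltW.
have cp : 0 < c + 1 by rewrite ltr_wpDl.
have q1' : 0 < 1 - q by rewrite subr_gt0.
have rho10 : 0 < rho1 by rewrite lt_min !divr_gt0.
have rho1_Gp : (G * p1 + 1) * rho1 <= rho.
  by rewrite mulrC -ler_pdivlMr // ge_min lexx.
have rho1_G : G * p1 * rho1 <= rho.
  by apply: le_trans rho1_Gp; rewrite ler_pM2r // lerDl.
have rho1_rho : rho1 <= rho.
  by apply: le_trans rho1_Gp; rewrite ler_peMl ?(ltW rho10) // lerDr ltW.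
have rho1_c : c * rho1 <= (1 - q) / 2.
  apply: (@le_trans _ _ ((c + 1) * rho1)); first by rewrite ler_pM2r // lerDl.
  by rewrite mulrC -ler_pdivlMr // ge_min lexx orbT.
pose q' := (1 + q) / 2.
have q'0 : 0 < q' by rewrite divr_gt0 // addr_gt0.
have q'1 : q' < 1 by rewrite ltr_pdivrMr // mul1r mulr2n ltrD2l.
have shrink s e : 0 <= s -> s < rho1 -> e <= c * s ^+ 2 -> q * s + e <= q' * s.
  move=> s0 sr he; have : c * s ^+ 2 <= (1 - q) / 2 * s.
    by rewrite expr2 mulrA ler_wpM2r // (le_trans _ rho1_c) // ler_wpM2l // ltW.
  have -> : q' * s = q * s + (1 - q) / 2 * s by rewrite /q'; field.
  by move=> h1; rewrite lerD2l (le_trans he).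
have NA0 x : 0 <= NA x by exact: equiv_norm_ge0 hNA x.
have u_le u : `|u| <= p1 * NA (T1 *m u).
  rewrite -{1}(mul1mx u) -P1T1 -mulmxA; apply: le_trans (Hp1 _) _.
  by rewrite ler_pM2l // (equiv_norm_ge hNA).
have gam_le u : `|gam u| <= G * p1 * NA (T1 *m u).
  by apply: le_trans (gam_norm u) _; rewrite -mulrA ler_pM2l.
(* Since [A T1 = T1 B], a norm contracted by [A] pulls back to one contracted by [B]; its sublevel
   sets are forward invariant under the reduced dynamics. *)
pose O := [set u : 'cV[R]_d | NA (T1 *m u) < rho1].
have gam_rho u : O u -> `|gam u| <= rho.
  move=> Ou; apply: le_trans (gam_le u) (le_trans _ rho1_G).
  by rewrite ler_pM2l // ltW.
have fgam u : O u -> f (gam u) = gam (r u).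
  by move=> Ou; rewrite -conj hf eta_id // gam_rho.
have Or u : O u -> O (r u).
  move=> Ou; rewrite /O /= rE mulmxDr mulmxA -AT -mulmxA.
  apply: le_lt_trans (equiv_normD hNA _ _) _.
  apply: (@le_lt_trans _ _ (q * NA (T1 *m u) + NA (T1 *m (P1 *m eta (gam u))))).
    by rewrite lerD2r.
  apply: (@le_lt_trans _ _ (q' * NA (T1 *m u))).
    apply: shrink => //.
    apply: (@le_trans _ _ (cA * t1 * p1 * K * (G * p1) ^+ 2 * NA (T1 *m u) ^+ 2)); last first.
      by rewrite ler_wpM2r ?sqr_ge0 // lerDl mulr_ge0 // ltW.
    apply: le_trans (HcA _) _; rewrite -!mulrA ler_pM2l //.
    apply: le_trans (Ht1 _) _; rewrite ler_pM2l //.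
    apply: le_trans (Hp1 _) _; rewrite ler_pM2l //.
    apply: le_trans (eta_flat _) _; rewrite ler_wpM2l //.
    rewrite [leRHS](_ : _ = (G * p1 * NA (T1 *m u)) ^+ 2); last by ring.
    by rewrite ler_sqr ?nnegrE // mulr_ge0 // ltW.
  by apply: le_lt_trans Ou; rewrite ler_piMl // ltW.
have gam_taylor x : exists2 D : 'M[R]_(n, d), P1 *m D = 1%:M &
    forall y : 'cV[R]_d, `|gam y - gam x - D *m (y - x)| <= t2 * M * `|y - x| `^ (1 + al).
  have [L HL] := h_taylor x; exists (T1 + T2 *m L).
    by rewrite mulmxDr P1T1 mulmxA P1T2 mul0mx addr0.
  move=> y; have -> : gam y - gam x - (T1 + T2 *m L) *m (y - x) =
      T2 *m (h y - h x - L *m (y - x)).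
    rewrite !gamE mulmxDl -mulmxA opprD addrACA -!mulmxBr [in LHS]opprD addrACA.
    by rewrite subrr add0r -mulmxBr.
  by apply: le_trans (Ht2 _) _; rewrite -mulrA ler_pM2l.
have r_taylor x : exists D : 'M[R]_d, forall y : 'cV[R]_d,
    `|r y - r x - D *m (y - x)| <=
      p1 * K * (G `^ (1 + al) + t2 * M) * `|y - x| `^ (1 + al).
  have [D _ HD] := gam_taylor x; have [J [J1 HJ]] := eta_taylor (gam x).
  exists (B + P1 *m (J *m D)) => y.
  have -> : r y - r x - (B + P1 *m (J *m D)) *m (y - x) =
      P1 *m ((eta (gam y) - eta (gam x) - J *m (gam y - gam x)) +
             J *m (gam y - gam x - D *m (y - x))).
    rewrite [J *m (_ - D *m _)]mulmxBr addrA subrK.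
    rewrite !rE mulmxDl opprD addrACA -!mulmxBr [in LHS]opprD addrACA subrr add0r.
    by rewrite -!mulmxA -mulmxBr.
  apply: le_trans (Hp1 _) _; rewrite -!mulrA ler_pM2l //.
  apply: le_trans (ler_normD _ _) _; rewrite mulrDl mulrDr; apply: lerD.
    apply: le_trans (HJ _) _; rewrite ler_wpM2l // -powRM ?(ltW G0) //.
    by apply: ge0_ler_powR; rewrite ?nnegrE // mulr_ge0 // ltW.
  by apply: le_trans (J1 _) _; rewrite ler_wpM2l.
have r_lip (x y : 'cV[R]_d) : `|r y - r x| <= (b + p1 * K * G) * `|y - x|.
  rewrite !rE opprD addrACA -!mulmxBr (le_trans (ler_normD _ _)) // mulrDl lerD //.
  apply: le_trans (Hp1 _) _; rewrite -!mulrA ler_pM2l //.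
  by apply: le_trans (eta_lip _ _) _; rewrite ler_wpM2l.
have jac_gam0 : jac gam 0 = T1.
  apply: diff_mulmx_jac; apply: (proj2 (@taylor_diff _ _ _ gam 0 T1 (t2 * M) al al0 _)).
  move=> y; rewrite gam0 !subr0 gamE addrAC subrr add0r.
  by apply: le_trans (Ht2 _) _; rewrite -mulrA ler_pM2l.
have jac_r0 : jac r 0 = B.
  apply: diff_mulmx_jac.
  (* The general expansion does not name the derivative; at 0 the quadratic bound on [eta]
     identifies it, with exponent [al = 1]. *)
  apply: (proj2 (@taylor_diff _ _ _ r 0 B (p1 * K * G ^+ 2) 1 ltr01 _)).
  move=> y; rewrite !rE gam0 eta0 !mulmx0 addr0 !subr0 addrAC subrr add0r.
  rewrite -(natrD _ 1 1) powR_mulrn //.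
  apply: le_trans (Hp1 _) _; rewrite -!mulrA ler_pM2l //.
  apply: le_trans (eta_flat _) _; rewrite ler_wpM2l //.
  rewrite [leRHS](_ : _ = (G * `|y|) ^+ 2); last by ring.
  by rewrite ler_sqr ?nnegrE // mulr_ge0 // ltW.
have O0 : O 0 by rewrite /O /= mulmx0 (equiv_norm0 hNA).
have Oopen : open O by exact: norm_sublevel_open hNA.
pose W := gam @` O.
have W0 : W 0 by exists 0.
exists W, O, gam, r; split => //; split.
- split => //.
  + apply: (@taylor_Ck1 _ _ _ gam (t2 * M) al) => //; first by rewrite mulr_ge0 // ltW.
    by move=> x; have [D _ HD] := gam_taylor x; exists D.
  + by move=> u _; have [D PD HD] := gam_taylor u; exact: taylor_rank HD PD.
  + exists (mulmx P1); split.
      by apply: continuous_subspaceT; exact: mulmx_continuous.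
    by move=> u _; rewrite gamE mulmxDr !mulmxA P1T1 P1T2 mul1mx mul0mx addr0.
- by rewrite jac_gam0.
- by move=> _ [u Ou <-]; exists (r u); [exact: Or|rewrite fgam].
- exists [set x | NA x < rho1], ((n * 1)%:R * rho1), q'; split.
  + have : \forall x \near (0 : 'cV[R]_n), NA x < rho1.
      apply: (@near0_norm _ _ _ (rho1 / cA)); first by rewrite divr_gt0.
      by move=> x; rewrite ltr_pdivlMr // mulrC; exact: le_lt_trans (HcA x).
    by [].
  + by rewrite q'0.
  + move=> x Ux i; exists 0 => //; rewrite subr0.
    have fx y : NA y < rho1 -> NA (f y) <= q' * NA y.
      move=> Uy; rewrite hf -eta_id; last first.
        by apply: le_trans (equiv_norm_ge hNA y) (le_trans (ltW Uy) rho1_rho).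
      apply: le_trans (equiv_normD hNA _ _) _.
      apply: (@le_trans _ _ (q * NA y + NA (eta y))); first by rewrite lerD2r.
      apply: shrink => //; apply: le_trans (HcA _) _.
      apply: (@le_trans _ _ (cA * K * NA y ^+ 2)).
        rewrite -mulrA ler_pM2l //; apply: le_trans (eta_flat _) _.
        by rewrite ler_wpM2l // ler_sqr ?nnegrE // (equiv_norm_ge hNA).
      rewrite ler_wpM2r ?sqr_ge0 // lerDr.
      exact: cc0.
    have it : NA (iter i f x) <= q' ^+ i * NA x.
      elim: i => [|i IH]; first by rewrite expr0 mul1r.
      rewrite iterS exprS -mulrA; apply: le_trans (fx _ _) _.
        apply: le_lt_trans IH (le_lt_trans _ Ux).
        by rewrite ler_piMl // exprn_ile1 // ltW.
      by rewrite ler_pM2l.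
    apply: le_trans (fnorm_le_norm _) _; rewrite -mulrA ler_wpM2l //.
    apply: le_trans (equiv_norm_ge hNA _) (le_trans it _).
    by rewrite mulrC ler_wpM2r ?exprn_ge0 ?(ltW q'0) // ltW.
- by move=> u Ou; split; [exact: Or|exact: fgam].
- apply: (@taylor_Ck1 _ _ _ r (p1 * K * (G `^ (1 + al) + t2 * M)) al) => //.
  by rewrite !mulr_ge0 ?addr_ge0 ?powR_ge0 ?mulr_ge0 ?(ltW p10) ?(ltW t20).
- exact: lipschitz_holder_near gam_lip.
- exact: lipschitz_holder_near r_lip.
Qed.

End SSM.

(** * Dynamic mode decomposition *)

Section Frobenius.
Context {R : realType}.

(** The sum of the squares [(B a i - C b i) ^+ 2] equals [B (A B - C ^+ 2)]; if [B = 0], every [b i]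
    vanishes. *)
Lemma cauchy_schwarz_sum (I : finType) (a b : I -> R) :
  (\sum_i a i * b i) ^+ 2 <= (\sum_i a i ^+ 2) * (\sum_i b i ^+ 2).
Proof.
set A := \sum_i a i ^+ 2; set B := \sum_i b i ^+ 2; set C := \sum_i a i * b i.
have B0 : 0 <= B by rewrite sumr_ge0 // => i _; rewrite sqr_ge0.
have : 0 <= \sum_i (B * a i - C * b i) ^+ 2.
  by rewrite sumr_ge0 // => i _; rewrite sqr_ge0.
have -> : \sum_i (B * a i - C * b i) ^+ 2 = B * (A * B - C ^+ 2).
  transitivity (\sum_i (B ^+ 2 * a i ^+ 2 + (- 2 * B * C) * (a i * b i) +
                        C ^+ 2 * b i ^+ 2)).
    by apply: eq_bigr => i _; ring.
  by rewrite !big_split -!mulr_sumr -/A -/B -/C /=; ring.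
have [B00 _|Bn0] := eqVneq B 0; last first.
  by rewrite pmulr_rge0 ?subr_ge0 // lt_neqAle eq_sym Bn0.
have b0 i : b i = 0.
  apply/eqP; rewrite -sqrf_eq0; move: B00 => /eqP.
  rewrite psumr_eq0 => [/allP/(_ i)|j _]; last exact: sqr_ge0.
  by rewrite mem_index_enum => /(_ isT).
rewrite /C big1 ?expr0n /= ?mulr_ge0 // => [|i _]; last by rewrite b0 mulr0.
by rewrite sumr_ge0 // => i _; rewrite sqr_ge0.
Qed.

Lemma fnorm_ge0 m n (M : 'M[R]_(m, n)) : 0 <= fnorm M.
Proof. exact: sqrtr_ge0. Qed.

Lemma sqr_fnorm m n (M : 'M[R]_(m, n)) : fnorm M ^+ 2 = \sum_i \sum_j M i j ^+ 2.
Proof.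
by rewrite sqr_sqrtr // sumr_ge0 // => i _; rewrite sumr_ge0 // => j _; rewrite sqr_ge0.
Qed.

Lemma fnorm_le m n (M : 'M[R]_(m, n)) c :
  0 <= c -> \sum_i \sum_j M i j ^+ 2 <= c ^+ 2 -> fnorm M <= c.
Proof. by move=> c0; rewrite -sqr_fnorm ler_sqr ?nnegrE // fnorm_ge0. Qed.

Lemma fnormM m n p (M : 'M[R]_(m, n)) (B : 'M[R]_(n, p)) :
  fnorm (M *m B) <= fnorm M * fnorm B.
Proof.
apply: fnorm_le; first by rewrite mulr_ge0 ?fnorm_ge0.
rewrite exprMn !sqr_fnorm mulr_suml ler_sum // => i _.
rewrite [X in _ <= _ * X]exchange_big mulr_sumr ler_sum // => j _.
rewrite mxE; exact: cauchy_schwarz_sum.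
Qed.

Lemma fnormD m n (M B : 'M[R]_(m, n)) : fnorm (M + B) <= fnorm M + fnorm B.
Proof.
apply: fnorm_le; first by rewrite addr_ge0 ?fnorm_ge0.
have CS : \sum_i \sum_j M i j * B i j <= fnorm M * fnorm B.
  have := cauchy_schwarz_sum (fun p : 'I_m * 'I_n => M p.1 p.2) (fun p => B p.1 p.2).
  rewrite -!(pair_bigA _ (fun i j => M i j * B i j)) /=.
  rewrite -!(pair_bigA _ (fun i j => M i j ^+ 2)) -!(pair_bigA _ (fun i j => B i j ^+ 2)) /=.
  rewrite -!sqr_fnorm -exprMn => h; apply: le_trans (ler_norm _) _.
  by rewrite -ler_sqr ?nnegrE ?mulr_ge0 ?fnorm_ge0 // real_normK ?num_real.
have -> : \sum_i \sum_j (M + B) i j ^+ 2 =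
    fnorm M ^+ 2 + 2 * (\sum_i \sum_j M i j * B i j) + fnorm B ^+ 2.
  rewrite !sqr_fnorm mulr_sumr -!big_split; apply: eq_bigr => i _ /=.
  rewrite mulr_sumr -!big_split; apply: eq_bigr => j _ /=.
  by rewrite mxE; ring.
by rewrite sqrrD mulr2n; lra.
Qed.

Lemma fnormN m n (M : 'M[R]_(m, n)) : fnorm (- M) = fnorm M.
Proof.
rewrite /fnorm; congr Num.sqrt; apply: eq_bigr => i _; apply: eq_bigr => j _.
by rewrite mxE sqrrN.
Qed.

Lemma fnormB m n (M B : 'M[R]_(m, n)) : fnorm (M - B) <= fnorm M + fnorm B.
Proof. by rewrite -(fnormN B) fnormD. Qed.

Lemma norm_le_fnorm m n (M : 'M[R]_(m, n)) : `|M| <= fnorm M.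
Proof.
apply: mx_norm_le => [|i j]; first exact: fnorm_ge0.
rewrite -ler_sqr ?nnegrE ?fnorm_ge0 // real_normK ?num_real // sqr_fnorm.
rewrite (bigD1 i) //= (bigD1 j) //= -addrA lerDl addr_ge0 //.
  by rewrite sumr_ge0 // => k _; rewrite sqr_ge0.
by rewrite sumr_ge0 // => k _; rewrite sumr_ge0 // => l _; rewrite sqr_ge0.
Qed.

(** The squared column norms add up to [fnorm X ^+ 2], so the constant does not depend on the number
    [m] of data points. *)
Lemma colwise_quadratic n d m (g : 'cV[R]_n -> 'cV[R]_d) (r K : R) (X : 'M[R]_(n, m)) :
  0 <= K -> (forall x : 'cV[R]_n, `|x| < r -> `|g x| <= K * `|x| ^+ 2) ->
  fnorm X < r -> fnorm (colwise g X) <= d%:R * K * fnorm X ^+ 2.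
Proof.
move=> K0 Hg Xr.
pose s j := \sum_i X i j ^+ 2.
have s0 j : 0 <= s j by rewrite sumr_ge0 // => i _; rewrite sqr_ge0.
have sE : fnorm X ^+ 2 = \sum_j s j by rewrite sqr_fnorm exchange_big.
have colX j : `|col j X| ^+ 2 <= s j.
  have -> : s j = fnorm (col j X) ^+ 2.
    by rewrite sqr_fnorm; apply: eq_bigr => i _; rewrite big_ord1 mxE.
  by rewrite ler_sqr ?nnegrE ?fnorm_ge0 // norm_le_fnorm.
have gj i j : `|g (col j X) i 0| <= K * s j.
  apply: le_trans (mx_norm_ge _ i 0) (le_trans (Hg _ _) _); last by rewrite ler_wpM2l.
  apply: le_lt_trans Xr; apply: le_trans (norm_le_fnorm X).
  by apply: mx_norm_le => // a b; rewrite mxE mx_norm_ge.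
apply: fnorm_le; first by rewrite mulr_ge0 ?sqr_ge0 // mulr_ge0.
apply: (@le_trans _ _ (\sum_(i < d) (K * \sum_j s j) ^+ 2)).
  apply: ler_sum => i _; apply: (@le_trans _ _ (\sum_j (K * s j) * (K * \sum_j s j))).
    apply: ler_sum => j _; rewrite mxE -real_normK ?num_real // expr2.
    apply: ler_pM => //; apply: le_trans (gj i j) _; rewrite ler_wpM2l //.
    by rewrite (bigD1 j) //= lerDl sumr_ge0.
  by rewrite -mulr_suml -mulr_sumr expr2.
rewrite sumr_const card_ord -sE -mulrA [leRHS]exprMn -[leLHS]mulr_natl.
rewrite ler_wpM2r ?sqr_ge0 // expr2 -natrM ler_nat.
by case: d {g Hg gj} => // p; rewrite leq_pmull.
Qed.

Lemma moore_penrose_unique m n (M : 'M[R]_(m, n)) (G1 G2 : 'M[R]_(n, m)) :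
  moore_penrose M G1 -> moore_penrose M G2 -> G1 = G2.
Proof.
move=> [a1 b1 c1 d1] [a2 b2 c2 d2].
have MG : M *m G1 = M *m G2.
  rewrite -[LHS]c1 -{1}a2 -[M *m G2 *m M *m G1]mulmxA trmx_mul c1 c2.
  by rewrite mulmxA a1.
have GM : G1 *m M = G2 *m M.
  rewrite -[LHS]d1 -{1}a2 mulmxA [G1 *m _]mulmxA -mulmxA trmx_mul d1 d2.
  by rewrite -mulmxA (mulmxA M) a1.
by rewrite -b1 GM -mulmxA MG mulmxA.
Qed.

(* [Defs.pinv], since the bare name [pinv] denotes the partial inverse of a function
   in mathcomp-classical. *)
Lemma pinvE m n (M : 'M[R]_(m, n)) (G : 'M[R]_(n, m)) :
  moore_penrose M G -> Defs.pinv M = G.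
Proof.
move=> MG; have : moore_penrose M (Defs.pinv M).
  by apply: (@xgetPex _ 0 [set H | moore_penrose M H]); exists G.
by move=> h; exact: moore_penrose_unique h MG.
Qed.

(** A left null vector [y] of the Gram matrix satisfies [|y Phi|^2 = 0]. *)
Lemma gram_unit d m (Phi : 'M[R]_(d, m)) :
  \rank Phi = d -> Phi *m Phi^T \in unitmx.
Proof.
move=> rk; rewrite -row_free_unit; apply: inj_row_free => y yPP.
have Pf : row_free Phi by rewrite /row_free rk.
apply: (row_free_eq0 Pf); apply/eqP; rewrite -normr_le0.
apply: le_trans (norm_le_fnorm _) _; apply: fnorm_le => //.
have -> : \sum_i \sum_j (y *m Phi) i j ^+ 2 = (y *m (Phi *m Phi^T) *m y^T) 0 0.
  rewrite big_ord1 mulmxA -mulmxA -trmx_mul mxE; apply: eq_bigr => j _.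
  by rewrite expr2 [(y *m Phi)^T j 0]mxE.
by rewrite yPP mul0mx mxE expr0n.
Qed.

(** At full row rank the Gram matrix [G] is invertible and the pseudo-inverse of [Phi] is
    [Phi^T G^-1], so the DMD formula reduces to multiplication by a right inverse of [Phi]. *)
Lemma dmd_pinv d m (Phi Phihat : 'M[R]_(d, m)) :
  \rank Phi = d -> Phi *m Defs.pinv Phi = 1%:M /\ dmd Phi Phihat = Phihat *m Defs.pinv Phi.
Proof.
move=> /gram_unit Gu; set Gm := Phi *m Phi^T in Gu *.
have GmT : Gm^T = Gm by rewrite /Gm trmx_mul trmxK.
have pG : Defs.pinv Gm = invmx Gm.
  apply: pinvE; split; rewrite ?mulmxV ?mulVmx ?mul1mx ?trmx1 //.
have PG : Phi *m (Phi^T *m invmx Gm) = 1%:M by rewrite mulmxA mulmxV.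
have pP : Defs.pinv Phi = Phi^T *m invmx Gm.
  apply: pinvE; split.
  - by rewrite PG mul1mx.
  - by rewrite -mulmxA PG mulmx1.
  - by rewrite PG trmx1.
  - by rewrite !trmx_mul trmxK trmx_inv GmT mulmxA.
by split; rewrite ?pP // /dmd -/Gm pG mulmxA.
Qed.

End Frobenius.

Section DMD.
Context {R : realType}.

Lemma C2_quadratic n d (g : 'cV[R]_n -> 'cV[R]_d) :
  Ck_near 2 (0 : 'cV[R]_n) g -> g 0 = 0 ->
  exists r K : R, [/\ 0 < r, 0 < K &
    forall x : 'cV[R]_n, `|x| < r -> `|g x - jac g 0 *m x| <= K * `|x| ^+ 2].
Proof.
move=> /C2_taylor_jac[J [r [K [r0 K0 JE H]]]] g0; exists r, K; split => // x xr.
have n0r : `|0 : 'cV[R]_n| < r by rewrite normr0.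
have [_ _] := H 0 x n0r xr; rewrite g0 !subr0.
suff -> : jac g 0 = J 0 by [].
apply/matrixP => i j.
have := jacE g 0 (delta_mx j 0); rewrite -JE => /matrixP/(_ i 0).
by rewrite -!colE !mxE.
Qed.

Lemma colwise_expand n d m (g : 'cV[R]_n -> 'cV[R]_d) (L : 'M[R]_(d, n)) (X : 'M[R]_(n, m)) :
  colwise g X = L *m X + colwise (fun x => g x - L *m x) X.
Proof.
apply/matrixP => i j; rewrite [RHS]mxE !mxE.
have -> : \sum_k L i k * col j X k 0 = \sum_k L i k * X k j.
  by apply: eq_bigr => k _; rewrite mxE.
by rewrite addrC subrK.
Qed.

Lemma dmd_error (n d k : nat) (A : 'M[R]_n) (f ft : 'cV[R]_n -> 'cV[R]_n)
    (phi : 'cV[R]_n -> 'cV[R]_d)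
    (PE P1 : 'M[R]_(d, n)) (PF : 'M[R]_(k, n)) (TE : 'M[R]_(n, d)) (T2 : 'M[R]_(n, k))
    (H : 'M[R]_d) (LE : 'M[R]_d) (beta : R) :
  (forall x, f x = A *m x + ft x) ->
  ft =o_ (0 : 'cV[R]_n) id -> Ck_near 2 (0 : 'cV[R]_n) ft ->
  Ck_near 2 (0 : 'cV[R]_n) phi -> phi 0 = 0 ->
  PE = H *m P1 -> H \in unitmx -> TE *m P1 + T2 *m PF = 1%:M ->
  A *m TE = TE *m LE -> jac phi 0 *m TE \in unitmx -> 0 < beta < 1 ->
  let S := jac phi 0 *m TE in
  let D0 := S *m LE *m invmx S in
  exists C delta : R, [/\ 0 < C, 0 < delta &
    forall (m : nat) (X : 'M[R]_(n, m)),
      \rank (colwise phi X) = d ->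
      fnorm (PF *m X) <= fnorm (PE *m X) `^ (1 + beta) ->
      fnorm (PE *m X) < delta ->
      fnorm (dmd (colwise phi X) (colwise phi (colwise f X)) - D0)
        <= C * cond_number (colwise phi X) * fnorm (PE *m X) `^ beta].
Proof.
move=> hf oft C2ft C2phi phi0 PEE Hu decomp hLE Su /andP[be0 be1].
set S := jac phi 0 *m TE in Su *; set D0 := S *m LE *m invmx S => /=.
have [ft0 dft0 dft0E] := littleo_id_diff0 oft.
have [rf [Kf [rf0 Kf0 Hft]]] := C2_quadratic C2ft ft0.
have jft0 : jac ft 0 = 0.
  by apply/matrixP => i j; rewrite mxE dft0E !mxE.
have {}Hft (x : 'cV[R]_n) : `|x| < rf -> `|ft x| <= Kf * `|x| ^+ 2.
  by move=> /Hft; rewrite jft0 mul0mx subr0.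
have [rp [Kp [rp0 Kp0 Hphi]]] := C2_quadratic C2phi phi0.
set J := jac phi 0 in S Su D0 Hphi *.
have [a a0 Ha] := mulmx_bound A; have [j j0 Hj] := mulmx_bound J.
pose q := a + Kf; have q0 : 0 < q by rewrite addr_gt0.
(* Within [rf] the bound on [ft] holds, within 1 squares are below first powers, and [rp / q] sends
   [f x] into the domain of the bound on [phi]. *)
pose r := Num.min (Num.min rf 1) (rp / q).
have r0 : 0 < r by rewrite !lt_min rf0 ltr01 divr_gt0.
have f_le (x : 'cV[R]_n) : `|x| < r -> `|f x| <= q * `|x|.
  rewrite !lt_min => /andP[/andP[xf x1] _].
  rewrite hf (le_trans (ler_normD _ _)) // mulrDl lerD //.
  by apply: le_trans (Hft _ xf) _; rewrite ler_pM2l // expr2 ler_piMl // ltW.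
pose K2 := Kp * q ^+ 2 + j * Kf.
have K20 : 0 < K2 by rewrite addr_gt0 // !mulr_gt0.
have phif (x : 'cV[R]_n) : `|x| < r -> `|phi (f x) - (J *m A) *m x| <= K2 * `|x| ^+ 2.
  move=> xr; have := f_le x xr; move: xr; rewrite !lt_min => /andP[/andP[xf x1] xq] fx.
  have fr : `|f x| < rp.
    by apply: le_lt_trans fx _; rewrite mulrC -ltr_pdivlMr.
  have -> : phi (f x) - (J *m A) *m x = (phi (f x) - J *m f x) + J *m ft x.
    by rewrite hf mulmxDr opprD addrA subrK mulmxA.
  apply: le_trans (ler_normD _ _) _; rewrite mulrDl; apply: lerD.
    apply: le_trans (Hphi _ fr) _; rewrite -mulrA ler_pM2l // -exprMn.
    by rewrite ler_sqr ?nnegrE // mulr_ge0 // ltW.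
  apply: le_trans (Hj _) _; rewrite -mulrA ler_pM2l //; exact: Hft.
pose r' := Num.min r rp; have r'0 : 0 < r' by rewrite lt_min r0.
pose cU := fnorm (invmx H); pose cX := fnorm TE * cU + fnorm T2 + 1.
have cX0 : 0 < cX by rewrite ltr_wpDl // addr_ge0 ?mulr_ge0 ?fnorm_ge0.
(* The three terms are the fast linear part, the nonlinear part of [Phihat], and [D0] applied to
   that of [Phi]. *)
pose cE := fnorm ((J *m A - D0 *m J) *m T2) + d%:R * K2 * cX ^+ 2 +
  fnorm D0 * (d%:R * Kp * cX ^+ 2).
have cE0 : 0 <= cE by rewrite !addr_ge0 ?mulr_ge0 ?fnorm_ge0 ?sqr_ge0 // ltW.
(* [H S^-1] recovers [PE X = H U] from the slow linear part [S U] of the data; [c3] measures what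
   else [Phi] contains. *)
pose cS := fnorm (H *m invmx S).
pose c3 := cS * (fnorm (J *m T2) + d%:R * Kp * cX ^+ 2).
have c30 : 0 <= c3 by rewrite mulr_ge0 ?addr_ge0 ?mulr_ge0 ?fnorm_ge0 ?sqr_ge0 // ltW.
(* The entries give [p <= 1], columns of [X] inside the Taylor domain, and
   [(2 c3 + 1) p ^ beta <= 1]; the last makes the remainder [c3 p ^ (1 + beta)] at most [p / 2]. *)
pose delta := Num.min (Num.min 1 (r' / cX)) ((2 * c3 + 1)^-1 `^ beta^-1).
have c31 : 0 < 2 * c3 + 1 by rewrite ltr_wpDl // mulr_ge0.
exists (2 * cE * cS + 1), delta; split.
- by rewrite ltr_wpDl // !mulr_ge0 ?fnorm_ge0.
- by rewrite !lt_min ltr01 divr_gt0 // powR_gt0 // invr_gt0.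
move=> m X rk hF; set p := fnorm (PE *m X) in hF *.
rewrite !lt_min => /andP[/andP[p1 pr] pc].
have p0 : 0 <= p by exact: fnorm_ge0.
have pb : p `^ (1 + beta) = p * p `^ beta.
  (* The law of exponents needs a nonzero base; at 0 both sides vanish. *)
  have [->|pn0] := eqVneq p 0; first by rewrite mul0r powR0 // gt_eqF // addr_gt0.
  by rewrite powRD ?powRr1 //; apply/implyP => _.
have pp : p ^+ 2 <= p `^ (1 + beta).
  rewrite pb expr2 ler_wpM2l //.
  have [->|pn0] := eqVneq p 0; first exact: powR_ge0.
  by apply: ger1_powR; rewrite ?(ltW be1) // lt_neqAle eq_sym pn0 p0 ltW.
have p1b : p `^ (1 + beta) <= p.
  rewrite pb ler_piMr //.
  have : p `^ beta <= 1 `^ beta.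
    by apply: ge0_ler_powR; rewrite ?nnegrE // ltW.
  by rewrite powR1.
pose U := P1 *m X; pose V := PF *m X.
have XE : X = TE *m U + T2 *m V by rewrite !mulmxA -mulmxDl decomp mul1mx.
have PEX : PE *m X = H *m U by rewrite PEE mulmxA.
have U_le : fnorm U <= cU * p.
  have -> : U = invmx H *m (PE *m X) by rewrite PEX mulmxA mulVmx // mul1mx.
  exact: fnormM.
have X_le : fnorm X <= cX * p.
  rewrite XE; apply: le_trans (fnormD _ _) _; rewrite /cX !mulrDl mul1r ler_wpDr // lerD //.
    by apply: le_trans (fnormM _ _) _; rewrite -mulrA ler_wpM2l ?fnorm_ge0.
  apply: le_trans (fnormM _ _) _; rewrite ler_wpM2l ?fnorm_ge0 //.
  exact: le_trans hF p1b.
have Xr : fnorm X < r' by apply: le_lt_trans X_le _; rewrite mulrC -ltr_pdivlMr.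
have X2 : fnorm X ^+ 2 <= cX ^+ 2 * p `^ (1 + beta).
  apply: (@le_trans _ _ ((cX * p) ^+ 2)).
    by rewrite ler_sqr ?nnegrE ?fnorm_ge0 // mulr_ge0 // ltW.
  by rewrite exprMn ler_wpM2l // sqr_ge0.
pose Phi := colwise phi X; pose Phihat := colwise phi (colwise f X).
have PhihatE : Phihat = colwise (phi \o f) X.
  apply/matrixP => s t; rewrite !mxE /=; congr (phi _ s 0).
  by apply/matrixP => u v; rewrite !mxE ord1.
pose Q1 := colwise (fun x => phi x - J *m x) X.
pose Q2 := colwise (fun x => (phi \o f) x - (J *m A) *m x) X.
have P1E : Phi = J *m X + Q1 by exact: colwise_expand.
have P2E : Phihat = J *m A *m X + Q2 by rewrite PhihatE; exact: colwise_expand.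
have quad (g : 'cV[R]_n -> 'cV[R]_d) K : 0 <= K ->
    (forall x : 'cV[R]_n, `|x| < r' -> `|g x| <= K * `|x| ^+ 2) ->
    fnorm (colwise g X) <= d%:R * K * cX ^+ 2 * p `^ (1 + beta).
  move=> Kge0 Hg; apply: le_trans (colwise_quadratic Kge0 Hg Xr) _.
  by rewrite -[leRHS]mulrA ler_wpM2l // mulr_ge0.
have Q1_le : fnorm Q1 <= d%:R * Kp * cX ^+ 2 * p `^ (1 + beta).
  apply: quad; first exact: ltW.
  by move=> x; rewrite lt_min => /andP[_ xr]; exact: Hphi.
have Q2_le : fnorm Q2 <= d%:R * K2 * cX ^+ 2 * p `^ (1 + beta).
  apply: quad; first exact: ltW.
  by move=> x; rewrite lt_min => /andP[xr _]; exact: phif.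
have slow : J *m A *m (TE *m U) = D0 *m J *m (TE *m U).
  have JA : J *m A *m TE = S *m LE by rewrite -mulmxA hLE mulmxA.
  have DS : D0 *m J *m TE = S *m LE by rewrite -mulmxA -/S /D0 mulmxKV.
  by rewrite !mulmxA JA DS.
have lin : J *m A *m X - D0 *m (J *m X) = (J *m A - D0 *m J) *m T2 *m V.
  rewrite (mulmxA D0 J) -mulmxBl XE mulmxDr [_ *m (TE *m U)]mulmxBl slow subrr add0r.
  by rewrite mulmxA.
have err_le : fnorm (Phihat - D0 *m Phi) <= cE * p `^ (1 + beta).
  have -> : Phihat - D0 *m Phi = (J *m A - D0 *m J) *m T2 *m V + Q2 - D0 *m Q1.
    by rewrite P2E P1E mulmxDr opprD addrACA lin addrA.
  apply: le_trans (fnormB _ _) _; rewrite /cE !mulrDl; apply: lerD.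
    apply: le_trans (fnormD _ _) _; apply: lerD => //.
    by apply: le_trans (fnormM _ _) _; rewrite ler_wpM2l ?fnorm_ge0.
  by apply: le_trans (fnormM _ _) _; rewrite -mulrA ler_wpM2l ?fnorm_ge0.
have p_le : p <= 2 * cS * fnorm Phi.
  have h : p <= cS * fnorm Phi + c3 * p `^ (1 + beta).
    have SU : S *m U = Phi - (J *m T2) *m V - Q1.
      by rewrite P1E {1}XE mulmxDr !mulmxA addrAC addrK addrK.
    rewrite {1}/p PEX.
    have -> : H *m U = H *m invmx S *m (S *m U) by rewrite -mulmxA mulKmx.
    apply: le_trans (fnormM _ _) _; rewrite -/cS /c3 -mulrA -mulrDr.
    rewrite ler_wpM2l ?fnorm_ge0 // SU mulrDl addrA.
    apply: le_trans (fnormB _ _) _; apply: lerD => //.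
    apply: le_trans (fnormB _ _) _; apply: lerD => //.
    by apply: le_trans (fnormM _ _) _; rewrite ler_wpM2l ?fnorm_ge0.
  have hb : (2 * c3 + 1) * p `^ beta <= 1.
    rewrite mulrC -ler_pdivlMr // mul1r.
    have -> : (2 * c3 + 1)^-1 = ((2 * c3 + 1)^-1 `^ beta^-1) `^ beta.
      by rewrite -powRrM mulVf ?gt_eqF // powRr1 // invr_ge0 ltW.
    by apply: ge0_ler_powR; rewrite ?nnegrE ?powR_ge0 // ltW.
  have hc : 2 * (c3 * p `^ (1 + beta)) <= p.
    rewrite pb; have -> : 2 * (c3 * (p * p `^ beta)) = (2 * c3 * p `^ beta) * p by ring.
    rewrite ler_piMl //; apply: le_trans hb.
    by rewrite [leRHS]mulrDl lerDl mul1r powR_ge0.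
  have half (x y z : R) : x <= y + z -> 2 * z <= x -> x <= 2 * y by clear; lra.
  by rewrite -mulrA; exact: half h hc.
have [PP ->] := dmd_pinv (colwise phi (colwise f X)) rk.
rewrite -/Phi -/Phihat -/p in PP *.
have -> : Phihat *m Defs.pinv Phi - D0 = (Phihat - D0 *m Phi) *m Defs.pinv Phi.
  by rewrite mulmxBl -mulmxA PP mulmx1.
apply: le_trans (fnormM _ _) _.
apply: (@le_trans _ _ (2 * cE * cS * fnorm Phi * p `^ beta * fnorm (Defs.pinv Phi))).
  rewrite ler_wpM2r ?fnorm_ge0 //; apply: le_trans err_le _; rewrite pb.
  have -> : 2 * cE * cS * fnorm Phi * p `^ beta = cE * ((2 * cS * fnorm Phi) * p `^ beta).
    by ring.
  by rewrite ler_wpM2l // ler_wpM2r // powR_ge0.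
rewrite /cond_number [leLHS](_ : _ =
  2 * cE * cS * (fnorm Phi * fnorm (Defs.pinv Phi)) * p `^ beta); last by ring.
rewrite ler_wpM2r ?powR_ge0 // ler_wpM2r ?mulr_ge0 ?fnorm_ge0 //.
by rewrite lerDl.
Qed.

End DMD.

(** * Adapted norms for the slow, fast and full blocks, and the assembly *)

Section Assembly.
Context {R : realType}.
Local Notation CR := R[i].

Lemma normc_real (z : CR) : exists2 m : R, 0 <= m & `|z| = m%:C%C.
Proof.
by exists (Num.sqrt (complex.Re z ^+ 2 + complex.Im z ^+ 2)); rewrite ?sqrtr_ge0 ?normc_def.
Qed.

Lemma cplx_unitmx n (M : 'M[R]_n) : (cplx M \in unitmx) = (M \in unitmx).
Proof. exact: map_unitmx. Qed.

Lemma intertwined_gen_eigenvector m n (P : 'M[R]_(m, n)) (A : 'M[R]_n) (L : 'M[R]_m)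
    (a : CR) k (v : 'cV[CR]_n) :
  P *m A = L *m P -> (cplx A - a%:M) ^+ k *m v = 0 ->
  (cplx L - a%:M) ^+ k *m (cplx P *m v) = 0.
Proof.
move=> PA Hv; rewrite mulmxA -(@shift_exp_intertwine R m n (cplx P) (cplx A)).
  by rewrite -mulmxA Hv mulmx0.
by rewrite -!cplxM PA.
Qed.

(** The lower bound for [L1] is an upper bound for its inverse in a norm adapted to that inverse.
    Generalized eigenvectors of a block are the projections of those of [A]; the projections from
    the other side vanish. *)
Lemma slow_fast_norms (n d k : nat) (A : 'M[R]_n) (lam : 'I_n -> CR) (e : 'M[CR]_n)
    (P1 : 'M[R]_(d, n)) (P2 : 'M[R]_(k, n)) (T1 : 'M[R]_(n, d)) (T2 : 'M[R]_(n, k))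
    (L1 : 'M[R]_d) (L2 : 'M[R]_k) :
  (0 < d < n)%N -> gen_eigenbasis A lam e ->
  P1 *m T1 = 1%:M -> P2 *m T2 = 1%:M ->
  P1 *m A = L1 *m P1 -> P2 *m A = L2 *m P2 ->
  (forall j : 'I_n, (d <= j)%N -> cplx P1 *m col j e = 0) ->
  (forall j : 'I_n, (j < d)%N -> cplx P2 *m col j e = 0) ->
  (forall i j : 'I_n, (i <= j)%N -> `|lam j| <= `|lam i|) ->
  (forall i j : 'I_n, (i < d <= j)%N -> `|lam j| < `|lam i|) ->
  (forall i, `|lam i| < 1) ->
  exists (N1 : 'cV[R]_d -> R) (C1 : R) (N2 : 'cV[R]_k -> R) (C2 a b : R),
  [/\ equiv_norm N1 C1 /\ equiv_norm N2 C2, L1 \in unitmx,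
    forall x, a * N1 x <= N1 (L1 *m x), forall v, N2 (L2 *m v) <= b * N2 v &
    [/\ 0 < b, b < a & a < 1]].
Proof.
move=> /andP[d0 dn] [_ e_unit He] P1T1 P2T2 P1A P2A P1e P2e hord hgap hstable.
have eig j : exists l, (cplx A - (lam j)%:M) ^+ l *m col j e = 0 by case: (He j).
have d1n : (d.-1 < n)%N by rewrite (leq_ltn_trans (leq_pred d)).
(* Indices start at 0: [i1] is the last slow eigenvalue and [i2] the first fast one. *)
pose i1 := Ordinal d1n; pose i2 := Ordinal dn.
have i1d : (i1 < d)%N by rewrite /= prednK.
have [m1 m10 E1] := normc_real (lam i1); have [m2 m20 E2] := normc_real (lam i2).
have m21 : m2 < m1 by rewrite -(@ltcR R) -E1 -E2 hgap // i1d /=.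
have m11 : m1 < 1 by rewrite -(@ltcR R) -E1.
have slow_gt (j : 'I_n) : (j < d)%N -> m1%:C%C <= `|lam j|.
  by move=> jd; rewrite -E1 hord // /= -ltnS prednK.
have fast_lt (j : 'I_n) : (d <= j)%N -> `|lam j| <= m2%:C%C.
  by move=> dj; rewrite -E2 hord.
(* [a] and [b] cut the gap between the two moduli into thirds; in particular [b > 0] even if every
   fast eigenvalue is 0. *)
pose a := (m2 + 2 * m1) / 3; pose b := (2 * m2 + m1) / 3.
have b0 : 0 < b by rewrite /b; lra.
have ba : b < a by rewrite /a /b; lra.
have am1 : a < m1 by rewrite /a; lra.
have m2b : m2 < b by rewrite /b; lra.
have a0 : 0 < a by exact: lt_trans ba.
have m1p : 0 < m1 by exact: lt_trans am1.
have zC : 0 = 0%:C%C :> CR by [].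
have lam0 (j : 'I_n) : (j < d)%N -> lam j != 0.
  move=> /slow_gt; apply: contraTneq => ->.
  by rewrite normr0 [X in _ <= X]zC lecR -ltNge.
pose W1 := cplx P1 *m e; pose V1 := invmx e *m cplx T1.
have WV1 : W1 *m V1 = 1%:M.
  by rewrite /W1 /V1 -mulmxA (mulmxA e) mulmxV // mul1mx -cplxM P1T1 [LHS]map_mx1.
pose W2 := cplx P2 *m e; pose V2 := invmx e *m cplx T2.
have WV2 : W2 *m V2 = 1%:M.
  by rewrite /W2 /V2 -mulmxA (mulmxA e) mulmxV // mul1mx -cplxM P2T2 [LHS]map_mx1.
have eig1 j : exists l, (cplx L1 - (lam j)%:M) ^+ l *m col j W1 = 0.
  have [l Hl] := eig j; exists l; rewrite /W1 -mulmx_col.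
  exact: intertwined_gen_eigenvector Hl.
have L1u : L1 \in unitmx.
  rewrite -cplx_unitmx; apply: (gen_eigenbasis_unit WV1) => j.
  have [jd|dj] := ltnP j d.
    by have [l Hl] := eig1 j; exists (lam j), l; rewrite lam0.
  (* The column is zero, so exponent 0 works with any nonzero value in place of the eigenvalue. *)
  by exists 1, 0; rewrite oner_neq0 /W1 -mulmx_col P1e // mulmx0.
have ai0 : 0 < a^-1 by rewrite invr_gt0.
have [|N1 [C1 [_ hN1 HN1]]] := @adapted_norm R d (invmx L1) a^-1 n W1 V1 ai0 WV1.
  move=> j; have [jd|dj] := ltnP j d.
    have [l Hl] := eig1 j; exists (lam j)^-1, l; split.
      have la : a%:C%C < `|lam j| by apply: lt_le_trans (slow_gt j jd); rewrite ltcR.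
      rewrite normfV fmorphV ltf_pV2 //; rewrite posrE ?normr_gt0 ?lam0 //.
      by rewrite ltcR.
    have -> : cplx (invmx L1) = invmx (cplx L1) by exact: map_invmx.
    by apply: gen_eigenvector_inv => //; rewrite ?cplx_unitmx ?lam0.
  exists 0, 0; rewrite normr0 [X in X < _]zC ltcR; split => //.
  by rewrite /W1 -mulmx_col P1e // mulmx0.
have [|N2 [C2 [_ hN2 HN2]]] := @adapted_norm R k L2 b n W2 V2 b0 WV2.
  move=> j; have [jd|dj] := ltnP j d.
    exists 0, 0; rewrite normr0 [X in X < _]zC ltcR; split => //.
    by rewrite /W2 -mulmx_col P2e // mulmx0.
  have [l Hl] := eig j; exists (lam j), l; split.
    by apply: le_lt_trans (fast_lt j dj) _; rewrite ltcR.
  by rewrite /W2 -mulmx_col; exact: intertwined_gen_eigenvector Hl.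
exists N1, C1, N2, C2, a, b; split=> //; last by split=> //; exact: lt_trans m11.
move=> x; rewrite -ler_pdivlMl //.
by have := HN1 (L1 *m x); rewrite mulKmx.
Qed.

Lemma stable_norm (n : nat) (A : 'M[R]_n) (lam : 'I_n -> CR) (e : 'M[CR]_n) :
  (0 < n)%N -> gen_eigenbasis A lam e ->
  (forall i j : 'I_n, (i <= j)%N -> `|lam j| <= `|lam i|) ->
  (forall i, `|lam i| < 1) ->
  exists (NA : 'cV[R]_n -> R) (CA q : R),
  [/\ equiv_norm NA CA, 0 < q < 1 & forall x, NA (A *m x) <= q * NA x].
Proof.
move=> n0 [_ e_unit He] hord hstable.
(* Index 0 carries the spectral radius, and [q] is the midpoint between it and 1. *)
have [m m0 Em] := normc_real (lam (Ordinal n0)).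
have m1 : m < 1 by rewrite -(@ltcR R) -Em.
pose q := (1 + m) / 2; have q0 : 0 < q by rewrite /q; lra.
have [|NA [CA [_ hNA HNA]]] := @adapted_norm R n A q n e (invmx e) q0 (mulmxV e_unit).
  move=> j; have [_ [l Hl]] := He j; exists (lam j), l; split => //.
  apply: (@le_lt_trans _ _ m%:C%C); first by rewrite -Em hord.
  by rewrite ltcR /q; lra.
by exists NA, CA, q; split => //; rewrite q0 /q /=; lra.
Qed.

(** With a fiber of dimension 0 any two fiber vectors are equal, so the zero graph is invariant. [k]
    is a variable with [k = 0] so that matrix types over [n - d] need no rewriting. *)
Lemma full_dimension_graph (n d k : nat) (P1 : 'M[R]_(d, n)) (P2 : 'M[R]_(k, n))
    (T1 : 'M[R]_(n, d)) (T2 : 'M[R]_(n, k)) (B : 'M[R]_d) (L2 : 'M[R]_k)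
    (ft : 'cV[R]_n -> 'cV[R]_n) :
  k = 0%N -> ft =o_ (0 : 'cV[R]_n) id -> Ck_near 2 (0 : 'cV[R]_n) ft ->
  exists (eta : 'cV[R]_n -> 'cV[R]_n) (h : 'cV[R]_d -> 'cV[R]_k) (rho K M al : R),
  [/\ [/\ 0 < rho, 0 <= K, 0 <= M & 0 < al < 1],
      small_C1_extension ft eta rho K al &
      invariant_C1_graph P1 P2 T1 T2 B L2 eta h M al].
Proof.
move=> k0 oft C2ft.
have flat (v w : 'cV[R]_k) : v = w.
  by apply/matrixP => i; have := ltn_ord i; rewrite [X in (_ < X)%N]k0.
have [eta [rho [K [[rho0 K0] eta_id eta_lip eta_flat eta_taylor]]]] :=
  small_extension oft C2ft ltr01.
have K2 : 0 <= K + 2 by rewrite addr_ge0.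
have al01 : 0 < (2^-1 : R) < 1 by apply/andP; split; lra.
exists eta, (fun=> 0), rho, (K + 2), 0, 2^-1; split => //; split => //.
- move=> x y; apply: le_trans (eta_lip x y) _; rewrite ler_wpM2r //; lra.
- by move=> y; apply: le_trans (eta_flat y) _; rewrite ler_wpM2r ?sqr_ge0 // lerDl.
- move=> x; have [J [J1 HJ]] := eta_taylor x; exists J; split=> [v|y].
    by apply: le_trans (J1 v) _; rewrite ler_wpM2r //; lra.
  apply: sqr_le_powR => //; apply: le_trans (ler_normB _ _) _.
  have -> (t : R) : 2 * t = 1 * t + 1 * t by ring.
  by rewrite lerD.
- by move=> x y; rewrite subrr normr0 mul0r.
- by move=> y; rewrite normr0 mul0r.
- by move=> x; exists 0 => y; rewrite mul0mx !subr0 normr0 mul0r.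
Qed.

Lemma linear_conjugate d (S L : 'M[R]_d) : S \in unitmx ->
  locally_topologically_conjugate (mulmx (S *m L *m invmx S)) (mulmx L).
Proof.
move=> Su; exists setT, setT, (mulmx (invmx S)), (mulmx S); split.
- by split; split => //; exact: openT.
- by rewrite mulmx0.
- by move=> x _; split; [exact: I|rewrite mulKVmx|exact: mulmx_continuous].
- by move=> x _; split; [exact: I|rewrite mulKmx|exact: mulmx_continuous].
- by move=> x _ _; rewrite -!mulmxA mulKmx.
Qed.

End Assembly.

(** [phi] vanishes at the fixed point because DMD fits a linear map without constant term: a nonzero
    [phi 0] would dominate the data near the origin. [C] and [delta] are chosen before [m] and [X],
    so the error bound is uniform in the data up to the displayed condition number. *)
Theorem theorem2 (R : realType) (n d : nat) (A : 'M[R]_n)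
    (f ft : 'cV[R]_n -> 'cV[R]_n) (phi : 'cV[R]_n -> 'cV[R]_d)
    (lam : 'I_n -> R[i]) (e : 'M[R[i]]_n)
    (TE : 'M[R]_(n, d)) (LE : 'M[R]_d)
    (PE : 'M[R]_(d, n)) (PF : 'M[R]_(n - d, n)) (beta : R)
    (hd : (1 <= d <= n)%N)
    (* the system *)
    (hf : forall x, f x = A *m x + ft x)
    (hft : ft =o_ (0 : 'cV[R]_n) id)
    (* eigenvalues, generalized eigenvectors, spectral bases *)
    (he : gen_eigenbasis A lam e)
    (hTE : right_spectral_basis A lam (fun i => (i < d)%N) TE)
    (hTE_E : (TE^T == slow_subspace d e)%MS)
    (hLE : A *m TE = TE *m LE)
    (hPE : left_spectral_basis A lam (fun i => (i < d)%N) PE)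
    (hPF : left_spectral_basis A lam (fun i => (d <= i)%N) PF)
    (* (A1) *)
    (hord : forall i j : 'I_n, (i <= j)%N -> `|lam j| <= `|lam i|)
    (hgap : forall i j : 'I_n, (i < d <= j)%N -> `|lam j| < `|lam i|)
    (hstable : forall i : 'I_n, `|lam i| < 1)
    (* (A2) *)
    (hft2 : Ck_near 2 (0 : 'cV[R]_n) ft)
    (* (A3) *)
    (hphi2 : Ck 2 [set: 'cV[R]_n] phi)
    (hphi0 : phi 0 = 0)
    (hphiE : \rank (slow_subspace d e *m (jac phi 0)^T) = d)
    (hbeta : 0 < beta < 1) :
  let S := jac phi 0 *m TE in
  let D0 := S *m LE *m invmx S in
  [/\ S \in unitmx,
      (exists (W : set 'cV[R]_n) (O : set 'cV[R]_d)
              (gam : 'cV[R]_d -> 'cV[R]_n) (r : 'cV[R]_d -> 'cV[R]_d),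
         attracting_SSM f (slow_subspace d e) W O gam r /\
         locally_topologically_conjugate (mulmx D0) (mulmx (jac r 0)))
    & exists C delta : R, [/\ 0 < C, 0 < delta &
        forall (m : nat) (X : 'M[R]_(n, m)),
          let Xhat := colwise f X in
          let Phi := colwise phi X in
          let Phihat := colwise phi (colwise f X) in
          (* (A4) *)
          \rank Phi = d ->
          fnorm (PF *m X) <= fnorm (PE *m X) `^ (1 + beta) ->
          fnorm (PF *m Xhat) <= fnorm (PE *m X) `^ (1 + beta) ->
          fnorm (PE *m X) < delta ->
          fnorm (dmd Phi Phihat - D0)
            <= C * cond_number Phi * fnorm (PE *m X) `^ beta]].
Proof.
move=> S D0; have /andP[d0 dn] := hd.
have [P1 [TF [[PEE P1E] [P1TE PFTE] [[P1TF PFTF] decomp] [P1A PFA] [P1e PFe]]]] :=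
  spectral_splitting dn he hTE hTE_E hLE hPE hPF hgap.
have PETEu : PE *m TE \in unitmx.
  rewrite -row_free_unit; apply: inj_row_free => y yM.
  apply: (row_free_eq0 hPE.1); rewrite PEE mulmxA yM mul0mx //.
have Su : S \in unitmx.
  (* The rows of [TE^T] span the slow subspace, so the rank in the non-degeneracy condition is that
     of [S^T]. *)
  rewrite -unitmx_tr -row_free_unit /row_free trmx_mul.
  by rewrite (eqmxMr _ (eqmxP hTE_E)) hphiE.
split => //.
- have [NA [CA [q [hNA q01 HNA]]]] := stable_norm (leq_trans d0 dn) he hord hstable.
  have [eta [h [rho [K [M [al [hc heta hh]]]]]]] :
      exists (eta : 'cV[R]_n -> 'cV[R]_n) (h : 'cV[R]_d -> 'cV[R]_(n - d)) (rho K M al : R),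
      [/\ [/\ 0 < rho, 0 <= K, 0 <= M & 0 < al < 1],
          small_C1_extension ft eta rho K al &
          invariant_C1_graph P1 PF TE TF LE (PF *m A *m TF) eta h M al].
    have [dn'|nd] := ltnP d n.
      have d0n : (0 < d < n)%N by rewrite d0.
      have [N1 [C1 [N2 [C2 [a [b [[hN1 hN2] LEu H1 H2 [b0 ba a1]]]]]]]] :=
        slow_fast_norms d0n he P1TE PFTF P1A PFA P1e PFe hord hgap hstable.
      exact: (slow_graph P1TE P1TF PFTE PFTF decomp hN1 hN2 LEu H1 H2 b0 ba a1 hft hft2).
    by apply: full_dimension_graph => //; apply/eqP; rewrite subn_eq0.
  have [W [V [gam [r [HW jr]]]]] := ssm_of_graph hf P1TE P1TF PFTE PFTF decomp hLE P1A PFA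
    hNA q01 HNA hTE_E hc heta hh.
  exists W, V, gam, r; split => //; rewrite jr; exact: linear_conjugate.
- have hphi2' : Ck_near 2 (0 : 'cV[R]_n) phi.
    by exists setT => //; split => //; exact: openT.
  have [C [delta [C0 delta0 H]]] := dmd_error hf hft hft2 hphi2' hphi0 PEE PETEu decomp
    hLE Su hbeta.
  exists C, delta; split => // m X Xhat Phi Phihat rk hF _ hp.
  exact: H.
Qed.
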